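(* The following equality of sets is valid: $$\operatorname{V}_f(\Omega;\mathbb{B})=\mathcal{T}_f\left(\operatorname{Hol}(\Omega;\mathbb{B})\right).$$
   Context: $\mathbb{B}$ is the algebra of bicomplex numbers $W=u+\mathbf{j}v$, $u,v\in\mathbb{C}$, $\mathbf{j}^2=-1$, $\mathbf{j}i=i\mathbf{j}$; $\operatorname{Sc}W=u$, $\operatorname{Vec}W=v$, $\overline{W}=u-\mathbf{j}v$. $C^k(\Omega;\mathbb{B})$ is defined componentwise. $\overline{\boldsymbol{\partial}}=\frac12\left(\frac{\partial}{\partial x}+\mathbf{j}\frac{\partial}{\partial y}\right)$, $z=x+iy$. Setting. $\Omega\subset\mathbb{C}$ is a bounded domain star-shaped with respect to $z=0$ (that is, $0\in\Omega$ and $[0,z]\subset\Omega$ for all $z\in\Omega$), and $\varrho_\Omega=\sup_{z\in\Omega}|z|$. The function $q_f\in C^1[0,\varrho_\Omega]$ is complex-valued, and $f\in C^2[0,\varrho_\Omega]$ is complex-valued, nowhere zero on $[0,\varrho_\Omega]$, satisfies $f''(r)+\frac1rf'(r)-q_f(r)f(r)=0$ on $(0,\varrho_\Omega)$, and is normalized by $f(0)=1$, $\lim_{r\to0^+}rf'(r)=0$; $f$ is identified with the radial function $z\mapsto f(|z|)$, assumed to be in $C^2(\overline\Omega)$. Put $q_{\frac1f}=2\left(\frac{f'}{f}\right)^2-q_f$, the potential associated in the same way to $\frac1f$. For $g\in\{f,\frac1f\}$ let $G^g\in C^2([0,\varrho_\Omega]\times[0,1])$ be the kernel (known to exist) satisfying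 $$r\left(G^g_{rr}(r,t)-q_g(r)G^g(r,t)\right)-G^g_r(r,t)+2(1-t)G^g_{rt}(r,t)=0,$$ $$G^g(r,0)=\int_0^r\tau q_g(\tau)\,d\tau,\qquad G^g(0,t)=0,$$ and define, for complex-valued $h\in C(\Omega)$, $\mathbf{T}_gh(z)=h(z)+\int_0^1\sigma\,G^g(|z|,1-\sigma^2)\,h(\sigma^2z)\,d\sigma$. Put $\mathcal{T}_fW=\mathbf{T}_f\operatorname{Sc}W+\mathbf{j}\,\mathbf{T}_{\frac1f}\operatorname{Vec}W$ for $W\in C(\Omega;\mathbb{B})$. $\operatorname{Hol}(\Omega;\mathbb{B})=\{W\in C^1(\Omega;\mathbb{B}):\overline{\boldsymbol{\partial}}W=0\}$, and $\operatorname{V}_f(\Omega;\mathbb{B})$ is the set of $W\in C^1(\Omega;\mathbb{B})$ satisfying the main Vekua equation $\overline{\boldsymbol{\partial}}W=\frac{\overline{\boldsymbol{\partial}}f}{f}\overline{W}$ in $\Omega$. *)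

(* Defs.v *)
From Stdlib Require Import Reals.
From Coquelicot Require Import Coquelicot.

Open Scope R_scope.

(** Functions on a subset of the plane are total functions [C -> _] of which
    only the values on that subset matter.  [C] is [R * R], so it also serves
    as the plane of the pairs (r, t). *)

(** * Differentiation of complex-valued functions of real variables *)

(** As for [Derive], the values are meaningful only where the derivatives
    exist. *)
Definition DeriveC (f : R -> C) (s : R) : C :=
  (Derive (fun x => Re (f x)) s, Derive (fun x => Im (f x)) s).

Definition Dx (u : C -> C) (z : C) : C :=
  DeriveC (fun s => u (s, Im z)) (Re z).
Definition Dy (u : C -> C) (z : C) : C :=
  DeriveC (fun s => u (Re z, s)) (Im z).

(** [f] is in C^k[a, b]: the derivatives up to order [k] exist on the open
    interval and extend continuously to the closed one. *)
Fixpoint Ck_itv (k : nat) (a b : R) (f : R -> C) : Prop :=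
  continuous_on (fun r => a <= r <= b) f /\
  match k with
  | O => True
  | S k' => exists f' : R -> C,
      Ck_itv k' a b f' /\
      forall r, a < r < b -> is_derive (V := C_R_NormedModule) f r (f' r)
  end.

(** For [U] open and [U] included in [D] included in the closure of [U]: the
    real partial derivatives of [u] up to order [k] exist on [U] and extend
    continuously to [D] (with [u] itself continuous on [D]).  Thus [D = U]
    gives C^k(U) and [D = closure U] gives C^k of the closure. *)
Fixpoint Ck (k : nat) (U D : C -> Prop) (u : C -> C) : Prop :=
  continuous_on D u /\
  match k with
  | O => True
  | S k' => exists ux uy : C -> C,
      Ck k' U D ux /\ Ck k' U D uy /\
      forall z, U z ->
        is_derive (V := C_R_NormedModule) (fun s => u (s, Im z)) (Re z) (ux z) /\
        is_derive (V := C_R_NormedModule) (fun s => u (Re z, s)) (Im z) (uy z)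
  end.

(** * Planar sets *)

Definition closure (U : C -> Prop) (z : C) : Prop :=
  forall P : C -> Prop, locally z P -> exists w, P w /\ U w.

Definition connected (U : C -> Prop) : Prop :=
  forall A B : C -> Prop, open A -> open B ->
    (forall z, U z -> A z \/ B z) ->
    (exists z, U z /\ A z) -> (exists z, U z /\ B z) ->
    exists z, U z /\ A z /\ B z.

Definition planar_domain (U : C -> Prop) : Prop :=
  (exists z, U z) /\ open U /\ connected U.

Definition bounded_set (U : C -> Prop) : Prop :=
  exists M : R, forall z, U z -> Cmod z <= M.

Definition star_shaped0 (U : C -> Prop) : Prop :=
  U (RtoC 0) /\
  forall z (t : R), U z -> 0 <= t <= 1 -> U (RtoC t * z)%C.

Definition is_sup_modulus (U : C -> Prop) (rho : R) : Prop :=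
  is_lub (fun r => exists z, U z /\ r = Cmod z) rho.

(** * Bicomplex numbers *)

(** [mkB u v] is u + j v. *)
Record Bicomplex : Type := mkB { Sc : C; Vec : C }.

Definition Bplus (W Z : Bicomplex) : Bicomplex :=
  mkB (Sc W + Sc Z)%C (Vec W + Vec Z)%C.
Definition Bmult (W Z : Bicomplex) : Bicomplex :=
  mkB (Sc W * Sc Z - Vec W * Vec Z)%C (Sc W * Vec Z + Vec W * Sc Z)%C.
Definition Bconj (W : Bicomplex) : Bicomplex := mkB (Sc W) (- Vec W)%C.
Definition CtoB (u : C) : Bicomplex := mkB u (RtoC 0).
Definition Bj : Bicomplex := mkB (RtoC 0) (RtoC 1).

Definition BCk (k : nat) (U : C -> Prop) (W : C -> Bicomplex) : Prop :=
  Ck k U U (fun z => Sc (W z)) /\ Ck k U U (fun z => Vec (W z)).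

Definition BDx (W : C -> Bicomplex) (z : C) : Bicomplex :=
  mkB (Dx (fun w => Sc (W w)) z) (Dx (fun w => Vec (W w)) z).
Definition BDy (W : C -> Bicomplex) (z : C) : Bicomplex :=
  mkB (Dy (fun w => Sc (W w)) z) (Dy (fun w => Vec (W w)) z).

Definition dbar (W : C -> Bicomplex) (z : C) : Bicomplex :=
  Bmult (CtoB (RtoC (1 / 2))) (Bplus (BDx W z) (Bmult Bj (BDy W z))).

Definition Hol (U : C -> Prop) (W : C -> Bicomplex) : Prop :=
  BCk 1 U W /\ forall z, U z -> dbar W z = CtoB (RtoC 0).

Definition radial (f : R -> C) (z : C) : C := f (Cmod z).

(** The complex-valued [f] does not vanish, so dividing by it in the bicomplex
    algebra is multiplying by its complex inverse. *)
Definition Vekua (U : C -> Prop) (f : R -> C) (W : C -> Bicomplex) : Prop :=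
  BCk 1 U W /\
  forall z, U z ->
    dbar W z =
    Bmult (Bmult (dbar (fun w => CtoB (radial f w)) z) (CtoB (/ radial f z)%C))
          (Bconj (W z)).

(** * Potentials, kernels and transmutation operators *)

Definition radial_solution (rho : R) (q f : R -> C) : Prop :=
  forall r, 0 < r < rho ->
    (DeriveC (DeriveC f) r + RtoC (1 / r) * DeriveC f r - q r * f r)%C = RtoC 0.

(** Only used on the open interval (0, rho), where [DeriveC f] is the
    derivative of [f]; the integral in [is_kernel] ignores the endpoints. *)
Definition q_inv (q f : R -> C) (r : R) : C :=
  (RtoC 2 * ((DeriveC f r / f r) * (DeriveC f r / f r)) - q r)%C.

(** The differential equation is required in the interior; it extends to the
    closed rectangle by continuity whenever [q] does. *)
Definition is_kernel (rho : R) (q : R -> C) (G : R -> R -> C) : Prop :=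
  let G_r := fun r t => DeriveC (fun s => G s t) r in
  let G_rr := fun r t => DeriveC (fun s => G_r s t) r in
  let G_rt := fun r t => DeriveC (fun s => G_r r s) t in
  Ck 2 (fun p => 0 < fst p < rho /\ 0 < snd p < 1)
       (fun p => 0 <= fst p <= rho /\ 0 <= snd p <= 1)
       (fun p => G (fst p) (snd p)) /\
  (forall r t, 0 < r < rho -> 0 < t < 1 ->
     (RtoC r * (G_rr r t - q r * G r t) - G_r r t
      + RtoC (2 * (1 - t)) * G_rt r t)%C = RtoC 0) /\
  (forall r, 0 <= r <= rho ->
     G r 0 = RInt (V := C_R_CompleteNormedModule)
               (fun tau => (RtoC tau * q tau)%C) 0 r) /\
  (forall t, 0 <= t <= 1 -> G 0 t = RtoC 0).

Definition Top (G : R -> R -> C) (h : C -> C) (z : C) : C :=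
  (h z + RInt (V := C_R_CompleteNormedModule)
           (fun sigma => (RtoC sigma * G (Cmod z) (1 - sigma ^ 2)%R
                          * h (RtoC (sigma ^ 2)%R * z))%C) 0 1)%C.

(** [Gf] and [Gi] are the kernels associated with f and 1/f. *)
Definition Tcal (Gf Gi : R -> R -> C) (W : C -> Bicomplex) (z : C) : Bicomplex :=
  mkB (Top Gf (fun w => Sc (W w)) z) (Top Gi (fun w => Vec (W w)) z).

(* Main.v *)
Require Import Defs.
From Stdlib Require Import Reals Lra Lia ClassicalEpsilon Classical.
From Coquelicot Require Import Coquelicot.

(** Write r = |z| and p = f' / f, and let D = x d/dx + y d/dy and
    R = - y d/dx + x d/dy be the Euler and the rotation field.  Away from the
    origin the main Vekua equation for W = w1 + j w2 says that
      D w1 - r p w1 = R w2   and   D w2 + r p w2 = - R w1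
    ([Vekua_polar]), and W is holomorphic when this holds with p = 0
    ([Hol_polar]); at the origin both Cartesian systems follow by continuity.

    The operators T_f and T_{1/f} integrate along rays against kernels that
    depend on z only through r, hence commute with R ([Tr_rot]).  The theorem
    rests on the two intertwining relations
      (D - r p) T_f = T_{1/f} D   and   (D + r p) T_{1/f} = T_f D
    ([Tr_euler]).  By an integration by parts along the rays
    ([radial_by_parts]) the first of them reduces to
      r (G_r - p G) + ((1 - t) (G - K))_t = 0   and   (G - K)(r, 0) = 2 r p(r)
    for the kernels G and K of f and 1/f, and the second to the same with the
    kernels exchanged and p replaced by - p.  The condition at t = 0 is the
    Riccati equation (r p)' = r (q - p^2).  For the rest, let S and E be the sum
    and the difference of the left-hand sides of the two identities.  The
    second-order equations of the kernels give
      E_r = - p S   and   r S_r + 2 (1 - t) S_t - 2 S = - r p E,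
    with S = 0 at t = 0 and S = E = 0 at r = 0.  In the energy
    int_0^1 (1 - t) (|S|^2 + |E|^2) dt the weight 1 - t cancels the boundary
    terms, so that its derivative is at most 2 sup |p| times the energy, which
    is therefore zero ([defects_vanish]).

    Integrated over t, divided by r and taken to the limit r = 0, the same
    identity yields int_0^1 s G_r(0, 1 - s^2) ds = 0, because p(0) = 0
    ([sker_Gr_mean_zero]).  This is what makes T_f h of class C^1 at the origin
    for h of class C^1 ([VI_C1dir]), although |z| is not differentiable there.

    Each operator is also bijective.  As G(0, t) = 0, its integral part is of
    Volterra type on every ray; in a norm weighted by exp (- 4 c |z|) it
    contracts by 1/4, so the Neumann series converges together with its
    directional derivatives ([Neumann_solves], [Neumann_C1dir]), and the
    solution is unique ([Volterra_unique]).  If W solves the Vekua equation and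
    a, b are the preimages of its components, the intertwining relations give
    T_{1/f} (D a - R b) = 0 and T_f (D b + R a) = 0, so a + j b is holomorphic.
    The converse inclusion is the same computation read backwards. *)

Open Scope R_scope.

(* The plane as a real normed module: derivatives, integrals and continuity of
   complex-valued maps. *)
Local Notation is_derC := (is_derive (K := R_AbsRing) (V := C_R_NormedModule)).
Local Notation RIntC := (RInt (V := C_R_CompleteNormedModule)).
Local Notation ex_RIntC := (ex_RInt (V := C_R_CompleteNormedModule)).
Local Notation RIntC_ext := (RInt_ext (V := C_R_CompleteNormedModule)).
Local Notation RIntC_correct := (RInt_correct (V := C_R_CompleteNormedModule)).
Local Notation ex_derive_continuous_R := (ex_derive_continuous (V := R_NormedModule)).
Local Notation contC := (continuous (U := C_UniformSpace)).

(* [ring] and [field] require an equation in [C] itself, not in the carrier of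
   a module that is convertible to it. *)
Ltac ceq := match goal with |- @eq _ ?a ?b => change (@eq C a b) end.
Ltac cring := ceq; ring.
Ltac cfield := ceq; field.

(** * Calculus of complex-valued functions of real variables *)

Lemma ball_R (x y e : R) : Rabs (y - x) < e -> ball x e y.
Proof. trivial. Qed.

Lemma ball_R_inv (x y e : R) : ball x e y -> Rabs (y - x) < e.
Proof. trivial. Qed.

Lemma continuous_C_iff {U : UniformSpace} (f : U -> C) (x : U) :
  contC f x <->
  continuous (fun y => Re (f y)) x /\ continuous (fun y => Im (f y)) x.
Proof.
  split.
  - intros H; split.
    + apply (continuous_comp f (fst : C -> R) x H), continuous_fst.
    + apply (continuous_comp f (snd : C -> R) x H), continuous_snd.
  - intros [H1 H2].
    apply continuous_ext with (fun y => (Re (f y), Im (f y))).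
    { intros y; now destruct (f y). }
    apply (continuous_comp_2 (fun y => Re (f y)) (fun y => Im (f y))
             (fun a b => (a, b) : C) x H1 H2).
    apply continuous_ext with (fun p : R * R => p).
    { now intros []. }
    apply continuous_id.
Qed.

Lemma continuous_Cplus {U : UniformSpace} (f g : U -> C) x :
  contC f x -> contC g x -> contC (fun y => f y + g y)%C x.
Proof.
  intros Hf Hg; apply continuous_C_iff in Hf as [? ?];
    apply continuous_C_iff in Hg as [? ?].
  apply continuous_C_iff; split; simpl; now apply (continuous_plus (V := R_NormedModule)).
Qed.

Lemma continuous_Copp {U : UniformSpace} (f : U -> C) x :
  contC f x -> contC (fun y => - f y)%C x.
Proof.
  intros Hf; apply continuous_C_iff in Hf as [? ?].
  apply continuous_C_iff; split; simpl; now apply (continuous_opp (V := R_NormedModule)).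
Qed.

Lemma continuous_Cminus {U : UniformSpace} (f g : U -> C) x :
  contC f x -> contC g x -> contC (fun y => f y - g y)%C x.
Proof. intros; now apply continuous_Cplus, continuous_Copp. Qed.

Lemma continuous_Rmult {U : UniformSpace} (f g : U -> R) x :
  continuous f x -> continuous g x -> continuous (fun y => f y * g y) x.
Proof. apply (continuous_mult (K := R_AbsRing)). Qed.

Lemma continuous_Rplus {U : UniformSpace} (f g : U -> R) x :
  continuous f x -> continuous g x -> continuous (fun y => f y + g y) x.
Proof. apply (continuous_plus (V := R_NormedModule)). Qed.

Lemma continuous_Rminus {U : UniformSpace} (f g : U -> R) x :
  continuous f x -> continuous g x -> continuous (fun y => f y - g y) x.
Proof. apply (continuous_minus (V := R_NormedModule)). Qed.

Lemma continuous_Cmult {U : UniformSpace} (f g : U -> C) x :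
  contC f x -> contC g x -> contC (fun y => f y * g y)%C x.
Proof.
  intros Hf Hg; apply continuous_C_iff in Hf as [? ?];
    apply continuous_C_iff in Hg as [? ?].
  apply continuous_C_iff; split; simpl.
  - apply continuous_Rminus; now apply continuous_Rmult.
  - apply continuous_Rplus; now apply continuous_Rmult.
Qed.

Lemma continuous_RtoC {U : UniformSpace} (f : U -> R) x :
  continuous f x -> contC (fun y => RtoC (f y)) x.
Proof.
  intros Hf; apply continuous_C_iff; split; simpl; trivial.
  apply continuous_const.
Qed.

Lemma continuous_sqrt_R (x : R) : continuous sqrt x.
Proof.
  destruct (Rle_lt_dec 0 x) as [H|H].
  - apply continuity_pt_filterlim, continuity_pt_sqrt, H.
  - apply continuous_ext_loc with (fun _ : R => 0).
    + exists (mkposreal (- x) ltac:(lra)); intros y Hy.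
      apply ball_R_inv, Rabs_def2 in Hy; simpl in Hy; rewrite sqrt_neg_0; lra.
    + apply continuous_const.
Qed.

Lemma continuous_Cmod_comp {U : UniformSpace} (f : U -> C) x :
  contC f x -> continuous (fun y => Cmod (f y)) x.
Proof.
  intros Hf; apply continuous_C_iff in Hf as [? ?].
  unfold Cmod.
  apply (continuous_comp (fun y => fst (f y) ^ 2 + snd (f y) ^ 2) sqrt).
  - simpl; apply continuous_Rplus; (apply continuous_Rmult; [assumption|]);
      (apply continuous_Rmult; [assumption|apply continuous_const]).
  - apply continuous_sqrt_R.
Qed.

(** The real inner product and the squared modulus in the plane. *)
Definition dotC (z w : C) : R := Re z * Re w + Im z * Im w.
Definition sqmod (z : C) : R := Re z * Re z + Im z * Im z.

Lemma continuous_dotC {U : UniformSpace} (f g : U -> C) x :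
  contC f x -> contC g x -> continuous (fun y => dotC (f y) (g y)) x.
Proof.
  intros H H'; apply continuous_C_iff in H as [? ?]; apply continuous_C_iff in H' as [? ?].
  unfold dotC; apply continuous_Rplus; now apply continuous_Rmult.
Qed.

Lemma continuous_sqmod {U : UniformSpace} (f : U -> C) x :
  contC f x -> continuous (fun y => sqmod (f y)) x.
Proof. intros H; now apply (continuous_dotC f f). Qed.

(* Continuity of an expression from that of its parts, by its syntactic shape. *)
Ltac cont_leaf := try assumption.
Ltac cont :=
  lazymatch goal with
  | |- continuous (fun y => Cminus (@?f y) (@?g y)) ?x => apply (continuous_Cminus f g x); cont
  | |- continuous (fun y => Cplus (@?f y) (@?g y)) ?x => apply (continuous_Cplus f g x); cont
  | |- continuous (fun y => Cmult (@?f y) (@?g y)) ?x => apply (continuous_Cmult f g x); cont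
  | |- continuous (fun y => Copp (@?f y)) ?x => apply (continuous_Copp f x); cont
  | |- continuous (fun y => RtoC (@?f y)) ?x => apply (continuous_RtoC f x); cont
  | |- continuous (fun y => Rminus (@?f y) (@?g y)) ?x => apply (continuous_Rminus f g x); cont
  | |- continuous (fun y => Rplus (@?f y) (@?g y)) ?x => apply (continuous_Rplus f g x); cont
  | |- continuous (fun y => Rmult (@?f y) (@?g y)) ?x => apply (continuous_Rmult f g x); cont
  | |- continuous (fun y => Cmod (@?f y)) ?x => apply (continuous_Cmod_comp f x); cont
  | |- continuous (fun y => dotC (@?f y) (@?g y)) ?x => apply (continuous_dotC f g x); cont
  | |- continuous (fun y => sqmod (@?f y)) ?x => apply (continuous_sqmod f x); cont
  | |- continuous (fun y => y) _ => apply continuous_id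
  | |- continuous fst (_, _) => apply continuous_fst
  | |- continuous snd (_, _) => apply continuous_snd
  | |- continuous (fun y => fst y) (_, _) => apply continuous_fst
  | |- continuous (fun y => snd y) (_, _) => apply continuous_snd
  | |- continuous (fun _ => ?c) _ => apply continuous_const
  | H : forall x, continuous ?f x |- continuous ?f _ => exact (H _)
  | |- continuous _ _ => cont_leaf
  end.

Lemma is_derC_iff (f : R -> C) (x : R) (l : C) :
  is_derC f x l <->
  is_derive (fun y => Re (f y)) x (Re l) /\ is_derive (fun y => Im (f y)) x (Im l).
Proof.
  split.
  - intros H; split.
    + exact (filterdiff_comp' (U := AbsRing_NormedModule R_AbsRing)
        (V := C_R_NormedModule) (W := R_NormedModule) f (fun t : C => fst t) x
        (fun y => scal y l) (fun t : C => fst t) H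
        (filterdiff_linear _ (is_linear_fst (U := R_NormedModule) (V := R_NormedModule)))).
    + exact (filterdiff_comp' (U := AbsRing_NormedModule R_AbsRing)
        (V := C_R_NormedModule) (W := R_NormedModule) f (fun t : C => snd t) x
        (fun y => scal y l) (fun t : C => snd t) H
        (filterdiff_linear _ (is_linear_snd (U := R_NormedModule) (V := R_NormedModule)))).
  - intros [H1 H2].
    apply (filterdiff_ext (U := AbsRing_NormedModule R_AbsRing) (V := C_R_NormedModule)
             (fun y => (Re (f y), Im (f y)) : C)).
    { intros y; now destruct (f y). }
    apply (filterdiff_ext_lin (U := AbsRing_NormedModule R_AbsRing)
             (V := C_R_NormedModule) _ (fun y => (scal y (Re l), scal y (Im l)) : C)).
    + apply (filterdiff_comp'_2 (T := AbsRing_NormedModule R_AbsRing)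
        (U := R_NormedModule)
        (V := R_NormedModule) (W := C_R_NormedModule)
        (fun y => Re (f y)) (fun y => Im (f y)) (fun a b => (a, b) : C) x _ _
        (fun a b => (a, b) : C) H1 H2).
      apply (filterdiff_ext (U := C_R_NormedModule) (V := C_R_NormedModule)
               (fun p => p)).
      { now intros []. }
      apply (filterdiff_ext_lin (U := C_R_NormedModule) (V := C_R_NormedModule)
               _ (fun p => p)).
      * apply filterdiff_id.
      * now intros [].
    + intros y; now destruct l.
Qed.

(** The real part for [true], the imaginary part for [false]: statements about
    both components are proved once for [cpt i]. *)
Definition cpt (i : bool) (z : C) : R := if i then Re z else Im z.

Lemma Ceq_cpt a b : (forall i, cpt i a = cpt i b) -> a = b.
Proof. intros H; destruct a, b; f_equal; [apply (H true)|apply (H false)]. Qed.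

Lemma continuous_cpt {U : UniformSpace} (f : U -> C) x i :
  contC f x -> continuous (fun y => cpt i (f y)) x.
Proof. rewrite continuous_C_iff; destruct i; tauto. Qed.

Lemma continuous_of_cpt {U : UniformSpace} (f : U -> C) x :
  (forall i, continuous (fun y => cpt i (f y)) x) -> contC f x.
Proof. intros H; apply continuous_C_iff; split; [apply (H true)|apply (H false)]. Qed.

Lemma is_derC_cpt f x l i : is_derC f x l -> is_derive (fun y => cpt i (f y)) x (cpt i l).
Proof. rewrite is_derC_iff; destruct i; tauto. Qed.

Lemma is_derC_of_cpt f x l :
  (forall i, is_derive (fun y => cpt i (f y)) x (cpt i l)) -> is_derC f x l.
Proof. intros H; apply is_derC_iff; split; [apply (H true)|apply (H false)]. Qed.

Lemma is_derC_const (c : C) x : is_derC (fun _ => c) x (RtoC 0).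
Proof.
  apply is_derC_iff; split; simpl; apply (is_derive_const (V := R_NormedModule)).
Qed.

Lemma is_derC_plus f g x l m :
  is_derC f x l -> is_derC g x m -> is_derC (fun y => f y + g y)%C x (l + m)%C.
Proof.
  rewrite !is_derC_iff; intros [? ?] [? ?]; split; simpl;
    now apply (is_derive_plus (V := R_NormedModule)).
Qed.

Lemma is_derC_opp f x l : is_derC f x l -> is_derC (fun y => - f y)%C x (- l)%C.
Proof.
  rewrite !is_derC_iff; intros [? ?]; split; simpl;
    now apply (is_derive_opp (V := R_NormedModule)).
Qed.

Lemma is_derC_minus f g x l m :
  is_derC f x l -> is_derC g x m -> is_derC (fun y => f y - g y)%C x (l - m)%C.
Proof. intros; now apply is_derC_plus, is_derC_opp. Qed.

Lemma is_derive_eq (f : R -> R) x l m : is_derive f x l -> l = m -> is_derive f x m.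
Proof. now intros H <-. Qed.

Lemma is_derC_eq f x l m : is_derC f x l -> l = m -> is_derC f x m.
Proof. now intros H <-. Qed.

Lemma is_derive_Rmult (f g : R -> R) x l m :
  is_derive f x l -> is_derive g x m ->
  is_derive (fun y => f y * g y) x (l * g x + f x * m).
Proof.
  intros Hf Hg.
  apply (is_derive_mult (K := R_AbsRing) f g x l m Hf Hg).
  intros; apply Rmult_comm.
Qed.

Lemma is_derC_mult f g x l m :
  is_derC f x l -> is_derC g x m ->
  is_derC (fun y => f y * g y)%C x (l * g x + f x * m)%C.
Proof.
  rewrite !is_derC_iff; intros [? ?] [? ?]; split; simpl.
  - eapply is_derive_eq.
    + apply (is_derive_minus (V := R_NormedModule)); apply is_derive_Rmult; eassumption.
    + unfold minus, plus, opp; simpl; unfold Re, Im; ring.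
  - eapply is_derive_eq.
    + apply (is_derive_plus (V := R_NormedModule)); apply is_derive_Rmult; eassumption.
    + unfold minus, plus, opp; simpl; unfold Re, Im; ring.
Qed.

Lemma is_derC_RtoC (f : R -> R) x l :
  is_derive f x l -> is_derC (fun y => RtoC (f y)) x (RtoC l).
Proof.
  intros; apply is_derC_iff; split; simpl; trivial.
  apply (is_derive_const (V := R_NormedModule)).
Qed.

Lemma is_derC_inv f x l :
  is_derC f x l -> f x <> RtoC 0 ->
  is_derC (fun y => / f y)%C x (- l / (f x * f x))%C.
Proof.
  rewrite !is_derC_iff; intros [H1 H2] Hn.
  assert (Hn' : Re (f x) ^ 2 + Im (f x) ^ 2 <> 0).
  { intros H0; apply Hn.
    assert (Re (f x) = 0) by nra. assert (Im (f x) = 0) by nra.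
    destruct (f x); simpl in *; now subst. }
  assert (Hd : is_derive (fun y => Re (f y) ^ 2 + Im (f y) ^ 2) x
                 (2 * Re (f x) * Re l + 2 * Im (f x) * Im l)).
  { eapply is_derive_eq.
    - apply (is_derive_plus (V := R_NormedModule)); apply is_derive_pow; eassumption.
    - unfold plus; simpl; ring. }
  assert (Hn2 : (Re (f x) * Re (f x) - Im (f x) * Im (f x)) ^ 2
                + (Re (f x) * Im (f x) + Im (f x) * Re (f x)) ^ 2 <> 0).
  { replace (_ + _) with ((Re (f x) ^ 2 + Im (f x) ^ 2) ^ 2) by ring.
    now apply pow_nonzero. }
  split.
  - eapply is_derive_eq.
    + apply (is_derive_div (fun y => Re (f y)) (fun y => Re (f y) ^ 2 + Im (f y) ^ 2)
               x _ _ H1 Hd Hn').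
    + destruct (f x) as [u v], l as [a b]; simpl in *. field.
      split; intros H; [apply Hn2|apply Hn']; simpl in *; lra.
  - eapply is_derive_eq.
    + apply (is_derive_div (fun y => - Im (f y)) (fun y => Re (f y) ^ 2 + Im (f y) ^ 2)
               x _ _ (is_derive_opp (V := R_NormedModule) _ _ _ H2) Hd Hn').
    + destruct (f x) as [u v], l as [a b]; simpl in *. unfold opp; simpl. field.
      split; intros H; [apply Hn2|apply Hn']; simpl in *; lra.
Qed.

Lemma is_derC_comp (f : R -> C) (g : R -> R) x l m :
  is_derC f (g x) l -> is_derive g x m ->
  is_derC (fun y => f (g y)) x (RtoC m * l)%C.
Proof.
  rewrite !is_derC_iff; intros [? ?] Hg; split.
  - eapply is_derive_eq.
    + apply (is_derive_comp (fun y => Re (f y)) g x _ _ H Hg).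
    + unfold scal; simpl; unfold mult; simpl; unfold Re, Im; ring.
  - eapply is_derive_eq.
    + apply (is_derive_comp (fun y => Im (f y)) g x _ _ H0 Hg).
    + unfold scal; simpl; unfold mult; simpl; unfold Re, Im; ring.
Qed.

Lemma is_derC_unique f x l m : is_derC f x l -> is_derC f x m -> l = m.
Proof.
  rewrite !is_derC_iff; intros [H1 H2] [H3 H4].
  apply is_derive_unique in H1, H2, H3, H4.
  destruct l, m; simpl in *; congruence.
Qed.

Lemma DeriveC_unique f x l : is_derC f x l -> DeriveC f x = l.
Proof.
  rewrite is_derC_iff; intros [H1 H2]; destruct l as [a b]; unfold DeriveC.
  f_equal; now apply is_derive_unique.
Qed.

Lemma is_derC_ext_loc f g x l :
  locally x (fun y => f y = g y) -> is_derC f x l -> is_derC g x l.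
Proof. intros; eapply (is_derive_ext_loc (V := C_R_NormedModule)); eassumption. Qed.

Lemma ex_RIntC_continuous f a b :
  (forall x, Rmin a b <= x <= Rmax a b -> contC f x) -> ex_RIntC f a b.
Proof. intros; now apply (ex_RInt_continuous (V := C_R_CompleteNormedModule)). Qed.

Lemma is_RIntC_pair f a b l :
  is_RInt (V := C_R_NormedModule) f a b l <->
  is_RInt (fun x => Re (f x)) a b (Re l) /\ is_RInt (fun x => Im (f x)) a b (Im l).
Proof.
  split.
  - intros H; split.
    + now apply (is_RInt_fct_extend_fst (U := R_NormedModule) (V := R_NormedModule)).
    + now apply (is_RInt_fct_extend_snd (U := R_NormedModule) (V := R_NormedModule)).
  - intros [H1 H2].
    assert (H := is_RInt_fct_extend_pair (U := R_NormedModule) (V := R_NormedModule)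
                   f a b _ _ H1 H2).
    now destruct l.
Qed.

Lemma RIntC_cpt i f a b :
  ex_RIntC f a b -> cpt i (RIntC f a b) = RInt (fun x => cpt i (f x)) a b.
Proof.
  intros H; apply RInt_correct, is_RIntC_pair in H as [H1 H2].
  symmetry; destruct i; now apply is_RInt_unique.
Qed.

Lemma RIntC_plus f g a b : ex_RIntC f a b -> ex_RIntC g a b ->
  RIntC (fun x => f x + g x)%C a b = (RIntC f a b + RIntC g a b)%C.
Proof. apply (RInt_plus (V := C_R_CompleteNormedModule)). Qed.

Lemma RIntC_opp f a b : ex_RIntC f a b ->
  RIntC (fun x => - f x)%C a b = (- RIntC f a b)%C.
Proof. apply (RInt_opp (V := C_R_CompleteNormedModule)). Qed.

Lemma RIntC_minus f g a b : ex_RIntC f a b -> ex_RIntC g a b ->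
  RIntC (fun x => f x - g x)%C a b = (RIntC f a b - RIntC g a b)%C.
Proof. apply (RInt_minus (V := C_R_CompleteNormedModule)). Qed.

Lemma Ceq (a b : C) : Re a = Re b -> Im a = Im b -> a = b.
Proof. destruct a, b; simpl; congruence. Qed.

Lemma is_RIntC_scal c f a b l :
  is_RInt (V := C_R_NormedModule) f a b l ->
  is_RInt (V := C_R_NormedModule) (fun x => c * f x)%C a b (c * l)%C.
Proof.
  rewrite !is_RIntC_pair; intros [H1 H2]; split; simpl.
  - apply (is_RInt_minus (V := R_NormedModule));
      now apply (is_RInt_scal (V := R_NormedModule)).
  - apply (is_RInt_plus (V := R_NormedModule));
      now apply (is_RInt_scal (V := R_NormedModule)).
Qed.

Lemma ex_RIntC_scal c f a b : ex_RIntC f a b -> ex_RIntC (fun x => c * f x)%C a b.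
Proof. intros [l Hl]; exists (c * l)%C; now apply is_RIntC_scal. Qed.

Lemma RIntC_scal c f a b : ex_RIntC f a b ->
  RIntC (fun x => c * f x)%C a b = (c * RIntC f a b)%C.
Proof.
  intros H; apply is_RInt_unique, is_RIntC_scal.
  now apply RIntC_correct.
Qed.

Lemma Cmod_RIntC_le f (g : R -> R) a b :
  a <= b -> ex_RIntC f a b -> ex_RInt g a b ->
  (forall x, a <= x <= b -> Cmod (f x) <= g x) ->
  Cmod (RIntC f a b) <= RInt g a b.
Proof.
  intros Hab Hf Hg H; rewrite Cmod_norm.
  apply (norm_RInt_le (V := C_R_NormedModule) f g a b); trivial.
  - intros; rewrite <- Cmod_norm; auto.
  - now apply RIntC_correct.
  - now apply (RInt_correct (V := R_CompleteNormedModule)).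
Qed.

Lemma Cmod_RIntC_le_const f M a b :
  a <= b -> ex_RIntC f a b ->
  (forall x, a <= x <= b -> Cmod (f x) <= M) ->
  Cmod (RIntC f a b) <= (b - a) * M.
Proof.
  intros Hab Hf H; rewrite Cmod_norm.
  apply (norm_RInt_le_const (V := C_R_NormedModule) f a b); trivial.
  { intros; rewrite <- Cmod_norm; auto. }
  now apply RIntC_correct.
Qed.

(** Continuity of a map into the plane, through the modulus. *)
Lemma continuous_C_eps {U : UniformSpace} (f : U -> C) x :
  contC f x <->
  forall eps : posreal, locally x (fun y => Cmod (f y - f x)%C < eps).
Proof.
  split.
  - intros H eps.
    assert (Hc : continuous (fun y => Cmod (f y - f x)%C) x).
    { apply continuous_Cmod_comp, continuous_Cminus; trivial; apply continuous_const. }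
    assert (H0 : locally (Cmod (f x - f x)%C) (fun r => r < eps)).
    { replace (f x - f x)%C with (RtoC 0) by ring; rewrite Cmod_0.
      exists eps; intros y Hy; apply Rabs_def2 in Hy.
      unfold minus, plus, opp in Hy; simpl in Hy; lra. }
    exact (Hc _ H0).
  - intros H; apply (filterlim_locally (U := C_UniformSpace)); intros eps.
    generalize (H eps); apply filter_imp; intros y Hy.
    apply (norm_compat1 (V := C_R_NormedModule)).
    now rewrite <- Cmod_norm.
Qed.

(** * Integrals depending on a variable *)

(** A property that holds near every point of the segment {x0} x [a, b] holds,
    for all x near x0, on the whole of [a, b]. *)
Lemma locally_tube {U : UniformSpace} (P : U -> R -> Prop) (x0 : U) (a b : R) :
  (forall t, a <= t <= b -> locally (x0, t) (fun p => P (fst p) (snd p))) ->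
  locally x0 (fun x => forall t, a <= t <= b -> P x t).
Proof.
  intros H.
  assert (H' : forall t, exists d : posreal, a <= t <= b ->
    forall x s, ball x0 d x -> ball t d s -> P x s).
  { intros t; destruct (classic (a <= t <= b)) as [Ht|Ht].
    - destruct (H t Ht) as [d Hd]; exists d; intros _ x s Hx Hs.
      apply (Hd (x, s)); now split.
    - exists (mkposreal 1 Rlt_0_1); tauto. }
  set (delta := fun t => proj1_sig (constructive_indefinite_description _ (H' t))).
  assert (Hdelta : forall t, a <= t <= b ->
    forall x s, ball x0 (delta t) x -> ball t (delta t) s -> P x s).
  { intros t; unfold delta;
      now destruct (constructive_indefinite_description _ (H' t)). }
  destruct (compactness_value_1d a b delta) as [d Hd].
  exists d; intros x Hx s Hs.
  apply NNPP; intros Hn; apply (Hd s Hs); intros [t [Ht [Hst Hdt]]]; apply Hn.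
  apply (Hdelta t Ht).
  - now apply ball_le with d.
  - exact Hst.
Qed.

Lemma continuous_RIntC_param {U : UniformSpace} (F : U -> R -> C) (x0 : U) (a b : R) :
  a <= b ->
  locally x0 (fun x => forall t, a <= t <= b -> contC (F x) t) ->
  (forall t, a <= t <= b -> contC (fun p : U * R => F (fst p) (snd p)) (x0, t)) ->
  contC (fun x => RIntC (F x) a b) x0.
Proof.
  intros Hab Hloc Hj.
  apply continuous_C_eps; intros eps.
  assert (Hloc0 := locally_singleton _ _ Hloc).
  assert (Heps : 0 < eps / (2 * (b - a + 1))).
  { apply Rdiv_lt_0_compat; [apply cond_pos|lra]. }
  assert (Ht : locally x0 (fun x => forall t, a <= t <= b ->
    Cmod (F x t - F x0 t)%C < eps / (2 * (b - a + 1)))).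
  { apply (locally_tube (fun x t => Cmod (F x t - F x0 t)%C < eps / (2 * (b - a + 1)))).
    intros t Ht.
    assert (Hc : contC (fun p : U * R => F (fst p) (snd p) - F x0 (snd p))%C (x0, t)).
    { apply continuous_Cminus; [now apply Hj|].
      apply (continuous_comp snd (F x0)); [apply continuous_snd|now apply Hloc0]. }
    assert (Hc' := proj1 (continuous_C_eps _ _) Hc (mkposreal _ Heps)).
    revert Hc'; apply filter_imp; intros [x s]; simpl.
    replace (F x s - F x0 s - (F x0 t - F x0 t))%C with (F x s - F x0 s)%C by ring.
    trivial. }
  generalize (filter_and _ _ Hloc Ht); apply filter_imp; intros x [Hx1 Hx2].
  assert (E1 : ex_RIntC (F x) a b).
  { apply ex_RIntC_continuous; rewrite Rmin_left, Rmax_right; trivial. }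
  assert (E2 : ex_RIntC (F x0) a b).
  { apply ex_RIntC_continuous; rewrite Rmin_left, Rmax_right; trivial. }
  rewrite <- RIntC_minus; trivial.
  apply Rle_lt_trans with ((b - a) * (eps / (2 * (b - a + 1)))).
  - apply Cmod_RIntC_le_const; trivial.
    + now apply (ex_RInt_minus (V := C_R_NormedModule)).
    + intros t Ht'; left; now apply Hx2.
  - apply Rlt_le_trans with ((2 * (b - a + 1)) * (eps / (2 * (b - a + 1)))).
    + apply Rmult_lt_compat_r; [trivial|lra].
    + right; field; lra.
Qed.

Lemma continuous_pairR {U : UniformSpace} (f g : U -> R) x :
  continuous f x -> continuous g x -> continuous (fun y => (f y, g y)) x.
Proof. intros; apply (proj2 (continuous_C_iff (fun y => (f y, g y) : C) x)); now split. Qed.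

Lemma is_derive_RInt_param_everywhere (F F' : R -> R -> R) (s0 a b : R) :
  a <= b ->
  locally s0 (fun s => forall t, is_derive (fun u => F u t) s (F' s t)) ->
  locally s0 (fun s => forall t, a <= t <= b -> continuous (F s) t) ->
  (forall t, a <= t <= b -> continuous (fun p : R * R => F' (fst p) (snd p)) (s0, t)) ->
  is_derive (fun s => RInt (F s) a b) s0 (RInt (F' s0) a b).
Proof.
  intros Hab Hd Hc Hj.
  assert (Hd0 := locally_singleton _ _ Hd).
  rewrite (RInt_ext (F' s0) (fun t => Derive (fun u => F u t) s0)).
  2:{ intros t _; symmetry; apply is_derive_unique, Hd0. }
  apply is_derive_RInt_param.
  - revert Hd; apply filter_imp; intros s Hs t _; eexists; apply Hs.
  - rewrite Rmin_left, Rmax_right; trivial; intros t Ht.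
    apply continuity_2d_pt_ext_loc with F'.
    + destruct Hd as [d Hd]; exists d; intros u v Hu _.
      symmetry; apply is_derive_unique, Hd, Hu.
    + apply continuity_2d_pt_filterlim, Hj, Ht.
  - revert Hc; apply filter_imp; intros s Hs.
    apply (ex_RInt_continuous (V := R_CompleteNormedModule)).
    rewrite Rmin_left, Rmax_right; trivial.
Qed.

Lemma is_derC_RInt_param (F F' : R -> R -> C) (s0 a b : R) :
  a <= b ->
  locally s0 (fun s => forall t, is_derC (fun u => F u t) s (F' s t)) ->
  locally s0 (fun s => forall t, a <= t <= b -> contC (F s) t) ->
  (forall t, a <= t <= b -> contC (fun p : R * R => F' (fst p) (snd p)) (s0, t)) ->
  is_derC (fun s => RIntC (F s) a b) s0 (RIntC (F' s0) a b).
Proof.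
  intros Hab Hd Hc Hj.
  assert (E : locally s0 (fun s => ex_RIntC (F s) a b)).
  { revert Hc; apply filter_imp; intros s Hs; apply ex_RIntC_continuous.
    rewrite Rmin_left, Rmax_right; trivial. }
  assert (E' : ex_RIntC (F' s0) a b).
  { apply ex_RIntC_continuous; rewrite Rmin_left, Rmax_right; trivial; intros t Ht.
    apply (continuous_comp (fun t => (s0, t)) (fun p : R * R => F' (fst p) (snd p)));
      [|now apply Hj].
    apply continuous_pairR; cont. }
  apply is_derC_of_cpt; intros i; rewrite RIntC_cpt by trivial.
  apply is_derive_ext_loc with (fun s => RInt (fun t => cpt i (F s t)) a b).
  { revert E; apply filter_imp; intros s Hs; symmetry; now apply RIntC_cpt. }
  apply (is_derive_RInt_param_everywhere (fun s t => cpt i (F s t)) (fun s t => cpt i (F' s t)));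
    trivial.
  - revert Hd; apply filter_imp; intros s Hs t; apply (is_derC_cpt (fun u => F u t)), Hs.
  - revert Hc; apply filter_imp; intros s Hs t Ht; apply (continuous_cpt (F s)); now apply Hs.
  - intros t Ht; apply (continuous_cpt (fun p : R * R => F' (fst p) (snd p))); now apply Hj.
Qed.

(** A continuous map vanishes at a point that zeros of it approach. *)
Lemma zero_by_density {U : UniformSpace} (h : U -> C) (x0 : U) :
  contC h x0 ->
  (forall P : U -> Prop, locally x0 P -> exists y, P y /\ h y = RtoC 0) ->
  h x0 = RtoC 0.
Proof.
  intros Hc Hd; apply NNPP; intros Hn.
  assert (Hp : 0 < Cmod (h x0)) by now apply Cmod_gt_0.
  destruct (Hd _ (proj1 (continuous_C_eps h x0) Hc (mkposreal _ Hp))) as [y [Hy E]].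
  rewrite E in Hy; simpl in Hy.
  replace (RtoC 0 - h x0)%C with (- h x0)%C in Hy by ring.
  rewrite Cmod_opp in Hy; lra.
Qed.

Lemma locally_R_meets_itv (c d t : R) (P : R -> Prop) :
  c < d -> c <= t <= d -> locally t P -> exists s, P s /\ c < s < d.
Proof.
  intros Hcd Ht [e He].
  assert (He0 := cond_pos e).
  destruct (Rlt_le_dec t d) as [H|H].
  - exists (Rmin (t + e / 2) ((t + d) / 2)).
    assert (H1 := Rmin_l (t + e / 2) ((t + d) / 2)).
    assert (H2 := Rmin_r (t + e / 2) ((t + d) / 2)).
    assert (H3 : t < Rmin (t + e / 2) ((t + d) / 2)) by (apply Rmin_glb_lt; lra).
    split; [|lra].
    apply He; apply ball_R.
    rewrite Rabs_pos_eq; lra.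
  - exists (Rmax (t - e / 2) ((t + c) / 2)).
    assert (H1 := Rmax_l (t - e / 2) ((t + c) / 2)).
    assert (H2 := Rmax_r (t - e / 2) ((t + c) / 2)).
    assert (H3 : Rmax (t - e / 2) ((t + c) / 2) < t) by (apply Rmax_lub_lt; lra).
    split; [|lra].
    apply He; apply ball_R.
    rewrite Rabs_left; lra.
Qed.

Lemma continuous_eq_closed_itv (f g : R -> C) (c d t : R) :
  c < d -> c <= t <= d -> contC f t -> contC g t ->
  (forall s, c < s < d -> f s = g s) -> f t = g t.
Proof.
  intros Hcd Ht Hf Hg E.
  assert (H : (f t - g t)%C = RtoC 0).
  { apply (zero_by_density (fun s => f s - g s)%C t).
    - now apply continuous_Cminus.
    - intros P HP; destruct (locally_R_meets_itv c d t P Hcd Ht HP) as [s [Hs Hs']].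
      exists s; split; trivial; rewrite E; trivial; ring. }
  replace (f t) with (g t + (f t - g t))%C by ring; rewrite H; ring.
Qed.

Lemma locally_itv (a b x : R) : a < x < b -> locally x (fun y => a < y < b).
Proof.
  intros H; apply filter_and; [apply open_gt|apply open_lt]; lra.
Qed.

(** The fundamental theorem of calculus for a function that is only
    differentiable in the interior. *)
Lemma RInt_derivative_interior (F F' : R -> R) (a b : R) :
  a <= b ->
  (forall x, a < x < b -> is_derive F x (F' x)) ->
  (forall x, a <= x <= b -> continuous F x) ->
  (forall x, continuous F' x) ->
  RInt F' a b = F b - F a.
Proof.
  intros Hab Hd HF HF'.
  assert (HI : forall x, is_derive (RInt F' a) x (F' x)).
  { intros x; apply (is_derive_RInt (V := R_NormedModule) F' (RInt F' a) a x); [|trivial].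
    apply filter_forall; intros y.
    apply (RInt_correct (V := R_CompleteNormedModule)).
    now apply (ex_RInt_continuous (V := R_CompleteNormedModule)). }
  destruct (MVT_gen (fun x => F x - RInt F' a x) a b (fun _ => 0)) as [c [Hc E]].
  - rewrite Rmin_left, Rmax_right; trivial; intros x Hx.
    eapply is_derive_eq.
    + apply (is_derive_minus (V := R_NormedModule)); [now apply Hd|apply HI].
    + unfold minus, plus, opp; simpl; ring.
  - rewrite Rmin_left, Rmax_right; trivial; intros x Hx.
    apply continuity_pt_filterlim; apply continuous_Rminus; [now apply HF|].
    apply ex_derive_continuous_R; eexists; apply HI.
  - rewrite RInt_point in E; unfold zero in E; simpl in E; lra.
Qed.

Lemma RIntC_derivative_interior (F F' : R -> C) (a b : R) :
  a <= b ->
  (forall x, a < x < b -> is_derC F x (F' x)) ->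
  (forall x, a <= x <= b -> contC F x) ->
  (forall x, contC F' x) ->
  RIntC F' a b = (F b - F a)%C.
Proof.
  intros Hab Hd HF HF'.
  apply Ceq_cpt; intros i; rewrite RIntC_cpt by (apply ex_RIntC_continuous; trivial).
  rewrite (RInt_derivative_interior (fun x => cpt i (F x)) (fun x => cpt i (F' x))); trivial.
  - now destruct i.
  - intros x Hx; apply (is_derC_cpt F); now apply Hd.
  - intros x Hx; apply (continuous_cpt F); now apply HF.
  - intros x; apply (continuous_cpt F'), HF'.
Qed.

(** A partial derivative in the interior of a rectangle persists on the edges
    where the other variable is extreme. *)
Lemma is_derC_edge (F F' : R -> R -> C) (a b c d : R) :
  c < d ->
  (forall p, contC (fun q : R * R => F (fst q) (snd q)) p) ->
  (forall p, contC (fun q : R * R => F' (fst q) (snd q)) p) ->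
  (forall r t, a < r < b -> c < t < d -> is_derC (fun s => F s t) r (F' r t)) ->
  forall r t, a < r < b -> c <= t <= d -> is_derC (fun s => F s t) r (F' r t).
Proof.
  intros Hcd HF HF' Hd r t Hr Ht.
  assert (H1 : forall s x, contC (F s) x).
  { intros s x; apply (continuous_comp (fun t => (s, t)) (fun q : R * R => F (fst q) (snd q)));
      [|apply HF].
    apply continuous_pairR; cont. }
  assert (H2 : forall s x, contC (fun r => F' r s) x).
  { intros s x; apply (continuous_comp (fun t => (t, s)) (fun q : R * R => F' (fst q) (snd q)));
      [|apply HF'].
    apply continuous_pairR; cont. }
  assert (H3 : forall s x, contC (fun r => F r s) x).
  { intros s x; apply (continuous_comp (fun t => (t, s)) (fun q : R * R => F (fst q) (snd q)));
      [|apply HF].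
    apply continuous_pairR; cont. }
  set (r1 := (a + r) / 2).
  assert (Hr1 : a < r1 < r) by (unfold r1; lra).
  clearbody r1.
  assert (E : forall s, r1 < s < b ->
    F s t = (F r1 t + RIntC (fun x => F' x t) r1 s)%C).
  { intros s Hs.
    apply (continuous_eq_closed_itv (F s)
      (fun t => F r1 t + RIntC (fun x => F' x t) r1 s)%C c d t);
      trivial.
    - apply continuous_Cplus; trivial.
      apply continuous_RIntC_param; [lra| |].
      + apply filter_forall; intros; apply H2.
      + intros x _.
        apply (continuous_comp (fun p : R * R => (snd p, fst p))
                 (fun q : R * R => F' (fst q) (snd q))); [|apply HF'].
        apply continuous_pairR; [apply continuous_snd|apply continuous_fst].
    - intros t' Ht'.
      rewrite (RIntC_derivative_interior (fun x => F x t')); trivial.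
      + ring.
      + lra.
      + intros x Hx; apply Hd; trivial; lra. }
  apply is_derC_ext_loc with (fun s => F r1 t + RIntC (fun x => F' x t) r1 s)%C.
  { assert (Hl : r1 < r < b) by lra.
    generalize (locally_itv _ _ _ Hl); apply filter_imp; intros s Hs.
    symmetry; now apply E. }
  eapply is_derC_eq.
  - apply is_derC_plus; [apply is_derC_const|].
    apply (is_derive_RInt (V := C_R_NormedModule) (fun x => F' x t)
             (RIntC (fun x => F' x t) r1) r1 r); [|apply H2].
    apply filter_forall; intros y.
    apply RIntC_correct.
    apply ex_RIntC_continuous; intros; apply H2.
  - apply Cplus_0_l.
Qed.

(** A derivative that has a limit at a point of continuity exists there. *)
Lemma is_derC_from_limit (u u' : R -> C) (s0 : R) :
  locally s0 (fun s => s <> s0 -> is_derC u s (u' s)) ->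
  contC u s0 -> contC u' s0 -> is_derC u s0 (u' s0).
Proof.
  assert (Hreal : forall u u' : R -> R,
    locally s0 (fun s => s <> s0 -> is_derive u s (u' s)) ->
    continuous u s0 -> continuous u' s0 -> is_derive u s0 (u' s0)).
  { clear; intros u u' [d Hd] Hu Hu'.
    apply is_derive_Reals; intros eps Heps.
    destruct (proj1 (filterlim_locally (U := R_UniformSpace) u' (u' s0)) Hu' (mkposreal eps Heps))
      as [d' Hd'].
    assert (Hm : 0 < Rmin d d') by (apply Rmin_glb_lt; apply cond_pos).
    exists (mkposreal _ Hm); intros h Hh0 Hh; simpl in Hh.
    assert (Hh1 : Rabs h < d) by (eapply Rlt_le_trans; [exact Hh|apply Rmin_l]).
    assert (Hh2 : Rabs h < d') by (eapply Rlt_le_trans; [exact Hh|apply Rmin_r]).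
    assert (Hball : forall e x, Rabs h < e -> Rmin s0 (s0 + h) <= x <= Rmax s0 (s0 + h) ->
      ball s0 e x).
    { intros e x He Hx; apply ball_R.
      apply Rabs_def2 in He; apply Rabs_def1;
        revert Hx; unfold Rmin, Rmax; destruct (Rle_dec s0 (s0 + h)); lra. }
    destruct (MVT_gen u s0 (s0 + h) u') as [c [Hc E]].
    - intros x Hx.
      assert (Hx' : x <> s0).
      { intros ->; destruct (Rle_dec 0 h); [rewrite Rmin_left in Hx | rewrite Rmax_left in Hx];
          lra. }
      apply Hd; trivial.
      apply Hball; trivial; lra.
    - intros x Hx; apply continuity_pt_filterlim.
      destruct (Req_dec x s0) as [->|Hx']; [exact Hu|].
      apply ex_derive_continuous_R; exists (u' x).
      apply Hd; trivial.
      now apply Hball.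
    - replace ((u (s0 + h) - u s0) / h) with (u' c) by (rewrite E; field; trivial).
      apply (Hd' c).
      now apply Hball. }
  intros Hd Hu Hu'; apply is_derC_of_cpt; intros i.
  apply (Hreal (fun s => cpt i (u s)) (fun s => cpt i (u' s))); try now apply continuous_cpt.
  revert Hd; apply filter_imp; intros s Hs Hn; apply (is_derC_cpt u); now apply Hs.
Qed.

(** The projection of the line onto [a, b]. *)
Definition clamp (a b x : R) : R := Rmax a (Rmin b x).

Lemma clamp_in a b x : a <= b -> a <= clamp a b x <= b.
Proof.
  intros; unfold clamp; split; [apply Rmax_l|].
  apply Rmax_lub; trivial; apply Rmin_l.
Qed.

Lemma clamp_id a b x : a <= x <= b -> clamp a b x = x.
Proof. intros; unfold clamp; rewrite Rmin_right, Rmax_right; lra. Qed.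

Lemma continuous_clamp a b x : continuous (clamp a b) x.
Proof.
  intros; unfold clamp.
  apply continuous_ext with (fun x => ((b + x - Rabs (b - x)) / 2 + a
                                 + Rabs ((b + x - Rabs (b - x)) / 2 - a)) / 2).
  { intros y.
    replace (Rmin b y) with ((b + y - Rabs (b - y)) / 2).
    - unfold Rmax; destruct (Rle_dec a ((b + y - Rabs (b - y)) / 2)).
      + rewrite (Rabs_pos_eq ((b + y - Rabs (b - y)) / 2 - a)); lra.
      + rewrite (Rabs_left ((b + y - Rabs (b - y)) / 2 - a)); lra.
    - unfold Rmin; destruct (Rle_dec b y).
      + rewrite Rabs_left1; lra.
      + rewrite Rabs_pos_eq; lra. }
  assert (HA : forall f : R -> R, continuous f x -> continuous (fun y => Rabs (f y)) x).
  { intros f Hf; apply (continuous_comp f Rabs); trivial.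
    apply continuous_Rabs. }
  assert (HB : continuous (fun y => Rabs (b - y)) x) by (apply (HA (fun y => b - y)); cont).
  unfold Rdiv; cont; apply (HA (fun y => (b + y - Rabs (b - y)) * / 2 - a)); cont.
Qed.

Lemma continuous_of_continuous_on {T U V : UniformSpace} (D : U -> Prop) (g : U -> V)
    (k : T -> U) (x : T) :
  continuous_on D g -> (forall y, D (k y)) -> continuous k x ->
  continuous (fun y => g (k y)) x.
Proof.
  intros Hg Hk Hc.
  apply (filterlim_comp _ _ _ k g (locally x) (within D (locally (k x))) (locally (g (k x)))).
  - intros P HP; generalize (Hc _ HP); unfold filtermap; apply filter_imp.
    intros y Hy; now apply Hy.
  - now apply Hg.
Qed.

(** * Radial integral operators on a star-shaped domain *)

(** A kernel is taken to be continuous on the whole plane; kernels given on a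
    rectangle are extended by composing with projections onto its sides. *)
Definition jcont (N : R -> R -> C) : Prop :=
  forall p : R * R, contC (fun q : R * R => N (fst q) (snd q)) p.

(** The operator h |-> int_0^1 N(|z|, s) h(s^2 z) ds.  Projecting s onto [0, 1]
    does not change it and makes the integrand continuous in s on the whole
    line. *)
Definition VI (N : R -> R -> C) (h : C -> C) (z : C) : C :=
  RIntC (fun s => N (Cmod z) s * h (RtoC (clamp 0 1 s ^ 2) * z))%C 0 1.

(** Continuity at every point of the domain. *)
Definition cont_in (Omega : C -> Prop) (h : C -> C) : Prop :=
  forall z, Omega z -> contC h z.

(** [h] is continuous in the domain and has there the continuous directional
    derivative [h'] in the direction [e]. *)
Definition C1dir (Omega : C -> Prop) (e : C) (h h' : C -> C) : Prop :=
  cont_in Omega h /\ cont_in Omega h' /\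
  forall z, Omega z -> is_derC (fun s => h (z + RtoC s * e)%C) 0 (h' z).

(** The derivative of [VI N h] in the direction [e], where [N'] is the
    derivative of [N] in the first variable.  At the origin the unit vector
    z / |z| is read as 0. *)
Definition VId (e : C) (N N' : R -> R -> C) (h h' : C -> C) (z : C) : C :=
  (RtoC (dotC e z / Cmod z) * VI N' h z
   + VI (fun r s => N r s * RtoC (clamp 0 1 s ^ 2))%C h' z)%C.

Lemma clamp_sqr_in s : 0 <= clamp 0 1 s ^ 2 <= 1.
Proof. assert (H := clamp_in 0 1 s ltac:(lra)); simpl; nra. Qed.

Lemma jcont_comp {U : UniformSpace} (N : R -> R -> C) (f g : U -> R) x :
  jcont N -> continuous f x -> continuous g x -> contC (fun y => N (f y) (g y)) x.
Proof.
  intros HN Hf Hg.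
  apply (continuous_comp (fun y => (f y, g y)) (fun q : R * R => N (fst q) (snd q)));
    [|apply HN].
  now apply continuous_pairR.
Qed.

Lemma continuous_sqr (x : R) : continuous (fun r => r ^ 2) x.
Proof. apply ex_derive_continuous_R; auto_derive; trivial. Qed.

Ltac cont_leaf ::=
  lazymatch goal with
  | H : jcont ?N |- continuous (fun y => ?N (@?f y) (@?g y)) ?x =>
      apply (jcont_comp N f g x H); cont
  | H : forall x, continuous ?k x |- continuous (fun y => ?k (@?f y)) ?x =>
      apply (continuous_comp f k x); [cont|exact (H _)]
  | |- continuous (fun y => clamp ?a ?b (@?f y)) ?x =>
      apply (continuous_comp f (clamp a b) x); [cont|apply continuous_clamp]
  | |- continuous (fun y => pow (@?f y) 2) ?x =>
      apply (continuous_comp f (fun r => r ^ 2) x); [cont|apply continuous_sqr]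
  | |- _ => try assumption
  end.

Lemma jcont_mult N M : jcont N -> jcont M -> jcont (fun r s => N r s * M r s)%C.
Proof. intros H1 H2 [r s]; cont. Qed.

Lemma jcont_clamp_sqr : jcont (fun _ s => RtoC (clamp 0 1 s ^ 2)).
Proof. intros [r s]; cont. Qed.

Lemma Cmod_pair_sqr (z : C) : Cmod z ^ 2 = Re z ^ 2 + Im z ^ 2.
Proof.
  unfold Cmod; rewrite pow2_sqrt; trivial.
  apply Rplus_le_le_0_compat; apply pow2_ge_0.
Qed.

Lemma dotC_le e z : Rabs (dotC e z) <= Cmod e * Cmod z.
Proof.
  apply Rsqr_incr_0_var.
  - rewrite <- Rsqr_abs; unfold Rsqr.
    replace (Cmod e * Cmod z * (Cmod e * Cmod z)) with (Cmod e ^ 2 * Cmod z ^ 2) by ring.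
    rewrite !Cmod_pair_sqr; unfold dotC.
    assert (H := pow2_ge_0 (Re e * Im z - Im e * Re z)); nra.
  - apply Rmult_le_pos; apply Cmod_ge_0.
Qed.

Lemma dotC_Cmod_le e z : Rabs (dotC e z / Cmod z) <= Cmod e.
Proof.
  destruct (Req_dec (Cmod z) 0) as [H|H].
  - rewrite H; unfold Rdiv; rewrite Rinv_0, Rmult_0_r, Rabs_R0; apply Cmod_ge_0.
  - assert (H0 : 0 < Cmod z) by (generalize (Cmod_ge_0 z); lra).
    unfold Rdiv; rewrite Rabs_mult, (Rabs_pos_eq (/ Cmod z)).
    + apply Rmult_le_reg_r with (Cmod z); trivial.
      rewrite Rmult_assoc, Rinv_l, Rmult_1_r; trivial; apply dotC_le.
    + left; now apply Rinv_0_lt_compat.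
Qed.

Lemma is_derive_Cmod_line (z e : C) (s : R) :
  (z + RtoC s * e)%C <> RtoC 0 ->
  is_derive (fun s => Cmod (z + RtoC s * e)%C) s
    (dotC e (z + RtoC s * e)%C / Cmod (z + RtoC s * e)%C).
Proof.
  intros Hn.
  assert (Hp : 0 < Re (z + RtoC s * e)%C ^ 2 + Im (z + RtoC s * e)%C ^ 2).
  { rewrite <- Cmod_pair_sqr; apply pow_lt; now apply Cmod_gt_0. }
  unfold Cmod at 2; unfold Cmod, dotC.
  destruct z as [x y], e as [a b]; simpl in *.
  auto_derive.
  - lra.
  - match goal with |- context [sqrt ?a] => set (A := a) end.
    match goal with |- context [_ / sqrt ?b] => replace b with A by (unfold A; ring) end.
    assert (0 < sqrt A) by (apply sqrt_lt_R0; unfold A; lra).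
    field; lra.
Qed.

Lemma continuous_line (z e : C) (s : R) : contC (fun s => z + RtoC s * e)%C s.
Proof. cont. Qed.

Lemma continuous_Rdiv {U : UniformSpace} (f g : U -> R) x :
  continuous f x -> continuous g x -> g x <> 0 -> continuous (fun y => f y / g y) x.
Proof.
  intros Hf Hg Hn; apply continuous_Rmult; trivial.
  apply (continuous_comp g Rinv); trivial.
  now apply continuous_Rinv.
Qed.

Lemma continuous_bounded_zero {U : UniformSpace} (b A : U -> C) (M : R) (x0 : U) :
  (forall x, Cmod (b x) <= M) -> A x0 = RtoC 0 -> contC A x0 ->
  contC (fun x => b x * A x)%C x0.
Proof.
  intros Hb HA Hc; apply continuous_C_eps; intros eps.
  assert (HM : 0 <= M) by (apply Rle_trans with (2 := Hb x0); apply Cmod_ge_0).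
  assert (He : 0 < eps / (M + 1)) by (apply Rdiv_lt_0_compat; [apply cond_pos|lra]).
  generalize (proj1 (continuous_C_eps _ _) Hc (mkposreal _ He)); apply filter_imp.
  intros x; simpl; rewrite HA.
  replace (A x - RtoC 0)%C with (A x) by ring.
  replace (b x * A x - b x0 * RtoC 0)%C with (b x * A x)%C by ring.
  intros H; rewrite Cmod_mult.
  apply Rle_lt_trans with (M * Cmod (A x)).
  - apply Rmult_le_compat_r; [apply Cmod_ge_0|apply Hb].
  - apply Rle_lt_trans with (M * (eps / (M + 1))).
    + apply Rmult_le_compat_l; lra.
    + apply Rlt_le_trans with ((M + 1) * (eps / (M + 1))).
      * apply Rmult_lt_compat_r; lra.
      * right; field; lra.
Qed.

Section RadialOperators.

Variable Omega : C -> Prop.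
Hypothesis Hopen : open Omega.
Hypothesis Hstar : star_shaped0 Omega.

Lemma star_clamp_sqr z s : Omega z -> Omega (RtoC (clamp 0 1 s ^ 2) * z)%C.
Proof. intros Hz; apply Hstar; trivial; apply clamp_sqr_in. Qed.

Lemma continuous_on_ray {U : UniformSpace} h (f : U -> C) (g : U -> R) x :
  cont_in Omega h -> Omega (f x) -> contC f x -> continuous g x ->
  contC (fun y => h (RtoC (clamp 0 1 (g y) ^ 2) * f y)%C) x.
Proof.
  intros Hh Hz Hf Hg.
  apply (continuous_comp (fun y => RtoC (clamp 0 1 (g y) ^ 2) * f y)%C h).
  - cont.
  - now apply Hh, star_clamp_sqr.
Qed.

Lemma VI_integrand_continuous {U : UniformSpace} N h (f : U -> C) (g : U -> R) x :
  jcont N -> cont_in Omega h -> Omega (f x) -> contC f x -> continuous g x ->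
  contC (fun y => N (Cmod (f y)) (g y) * h (RtoC (clamp 0 1 (g y) ^ 2) * f y))%C x.
Proof.
  intros HN Hh Hz Hf Hg; apply continuous_Cmult.
  - apply jcont_comp; trivial; now apply continuous_Cmod_comp.
  - now apply continuous_on_ray.
Qed.

Lemma VI_integrand_ray N h z s : jcont N -> cont_in Omega h -> Omega z ->
  contC (fun s => N (Cmod z) s * h (RtoC (clamp 0 1 s ^ 2) * z))%C s.
Proof.
  intros HN Hh Hz.
  apply (VI_integrand_continuous N h (fun _ => z) (fun s => s)); trivial; cont.
Qed.

Lemma VI_integrable N h z : jcont N -> cont_in Omega h -> Omega z ->
  ex_RIntC (fun s => N (Cmod z) s * h (RtoC (clamp 0 1 s ^ 2) * z))%C 0 1.
Proof.
  intros HN Hh Hz; apply ex_RIntC_continuous; intros s _.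
  now apply VI_integrand_ray.
Qed.

Lemma VI_cont N h : jcont N -> cont_in Omega h -> cont_in Omega (VI N h).
Proof.
  intros HN Hh z Hz; unfold VI.
  apply (continuous_RIntC_param
    (fun z s => N (Cmod z) s * h (RtoC (clamp 0 1 s ^ 2) * z))%C z 0 1); [lra| |].
  - generalize (Hopen z Hz); apply filter_imp; intros w Hw s _.
    now apply VI_integrand_ray.
  - intros s _.
    apply (VI_integrand_continuous N h (fun p : C * R => fst p) (fun p => snd p)); trivial.
    + apply continuous_fst.
    + apply continuous_snd.
Qed.

Lemma locally_line_in (z e : C) : Omega z -> locally 0 (fun s => Omega (z + RtoC s * e)%C).
Proof.
  intros Hz.
  apply (continuous_line z e 0 Omega).
  replace (z + RtoC 0 * e)%C with z by ring; now apply Hopen.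
Qed.

Lemma is_derC_line_shift (h : C -> C) (h' : C) (z e : C) (s0 : R) :
  is_derC (fun s => h (z + RtoC s0 * e + RtoC s * e)%C) 0 h' ->
  is_derC (fun s => h (z + RtoC s * e)%C) s0 h'.
Proof.
  intros H.
  apply is_derC_ext_loc with (fun s => h (z + RtoC s0 * e + RtoC (s - s0) * e)%C).
  { apply filter_forall; intros s; f_equal; rewrite RtoC_minus; ring. }
  eapply is_derC_eq.
  - apply (is_derC_comp (fun s => h (z + RtoC s0 * e + RtoC s * e)%C) (fun s => s - s0) s0 h' 1).
    + now rewrite Rminus_diag.
    + auto_derive; trivial; ring.
  - apply Cmult_1_l.
Qed.

Lemma C1dir_scaled e h h' z k s : C1dir Omega e h h' -> 0 <= k <= 1 ->
  Omega (z + RtoC s * e)%C ->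
  is_derC (fun u => h (RtoC k * (z + RtoC u * e))%C) s
    (RtoC k * h' (RtoC k * (z + RtoC s * e)))%C.
Proof.
  intros [_ [_ Hd]] Hk Hz.
  set (w := (RtoC k * (z + RtoC s * e))%C).
  apply is_derC_ext_loc with (fun u => h (w + RtoC (k * (u - s)) * e)%C).
  { apply filter_forall; intros u; f_equal; unfold w.
    rewrite RtoC_mult, RtoC_minus; ring. }
  apply (is_derC_comp (fun v => h (w + RtoC v * e)%C) (fun u => k * (u - s))).
  - rewrite Rminus_diag, Rmult_0_r; apply Hd; unfold w; now apply Hstar.
  - auto_derive; trivial; ring.
Qed.

Variable rho : R.
Hypothesis Hrho : forall z, Omega z -> Cmod z < rho.

Variables N N' : R -> R -> C.
Hypothesis HN : jcont N.
Hypothesis HN' : jcont N'.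
Hypothesis HNd : forall r s, 0 < r < rho -> is_derC (fun r => N r s) r (N' r s).
Hypothesis HN'0 : RIntC (N' 0) 0 1 = RtoC 0.

(** The mean of N' at r = 0 vanishes, so the factor z / |z| of the derivative is
    multiplied by a function that tends to 0 at the origin. *)
Lemma VI_derivative_zero h : cont_in Omega h -> VI N' h (RtoC 0) = RtoC 0.
Proof.
  intros Hh; unfold VI.
  rewrite (RIntC_ext _ (fun s => h (RtoC 0) * N' 0 s)%C).
  - rewrite RIntC_scal.
    + rewrite HN'0; ring.
    + apply ex_RIntC_continuous; intros s _; apply jcont_comp; trivial.
      * apply continuous_const.
      * apply continuous_id.
  - intros s _; rewrite Cmod_0, Cmult_0_r; apply Cmult_comm.
Qed.

Lemma VId_cont e h h' : C1dir Omega e h h' -> cont_in Omega (VId e N N' h h').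
Proof.
  intros [Hh [Hh' _]] z Hz; unfold VId.
  apply continuous_Cplus.
  2:{ apply VI_cont; trivial; apply jcont_mult; trivial; apply jcont_clamp_sqr. }
  destruct (classic (z = RtoC 0)) as [->|Hn].
  - apply (continuous_bounded_zero (fun z => RtoC (dotC e z / Cmod z)) (VI N' h) (Cmod e)).
    + intros x; rewrite Cmod_R; apply dotC_Cmod_le.
    + now apply VI_derivative_zero.
    + now apply VI_cont.
  - apply continuous_Cmult; [|now apply VI_cont].
    apply continuous_RtoC, (continuous_Rdiv (fun z => dotC e z) (fun z => Cmod z)); [cont|cont|].
    intros H; now apply Hn, Cmod_eq_0.
Qed.

Lemma VI_derivative_off_zero e h h' z : C1dir Omega e h h' -> Omega z -> z <> RtoC 0 ->
  is_derC (fun s => VI N h (z + RtoC s * e)%C) 0 (VId e N N' h h' z).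
Proof.
  intros HC Hz Hn.
  assert (Hh := proj1 HC); assert (Hh' := proj1 (proj2 HC)).
  set (l := fun s => (z + RtoC s * e)%C).
  assert (Hl0 : l 0 = z) by (unfold l; ring).
  assert (Hlc : forall s, contC l s) by (intros; apply continuous_line).
  assert (Hloc : locally 0 (fun s => Omega (l s) /\ l s <> RtoC 0)).
  { apply filter_and; [now apply locally_line_in|].
    assert (H0 : 0 < Cmod (l 0)) by (rewrite Hl0; now apply Cmod_gt_0).
    generalize (proj1 (continuous_C_eps _ _) (Hlc 0) (mkposreal _ H0)); apply filter_imp.
    simpl; intros s Hs E; rewrite E in Hs.
    replace (RtoC 0 - l 0)%C with (- l 0)%C in Hs by ring.
    rewrite Cmod_opp in Hs; lra. }
  set (k := fun s => clamp 0 1 s ^ 2).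
  set (F' := fun u s => (RtoC (dotC e (l u) / Cmod (l u)) * N' (Cmod (l u)) s
                           * h (RtoC (k s) * l u)
                         + N (Cmod (l u)) s * (RtoC (k s) * h' (RtoC (k s) * l u)))%C).
  assert (HD : is_derC (fun u => RIntC (fun s => N (Cmod (l u)) s * h (RtoC (k s) * l u))%C 0 1)
                 0 (RIntC (F' 0) 0 1)).
  { apply (is_derC_RInt_param (fun u s => N (Cmod (l u)) s * h (RtoC (k s) * l u))%C F');
      [lra| | |].
    - revert Hloc; apply filter_imp; intros u [Hu1 Hu2] s; unfold F'.
      apply (is_derC_mult (fun u => N (Cmod (l u)) s)
               (fun u => h (RtoC (k s) * l u)%C)).
      + apply (is_derC_comp (fun r => N r s) (fun u => Cmod (l u))).
        * apply HNd; split; [now apply Cmod_gt_0|now apply Hrho].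
        * exact (is_derive_Cmod_line z e u Hu2).
      + exact (C1dir_scaled e h h' z (k s) u HC (clamp_sqr_in s) Hu1).
    - revert Hloc; apply filter_imp; intros u [Hu1 _] s _.
      now apply VI_integrand_ray.
    - intros s _; unfold F', k.
      assert (Hlf : contC (fun p : R * R => l (fst p)) (0, s)).
      { apply (continuous_comp fst l); [apply continuous_fst|apply Hlc]. }
      assert (Hsn : continuous (fun p : R * R => snd p) (0, s)) by apply continuous_snd.
      apply continuous_Cplus; [apply continuous_Cmult|].
      + apply continuous_Cmult.
        * apply continuous_RtoC, continuous_Rdiv.
          -- cont.
          -- now apply continuous_Cmod_comp.
          -- simpl; rewrite Hl0; intros H; now apply Hn, Cmod_eq_0.
        * apply jcont_comp; trivial; now apply continuous_Cmod_comp.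
      + apply (continuous_on_ray h (fun p : R * R => l (fst p))); trivial.
        simpl; now rewrite Hl0.
      + apply continuous_Cmult; [|apply continuous_Cmult].
        * apply jcont_comp; trivial; now apply continuous_Cmod_comp.
        * cont.
        * apply (continuous_on_ray h' (fun p : R * R => l (fst p))); trivial.
          simpl; now rewrite Hl0. }
  eapply is_derC_eq; [exact HD|].
  unfold VId, VI, F'; rewrite Hl0.
  assert (I1 := VI_integrable N' h z HN' Hh Hz).
  assert (I2 := VI_integrable (fun r s => N r s * RtoC (clamp 0 1 s ^ 2))%C h' z
                  (jcont_mult _ _ HN jcont_clamp_sqr) Hh' Hz).
  rewrite <- RIntC_scal; trivial.
  rewrite <- RIntC_plus; trivial.
  - apply RIntC_ext; intros s _; unfold k.
    cring.
  - apply ex_RIntC_continuous; intros s _.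
    apply continuous_Cmult; [apply continuous_const|].
    now apply VI_integrand_ray.
Qed.

Lemma VI_C1dir e h h' : e <> RtoC 0 -> C1dir Omega e h h' ->
  C1dir Omega e (VI N h) (VId e N N' h h').
Proof.
  intros He HC; split; [|split].
  - apply VI_cont; trivial; apply HC.
  - now apply VId_cont.
  - intros z Hz; destruct (classic (z = RtoC 0)) as [->|Hn].
    2: now apply VI_derivative_off_zero.
    eapply is_derC_eq.
    + apply (is_derC_from_limit _ (fun s => VId e N N' h h' (RtoC 0 + RtoC s * e)%C)).
      * generalize (locally_line_in _ e Hz); apply filter_imp; intros s Hs Hs0.
        apply is_derC_line_shift, VI_derivative_off_zero; trivial.
        rewrite Cplus_0_l; apply Cmult_neq_0; trivial.
        intros H; apply Hs0; now apply RtoC_inj.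
      * apply (continuous_comp (fun s => RtoC 0 + RtoC s * e)%C (VI N h));
          [apply continuous_line|].
        apply VI_cont; trivial; [apply HC|].
        now replace (RtoC 0 + RtoC 0 * e)%C with (RtoC 0) by ring.
      * apply (continuous_comp (fun s => RtoC 0 + RtoC s * e)%C (VId e N N' h h'));
          [apply continuous_line|].
        apply VId_cont; trivial.
        now replace (RtoC 0 + RtoC 0 * e)%C with (RtoC 0) by ring.
    + f_equal; ring.
Qed.

End RadialOperators.

(** * Geometrically convergent series of functions *)

Lemma half_pow_pos n : 0 < (1 / 2) ^ n.
Proof. apply pow_lt; lra. Qed.

Lemma half_pow_decr n m : (n <= m)%nat -> (1 / 2) ^ m <= (1 / 2) ^ n.
Proof.
  intros H; assert (H1 : (1 / 2) ^ (m - n) <= 1 ^ (m - n)) by (apply pow_incr; lra).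
  rewrite pow1 in H1.
  replace m with ((m - n) + n)%nat by lia; rewrite pow_add.
  assert (H2 := half_pow_pos n); nra.
Qed.

Lemma half_pow_small (B : R) (eps : posreal) : exists n, B * (1 / 2) ^ n < eps.
Proof.
  assert (H : is_lim_seq (fun n => B * (1 / 2) ^ n) (B * 0)).
  { apply (is_lim_seq_scal_l _ B 0), is_lim_seq_geom; rewrite Rabs_pos_eq; lra. }
  rewrite Rmult_0_r in H; apply is_lim_seq_spec in H.
  destruct (H eps) as [n Hn]; exists n.
  specialize (Hn n (Nat.le_refl n)); rewrite Rminus_0_r in Hn.
  apply Rabs_def2 in Hn; lra.
Qed.

Lemma half_series (B : R) n :
  Series (fun k => B * (1 / 2) ^ (n + k)) = B * (1 / 2) ^ n * 2 /\
  ex_series (fun k => B * (1 / 2) ^ (n + k)).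
Proof.
  assert (H : is_series (fun k => B * (1 / 2) ^ n * (1 / 2) ^ k) (B * (1 / 2) ^ n * 2)).
  { apply (is_series_scal (V := R_NormedModule) (B * (1 / 2) ^ n) (pow (1 / 2)) 2).
    assert (G : is_series (fun k => (1 / 2) ^ k) (/ (1 - 1 / 2))).
    { apply is_series_geom; rewrite Rabs_pos_eq; lra. }
    replace (/ (1 - 1 / 2)) with 2 in G by field; exact G. }
  assert (H' : is_series (fun k => B * (1 / 2) ^ (n + k)) (B * (1 / 2) ^ n * 2)).
  { eapply is_series_ext; [|exact H]; intros k; simpl; rewrite pow_add; ring. }
  split; [now apply is_series_unique|eexists; exact H'].
Qed.

Lemma half_series_bound (a : nat -> R) (B : R) n :
  (forall k, Rabs (a k) <= B * (1 / 2) ^ (n + k)) ->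
  ex_series a /\ Rabs (Series a) <= B * (1 / 2) ^ n * 2.
Proof.
  intros H; destruct (half_series B n) as [E X].
  assert (X' : ex_series (fun k => Rabs (a k))).
  { apply (ex_series_le (V := R_CompleteNormedModule) _
      (fun k => B * (1 / 2) ^ (n + k))); trivial.
    intros k; unfold norm; simpl; unfold abs; simpl; now rewrite Rabs_Rabsolu. }
  split; [now apply ex_series_Rabs|].
  eapply Rle_trans; [now apply Series_Rabs|].
  rewrite <- E; apply Series_le; trivial.
  intros k; split; [apply Rabs_pos|apply H].
Qed.

Lemma half_series_tail (a : nat -> R) (B : R) n :
  (forall k, Rabs (a k) <= B * (1 / 2) ^ k) ->
  Rabs (sum_n a n - Series a) <= B * (1 / 2) ^ n.
Proof.
  intros H.
  rewrite (Series_incr_n a (S n)); [|lia|now apply (half_series_bound a B 0)].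
  rewrite <- sum_n_Reals; simpl Nat.pred.
  replace (sum_n a n - (sum_n a n + Series (fun k => a (S n + k)%nat)))
    with (- Series (fun k => a (S n + k)%nat)) by ring.
  rewrite Rabs_Ropp.
  eapply Rle_trans; [apply (half_series_bound _ B (S n)); intros k; apply H|].
  simpl; right; field.
Qed.

Lemma continuous_sum_n {U : UniformSpace} (a : nat -> U -> R) x n :
  (forall k, continuous (a k) x) -> continuous (fun y => sum_n (fun k => a k y) n) x.
Proof.
  intros H; induction n as [|n IH].
  - apply continuous_ext with (a 0%nat); [|apply H].
    intros y; now rewrite sum_O.
  - apply continuous_ext with (fun y => sum_n (fun k => a k y) n + a (S n) y).
    + intros y; now rewrite sum_Sn.
    + now apply continuous_Rplus.
Qed.

Lemma continuous_Series {U : UniformSpace} (a : nat -> U -> R) x B :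
  (forall k, continuous (a k) x) ->
  locally x (fun y => forall k, Rabs (a k y) <= B * (1 / 2) ^ k) ->
  continuous (fun y => Series (fun k => a k y)) x.
Proof.
  intros Hc Hb; apply (filterlim_locally (U := R_UniformSpace)); intros eps.
  assert (He : 0 < eps / 3) by (generalize (cond_pos eps); lra).
  destruct (half_pow_small B (mkposreal _ He)) as [n Hn]; simpl in Hn.
  assert (Hs := continuous_sum_n a x n Hc).
  apply (filterlim_locally (U := R_UniformSpace)) with (eps := mkposreal _ He) in Hs.
  assert (Hb0 := locally_singleton _ _ Hb).
  generalize (filter_and _ _ Hb Hs); apply filter_imp; intros y [Hy1 Hy2].
  apply ball_R_inv in Hy2; apply ball_R; simpl in Hy2.
  assert (T1 := half_series_tail (fun k => a k y) B n Hy1).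
  assert (T2 := half_series_tail (fun k => a k x) B n Hb0).
  apply Rabs_le_between in T1, T2; apply Rabs_def2 in Hy2.
  apply Rabs_def1; lra.
Qed.

Lemma is_derive_Series (a a' : nat -> R -> R) x B :
  locally x (fun y => forall k, Rabs (a k y) <= B * (1 / 2) ^ k) ->
  locally x (fun y => forall k, Rabs (a' k y) <= B * (1 / 2) ^ k) ->
  locally x (fun y => forall k, is_derive (a k) y (a' k y)) ->
  locally x (fun y => forall k, continuous (a' k) y) ->
  is_derive (fun y => Series (fun k => a k y)) x (Series (fun k => a' k x)).
Proof.
  intros H1 H2 H3 H4.
  destruct (filter_and _ _ (filter_and _ _ H1 H2) (filter_and _ _ H3 H4)) as [d Hd].
  set (D := fun y => x - d < y < x + d).
  assert (HD : forall y, D y -> ball x d y).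
  { unfold D; intros y Hy; apply ball_R.
    apply Rabs_def1; lra. }
  assert (HDx : D x) by (unfold D; generalize (cond_pos d); lra).
  assert (HDd : forall n y, D y ->
    is_derive (fun y => sum_n (fun k => a k y) n) y (sum_n (fun k => a' k y) n)).
  { intros n y Hy; apply (is_derive_sum_n (V := R_NormedModule)).
    intros k _; now apply Hd, HD. }
  assert (HB0 : 0 <= B).
  { destruct (Hd x (HD x HDx)) as [[Hb _] _].
    specialize (Hb 0%nat); rewrite pow_O, Rmult_1_r in Hb.
    eapply Rle_trans; [apply Rabs_pos|exact Hb]. }
  assert (HO : open D).
  { intros y Hy; now apply locally_itv. }
  assert (E : Lim_seq (fun n => Derive (fun y => sum_n (fun k => a k y) n) x)
              = Lim_seq (sum_n (fun k => a' k x))).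
  { apply Lim_seq_ext; intros n; now apply is_derive_unique, HDd. }
  unfold Series; rewrite <- E.
  apply (CVU_Derive (fun n y => sum_n (fun k => a k y) n) D); trivial.
  - unfold D; intros u v w; lra.
  - intros eps; destruct (half_pow_small B eps) as [n Hn]; exists n; intros m Hm y Hy.
    apply Rle_lt_trans with (B * (1 / 2) ^ m).
    + apply (half_series_tail (fun k => a k y) B m); now apply Hd, HD.
    + apply Rle_lt_trans with (2 := Hn); apply Rmult_le_compat_l.
      * exact HB0.
      * now apply half_pow_decr.
  - intros n y Hy; eexists; now apply HDd.
  - intros n y Hy; apply continuity_pt_filterlim.
    apply (continuous_ext_loc _ (fun y => sum_n (fun k => a' k y) n)).
    + generalize (HO y Hy); apply filter_imp; intros w Hw.
      symmetry; now apply is_derive_unique, HDd.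
    + apply continuous_sum_n; intros k; now apply Hd, HD.
  - intros eps; destruct (half_pow_small B eps) as [n Hn]; exists n; intros m Hm y Hy.
    replace (Derive (fun y => sum_n (fun k => a k y) m) y)
      with (sum_n (fun k => a' k y) m) by (symmetry; now apply is_derive_unique, HDd).
    rewrite (Lim_seq_ext (fun n => Derive (fun y => sum_n (fun k => a k y) n) y)
               (sum_n (fun k => a' k y))).
    2:{ intros p; now apply is_derive_unique, HDd. }
    apply Rle_lt_trans with (B * (1 / 2) ^ m).
    + apply (half_series_tail (fun k => a' k y) B m); now apply Hd, HD.
    + apply Rle_lt_trans with (2 := Hn); apply Rmult_le_compat_l.
      * exact HB0.
      * now apply half_pow_decr.
Qed.

(** The sum of a complex series. *)
Definition CSer (a : nat -> C) : C :=
  (Series (fun k => Re (a k)), Series (fun k => Im (a k))).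

Lemma CSer_ext (a b : nat -> C) : (forall k, a k = b k) -> CSer a = CSer b.
Proof.
  intros H; unfold CSer; f_equal; apply Series_ext; intros k; now rewrite H.
Qed.

Lemma cpt_le_Cmod i (z : C) : Rabs (cpt i z) <= Cmod z.
Proof.
  destruct i; (eapply Rle_trans; [|apply Rmax_Cmod]); [apply Rmax_l|apply Rmax_r].
Qed.

Lemma Cmod_le_Re_Im (z : C) : Cmod z <= Rabs (Re z) + Rabs (Im z).
Proof.
  replace z with (RtoC (Re z) + RtoC (Im z) * Ci)%C at 1.
  - eapply Rle_trans; [apply Cmod_triangle|].
    rewrite Cmod_mult, !Cmod_R; unfold Cmod, Ci; simpl.
    replace (0 * (0 * 1) + 1 * (1 * 1)) with 1 by ring; rewrite sqrt_1; lra.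
  - apply Ceq; simpl; ring.
Qed.

Lemma CSer_bound (a : nat -> C) (B : R) n :
  (forall k, Cmod (a k) <= B * (1 / 2) ^ (n + k)) ->
  Cmod (CSer a) <= 4 * B * (1 / 2) ^ n.
Proof.
  intros H; eapply Rle_trans; [apply Cmod_le_Re_Im|]; simpl.
  assert (H' : forall i, Rabs (Series (fun k => cpt i (a k))) <= B * (1 / 2) ^ n * 2).
  { intros i; apply half_series_bound; intros k.
    eapply Rle_trans; [apply cpt_le_Cmod|apply H]. }
  assert (H1 := H' true); assert (H2 := H' false); simpl in H1, H2; lra.
Qed.

Lemma CSer_incr_1 (a : nat -> C) (B : R) :
  (forall k, Cmod (a k) <= B * (1 / 2) ^ k) ->
  CSer a = (a 0%nat + CSer (fun k => a (S k)))%C.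
Proof.
  intros H.
  assert (X : forall i, ex_series (fun k => cpt i (a k))).
  { intros i; apply (half_series_bound _ B 0); intros k.
    eapply Rle_trans; [apply cpt_le_Cmod|apply H]. }
  apply Ceq; simpl; [exact (Series_incr_1 _ (X true))|exact (Series_incr_1 _ (X false))].
Qed.

Lemma continuous_CSer {U : UniformSpace} (a : nat -> U -> C) x B :
  (forall k, contC (a k) x) ->
  locally x (fun y => forall k, Cmod (a k y) <= B * (1 / 2) ^ k) ->
  contC (fun y => CSer (fun k => a k y)) x.
Proof.
  intros Hc Hb; apply continuous_of_cpt; intros i.
  apply continuous_ext with (fun y => Series (fun k => cpt i (a k y))); [now destruct i|].
  apply continuous_Series with B.
  - intros k; apply (continuous_cpt (a k)), Hc.
  - revert Hb; apply filter_imp; intros y Hy k; eapply Rle_trans; [apply cpt_le_Cmod|apply Hy].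
Qed.

Lemma is_derC_CSer (a a' : nat -> R -> C) x B :
  locally x (fun y => forall k, Cmod (a k y) <= B * (1 / 2) ^ k) ->
  locally x (fun y => forall k, Cmod (a' k y) <= B * (1 / 2) ^ k) ->
  locally x (fun y => forall k, is_derC (a k) y (a' k y)) ->
  locally x (fun y => forall k, contC (a' k) y) ->
  is_derC (fun y => CSer (fun k => a k y)) x (CSer (fun k => a' k x)).
Proof.
  intros H1 H2 H3 H4; apply is_derC_of_cpt; intros i.
  apply is_derive_ext with (fun y => Series (fun k => cpt i (a k y))); [now destruct i|].
  replace (cpt i (CSer (fun k => a' k x))) with (Series (fun k => cpt i (a' k x)))
    by now destruct i.
  apply (is_derive_Series (fun k y => cpt i (a k y)) (fun k y => cpt i (a' k y)) x B).
  - revert H1; apply filter_imp; intros y Hy k; eapply Rle_trans; [apply cpt_le_Cmod|apply Hy].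
  - revert H2; apply filter_imp; intros y Hy k; eapply Rle_trans; [apply cpt_le_Cmod|apply Hy].
  - revert H3; apply filter_imp; intros y Hy k; apply (is_derC_cpt (a k)), Hy.
  - revert H4; apply filter_imp; intros y Hy k; apply (continuous_cpt (a' k)), Hy.
Qed.

(** * The Volterra equation u + VI N u = w *)

Section Volterra.

Variable Omega : C -> Prop.
Hypothesis Hopen : open Omega.
Hypothesis Hstar : star_shaped0 Omega.
Variable rho : R.
Hypothesis Hrho : forall z, Omega z -> Cmod z < rho.
Variable cb : R.
Hypothesis Hcb : 0 < cb.

(** The bound, linear in r, that makes the operator of Volterra type on each
    ray. *)
Definition kernel_bound (N : R -> R -> C) : Prop :=
  forall r s, 0 <= r < rho -> 0 <= s <= 1 -> Cmod (N r s) <= 2 * cb * s * r.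

Lemma Omega_Cmod z : Omega z -> 0 <= Cmod z < rho.
Proof. intros Hz; split; [apply Cmod_ge_0|now apply Hrho]. Qed.

Lemma Cmod_scale (k : R) z : 0 <= k -> Cmod (RtoC k * z)%C = k * Cmod z.
Proof. intros Hk; rewrite Cmod_mult, Cmod_R, Rabs_pos_eq; trivial. Qed.

Lemma ex_RInt_exp_weight (M r : R) :
  ex_RInt (fun s => M * (2 * cb * s * r * exp (4 * cb * (s ^ 2 * r)))) 0 1 /\
  RInt (fun s => M * (2 * cb * s * r * exp (4 * cb * (s ^ 2 * r)))) 0 1
  = M / 4 * (exp (4 * cb * r) - 1).
Proof.
  assert (H : is_RInt (fun s => M * (2 * cb * s * r * exp (4 * cb * (s ^ 2 * r)))) 0 1
    (minus (M / 4 * exp (4 * cb * (1 ^ 2 * r))) (M / 4 * exp (4 * cb * (0 ^ 2 * r))))).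
  { apply (is_RInt_derive (V := R_CompleteNormedModule)
      (fun s => M / 4 * exp (4 * cb * (s ^ 2 * r)))).
    - intros s _; auto_derive; trivial; simpl; field.
    - intros s _; apply ex_derive_continuous_R.
      auto_derive; trivial. }
  split; [eexists; exact H|].
  rewrite (is_RInt_unique _ _ _ _ H); unfold minus, plus, opp; simpl.
  replace (4 * cb * (0 * (0 * 1) * r)) with 0 by ring; rewrite exp_0.
  replace (4 * cb * (1 * (1 * 1) * r)) with (4 * cb * r) by ring; ring.
Qed.

(** In the norm weighted by exp (- 4 cb |z|) the operator contracts by 1/4. *)
Lemma VI_contracts N h z M : jcont N -> kernel_bound N -> cont_in Omega h -> Omega z ->
  0 <= M ->
  (forall s, 0 <= s <= 1 ->
     Cmod (h (RtoC s * z)%C) <= M * exp (4 * cb * (s * Cmod z))) ->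
  Cmod (VI N h z) <= M / 4 * exp (4 * cb * Cmod z).
Proof.
  intros HN HB Hh Hz HM Hb.
  destruct (ex_RInt_exp_weight M (Cmod z)) as [X E].
  apply Rle_trans with (M / 4 * (exp (4 * cb * Cmod z) - 1)); [|lra].
  rewrite <- E; unfold VI; apply Cmod_RIntC_le; [lra| |exact X|].
  - now apply (VI_integrable Omega Hstar N h z HN Hh Hz).
  - intros s Hs; rewrite Cmod_mult, clamp_id; trivial.
    assert (Hs2 : 0 <= s ^ 2 <= 1) by (simpl; nra).
    replace (M * (2 * cb * s * Cmod z * exp (4 * cb * (s ^ 2 * Cmod z))))
      with (2 * cb * s * Cmod z * (M * exp (4 * cb * (s ^ 2 * Cmod z)))) by ring.
    apply Rmult_le_compat; try apply Cmod_ge_0.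
    + apply HB; trivial; now apply Omega_Cmod.
    + now apply Hb.
Qed.

Lemma exp_incr x y : x <= y -> exp x <= exp y.
Proof. intros [H | ->]; [left; now apply exp_increasing|right; trivial]. Qed.

Lemma le_exp_weight M s z : 0 <= M -> 0 <= s -> M <= M * exp (4 * cb * (s * Cmod z)).
Proof.
  intros HM Hs; rewrite <- (Rmult_1_r M) at 1; apply Rmult_le_compat_l; trivial.
  rewrite <- exp_0; apply exp_incr.
  apply Rmult_le_pos; [lra|]; apply Rmult_le_pos; [lra|apply Cmod_ge_0].
Qed.

Lemma VI_bounded N h z M : jcont N ->
  (forall r s, 0 <= r < rho -> 0 <= s <= 1 -> Cmod (N r s) <= cb) ->
  cont_in Omega h -> Omega z -> 0 <= M ->
  (forall s, 0 <= s <= 1 ->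
     Cmod (h (RtoC s * z)%C) <= M * exp (4 * cb * (s * Cmod z))) ->
  Cmod (VI N h z) <= cb * M * exp (4 * cb * Cmod z).
Proof.
  intros HN HB Hh Hz HM Hb.
  replace (cb * M * exp (4 * cb * Cmod z)) with ((1 - 0) * (cb * (M * exp (4 * cb * Cmod z))))
    by ring.
  unfold VI; apply Cmod_RIntC_le_const; [lra| |].
  - now apply (VI_integrable Omega Hstar N h z HN Hh Hz).
  - intros s Hs; rewrite Cmod_mult, clamp_id; trivial.
    assert (Hs2 : 0 <= s ^ 2 <= 1) by (simpl; nra).
    apply Rmult_le_compat; try apply Cmod_ge_0.
    + apply HB; trivial; now apply Omega_Cmod.
    + eapply Rle_trans; [now apply Hb|].
      apply Rmult_le_compat_l; trivial; apply exp_incr.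
      assert (Hz0 := Cmod_ge_0 z).
      assert (s ^ 2 * Cmod z <= Cmod z) by nra. nra.
Qed.

Lemma VI_plus N h1 h2 z : jcont N -> cont_in Omega h1 -> cont_in Omega h2 -> Omega z ->
  VI N (fun w => h1 w + h2 w)%C z = (VI N h1 z + VI N h2 z)%C.
Proof.
  intros HN H1 H2 Hz; unfold VI.
  rewrite <- RIntC_plus; try now apply (VI_integrable Omega Hstar).
  apply RIntC_ext; intros s _; cring.
Qed.

Lemma VI_opp N h z : jcont N -> cont_in Omega h -> Omega z ->
  VI N (fun w => - h w)%C z = (- VI N h z)%C.
Proof.
  intros HN H1 Hz; unfold VI.
  rewrite <- RIntC_opp; try now apply (VI_integrable Omega Hstar).
  apply RIntC_ext; intros s _; cring.
Qed.

Lemma VI_ext N h1 h2 z : (forall w, Omega w -> h1 w = h2 w) -> Omega z ->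
  VI N h1 z = VI N h2 z.
Proof.
  intros H Hz; unfold VI.
  apply RIntC_ext; intros s _.
  rewrite H; [trivial|]; now apply (star_clamp_sqr Omega Hstar).
Qed.

(** On the rays to all points near [z0] a continuous function is bounded. *)
Lemma ray_bound h z0 : cont_in Omega h -> Omega z0 ->
  exists M, 0 <= M /\
    locally z0 (fun z => forall s, 0 <= s <= 1 -> Cmod (h (RtoC s * z)%C) <= M).
Proof.
  intros Hh Hz0.
  destruct (continuity_ab_maj (fun s => Cmod (h (RtoC s * z0)%C)) 0 1) as [m [Hm Hm']].
  - lra.
  - intros s Hs; apply continuity_pt_filterlim.
    apply (continuous_Cmod_comp (fun s => h (RtoC s * z0)%C) s).
    apply (continuous_comp (fun s => RtoC s * z0)%C h s); [|now apply Hh, Hstar].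
    apply continuous_Cmult; [|apply continuous_const].
    apply continuous_RtoC, continuous_id.
  - exists (Cmod (h (RtoC m * z0)%C) + 1); split.
    { generalize (Cmod_ge_0 (h (RtoC m * z0)%C)); lra. }
    apply (locally_tube (fun z s => Cmod (h (RtoC s * z)%C) <= Cmod (h (RtoC m * z0)%C) + 1)).
    intros s Hs.
    assert (Hc : contC (fun p : C * R => h (RtoC (snd p) * fst p)%C) (z0, s)).
    { apply (continuous_comp (fun p : C * R => RtoC (snd p) * fst p)%C h).
      - apply continuous_Cmult; [apply continuous_RtoC, continuous_snd|apply continuous_fst].
      - simpl; now apply Hh, Hstar. }
    generalize (proj1 (continuous_C_eps _ _) Hc (mkposreal 1 Rlt_0_1)); apply filter_imp.
    intros [z t]; simpl; intros H.
    replace (h (RtoC t * z)%C) with ((h (RtoC t * z) - h (RtoC s * z0)) + h (RtoC s * z0))%C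
      by ring.
    eapply Rle_trans; [apply Cmod_triangle|].
    specialize (Hm s Hs); lra.
Qed.

Lemma ray_bound_at h z0 : cont_in Omega h -> Omega z0 ->
  exists M, 0 <= M /\ forall s, 0 <= s <= 1 -> Cmod (h (RtoC s * z0)%C) <= M.
Proof.
  intros Hh Hz; destruct (ray_bound h z0 Hh Hz) as [M [HM Hl]].
  exists M; split; trivial; exact (locally_singleton _ _ Hl).
Qed.

Lemma Cmod_small_0 (x : C) B :
  (forall n, Cmod x <= B * (1 / 2) ^ n) -> x = RtoC 0.
Proof.
  intros H; apply Cmod_eq_0; apply Rle_antisym; [|apply Cmod_ge_0].
  apply le_epsilon; intros eps He; rewrite Rplus_0_l.
  destruct (half_pow_small B (mkposreal eps He)) as [n Hn]; simpl in Hn.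
  specialize (H n); lra.
Qed.

Lemma quarter_le_half n : (1 / 4) ^ n <= (1 / 2) ^ n.
Proof. apply pow_incr; lra. Qed.

Variable N : R -> R -> C.
Hypothesis HN : jcont N.
Hypothesis HB : kernel_bound N.

(** The terms (- VI N)^k w of the Neumann series. *)
Fixpoint nterm (w : C -> C) (k : nat) : C -> C :=
  match k with
  | O => w
  | S k' => fun z => (- VI N (nterm w k') z)%C
  end.

(** The solution of u + VI N u = w. *)
Definition Neumann (w : C -> C) (z : C) : C := CSer (fun k => nterm w k z).

Lemma nterm_cont w k : cont_in Omega w -> cont_in Omega (nterm w k).
Proof.
  intros Hw; induction k as [|k IH]; simpl; trivial.
  intros z Hz; apply continuous_Copp; now apply (VI_cont Omega Hopen Hstar).
Qed.

Lemma nterm_bound w z M : cont_in Omega w -> Omega z -> 0 <= M ->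
  (forall s, 0 <= s <= 1 -> Cmod (w (RtoC s * z)%C) <= M) ->
  forall k s, 0 <= s <= 1 ->
    Cmod (nterm w k (RtoC s * z)%C) <= M * (1 / 4) ^ k * exp (4 * cb * (s * Cmod z)).
Proof.
  intros Hw Hz HM Hb; induction k as [|k IH]; intros s Hs.
  - simpl; rewrite Rmult_1_r; eapply Rle_trans; [now apply Hb|apply le_exp_weight; lra].
  - assert (Hsz : Omega (RtoC s * z)%C) by now apply Hstar.
    cbn [nterm]; rewrite Cmod_opp.
    rewrite <- (Cmod_scale s z) by tauto.
    replace (M * (1 / 4) ^ S k) with (M * (1 / 4) ^ k / 4) by (simpl; field).
    apply VI_contracts; trivial.
    + now apply nterm_cont.
    + apply Rmult_le_pos; trivial; apply pow_le; lra.
    + intros t Ht; rewrite Cmult_assoc, <- RtoC_mult, Cmod_scale by tauto.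
      replace (t * (s * Cmod z)) with (t * s * Cmod z) by ring.
      apply IH; nra.
Qed.

Lemma exp_le_rho z s : Omega z -> 0 <= s <= 1 -> exp (4 * cb * (s * Cmod z)) <= exp (4 * cb * rho).
Proof.
  intros Hz Hs; apply exp_incr; assert (H := Omega_Cmod z Hz).
  assert (s * Cmod z <= rho) by nra. nra.
Qed.

Lemma nterm_bound_half w z M : cont_in Omega w -> Omega z -> 0 <= M ->
  (forall s, 0 <= s <= 1 -> Cmod (w (RtoC s * z)%C) <= M) ->
  forall k s, 0 <= s <= 1 ->
    Cmod (nterm w k (RtoC s * z)%C) <= M * exp (4 * cb * rho) * (1 / 2) ^ k.
Proof.
  intros Hw Hz HM Hb k s Hs.
  eapply Rle_trans; [now apply (nterm_bound w z M)|].
  replace (M * exp (4 * cb * rho) * (1 / 2) ^ k)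
    with (M * (1 / 2) ^ k * exp (4 * cb * rho)) by ring.
  assert (H1 := half_pow_pos k).
  apply Rmult_le_compat.
  - apply Rmult_le_pos; trivial; apply pow_le; lra.
  - left; apply exp_pos.
  - apply Rmult_le_compat_l; trivial; apply quarter_le_half.
  - now apply exp_le_rho.
Qed.

Lemma Volterra_unique h : cont_in Omega h ->
  (forall z, Omega z -> (h z + VI N h z)%C = RtoC 0) ->
  forall z, Omega z -> h z = RtoC 0.
Proof.
  intros Hh E.
  (* the hypothesis makes every term of the Neumann series equal to h *)
  assert (Hk : forall k z, Omega z -> nterm h k z = h z).
  { induction k as [|k IH]; intros z Hz; trivial; cbn [nterm].
    rewrite (VI_ext N _ h z IH Hz).
    replace (h z) with ((h z + VI N h z) - VI N h z)%C by ring.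
    rewrite E by trivial; ring. }
  intros z Hz; destruct (ray_bound_at h z Hh Hz) as [M [HM Hb]].
  apply Cmod_small_0 with (M * exp (4 * cb * rho)); intros n.
  rewrite <- (Hk n z Hz), <- (Cmult_1_l z) at 1.
  apply nterm_bound_half; trivial; lra.
Qed.

Lemma Neumann_tail_cont w n : cont_in Omega w ->
  cont_in Omega (fun z => CSer (fun k => nterm w (n + k) z)).
Proof.
  intros Hw z0 Hz0.
  destruct (ray_bound w z0 Hw Hz0) as [M [HM Hl]].
  apply (continuous_CSer (fun k => nterm w (n + k)) z0 (M * exp (4 * cb * rho))).
  - intros k; now apply nterm_cont.
  - generalize (filter_and _ _ Hl (Hopen z0 Hz0)); apply filter_imp; intros z [Hz1 Hz2] k.
    replace z with (RtoC 1 * z)%C by apply Cmult_1_l.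
    eapply Rle_trans; [apply (nterm_bound_half w z M); trivial; lra|].
    apply Rmult_le_compat_l.
    + apply Rmult_le_pos; trivial; left; apply exp_pos.
    + apply half_pow_decr; lia.
Qed.

(** The remainders R_n of the series satisfy that R_n + VI N R_n - nterm w n
    does not depend on n, while it tends to 0. *)
Lemma Neumann_solves w : cont_in Omega w ->
  forall z, Omega z -> (Neumann w z + VI N (Neumann w) z)%C = w z.
Proof.
  intros Hw z Hz.
  destruct (ray_bound_at w z Hw Hz) as [M [HM Hb]].
  set (B := M * exp (4 * cb * rho)).
  assert (HB0 : 0 <= B) by (apply Rmult_le_pos; trivial; left; apply exp_pos).
  assert (Hbound := nterm_bound_half w z M Hw Hz HM Hb); fold B in Hbound.
  set (Rn := fun n z => CSer (fun k => nterm w (n + k) z)).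
  assert (HRc : forall n, cont_in Omega (Rn n)) by (intros; now apply Neumann_tail_cont).
  set (X := fun n => (Rn n z + VI N (Rn n) z - nterm w n z)%C).
  assert (Hstep : forall n y, Omega y -> Rn n y = (nterm w n y + Rn (S n) y)%C).
  { intros n y Hy; unfold Rn.
    destruct (ray_bound_at w y Hw Hy) as [My [HMy Hby]].
    rewrite (CSer_incr_1 _ (My * exp (4 * cb * rho))).
    - rewrite Nat.add_0_r; f_equal.
      apply CSer_ext; intros k; now rewrite Nat.add_succ_r.
    - intros k; replace y with (RtoC 1 * y)%C by ring.
      eapply Rle_trans; [apply (nterm_bound_half w y My); trivial; lra|].
      apply Rmult_le_compat_l.
      + apply Rmult_le_pos; trivial; left; apply exp_pos.
      + apply half_pow_decr; lia. }
  assert (HX : forall n, X n = X 0%nat).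
  { induction n as [|n IH]; trivial; rewrite <- IH; unfold X.
    rewrite (Hstep n z Hz).
    rewrite (VI_ext N (Rn n) (fun y => nterm w n y + Rn (S n) y)%C z (Hstep n) Hz).
    rewrite VI_plus; trivial; [|now apply nterm_cont].
    cbn [nterm]; ring. }
  assert (HXb : forall n, Cmod (X n) <= 6 * B * exp (4 * cb * rho) * (1 / 2) ^ n).
  { intros n; unfold X.
    assert (HR : forall s, 0 <= s <= 1 ->
      Cmod (Rn n (RtoC s * z)%C) <= 4 * B * (1 / 2) ^ n).
    { intros s Hs; unfold Rn; apply CSer_bound; intros k; now apply Hbound. }
    assert (H1 := HR 1 ltac:(lra)); replace (RtoC 1 * z)%C with z in H1 by ring.
    assert (H2 := Hbound n 1 ltac:(lra)); replace (RtoC 1 * z)%C with z in H2 by ring.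
    assert (Hp := half_pow_pos n).
    assert (He : 1 <= exp (4 * cb * rho)).
    { rewrite <- exp_0; apply exp_incr; apply Rmult_le_pos; [lra|].
      generalize (Omega_Cmod z Hz); lra. }
    assert (H3 : Cmod (VI N (Rn n) z) <= 4 * B * (1 / 2) ^ n / 4 * exp (4 * cb * Cmod z)).
    { apply VI_contracts; trivial.
      - apply Rmult_le_pos; lra.
      - intros s Hs; eapply Rle_trans; [now apply HR|apply le_exp_weight; [|lra]].
        apply Rmult_le_pos; lra. }
    assert (H4 := exp_le_rho z 1 Hz ltac:(lra)); rewrite Rmult_1_l in H4.
    assert (H5 : B * (1 / 2) ^ n * exp (4 * cb * Cmod z)
                 <= B * (1 / 2) ^ n * exp (4 * cb * rho)).
    { apply Rmult_le_compat_l; trivial; apply Rmult_le_pos; lra. }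
    assert (H6 : B * (1 / 2) ^ n * 1 <= B * (1 / 2) ^ n * exp (4 * cb * rho)).
    { apply Rmult_le_compat_l; trivial; apply Rmult_le_pos; lra. }
    unfold Cminus; eapply Rle_trans; [apply Cmod_triangle|]; rewrite Cmod_opp.
    assert (H7 := Cmod_triangle (Rn n z) (VI N (Rn n) z)).
    lra. }
  assert (H0 : X 0%nat = RtoC 0).
  { apply Cmod_small_0 with (6 * B * exp (4 * cb * rho)); intros n; rewrite <- (HX n).
    apply HXb. }
  unfold X in H0; simpl in H0.
  replace (w z) with (w z + (Rn 0%nat z + VI N (Rn 0%nat) z - w z))%C by (rewrite H0; ring).
  change (Neumann w) with (Rn 0%nat); ring.
Qed.

Variable N' : R -> R -> C.
Hypothesis HN' : jcont N'.
Hypothesis HNd : forall r s, 0 < r < rho -> is_derC (fun r => N r s) r (N' r s).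
Hypothesis HN'0 : RIntC (N' 0) 0 1 = RtoC 0.
Hypothesis HB' : forall r s, 0 <= r < rho -> 0 <= s <= 1 -> Cmod (N' r s) <= cb.

(** The derivative of [nterm w k] in the direction [e], when [w'] is that of
    [w]. *)
Fixpoint nterm' (e : C) (w w' : C -> C) (k : nat) : C -> C :=
  match k with
  | O => w'
  | S k' => fun z => (- VId e N N' (nterm w k') (nterm' e w w' k') z)%C
  end.

Lemma nterm_C1dir e w w' k : e <> RtoC 0 -> C1dir Omega e w w' ->
  C1dir Omega e (nterm w k) (nterm' e w w' k).
Proof.
  intros He Hw; induction k as [|k IH]; simpl; trivial.
  assert (H := VI_C1dir Omega Hopen Hstar rho Hrho N N' HN HN' HNd HN'0 e _ _ He IH).
  destruct H as [H1 [H2 H3]]; split; [|split].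
  - intros z Hz; apply continuous_Copp; now apply H1.
  - intros z Hz; apply continuous_Copp; now apply H2.
  - intros z Hz; apply is_derC_opp; now apply H3.
Qed.

Lemma nterm'_bound e w w' z M L : Cmod e = 1 -> C1dir Omega e w w' -> Omega z -> 0 <= M ->
  (forall s, 0 <= s <= 1 -> Cmod (w (RtoC s * z)%C) <= M) ->
  (forall s, 0 <= s <= 1 -> Cmod (w' (RtoC s * z)%C) <= L) ->
  4 * cb * M <= L ->
  forall k s, 0 <= s <= 1 ->
    Cmod (nterm' e w w' k (RtoC s * z)%C) <= L * (1 / 2) ^ k * exp (4 * cb * (s * Cmod z)).
Proof.
  intros He Hw Hz HM Hb Hb' HL.
  assert (HL0 : 0 <= L) by nra.
  assert (He0 : e <> RtoC 0) by (intros E; rewrite E, Cmod_0 in He; lra).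
  induction k as [|k IH]; intros s Hs.
  - simpl; rewrite Rmult_1_r; eapply Rle_trans; [now apply Hb'|apply le_exp_weight; lra].
  - assert (Hsz : Omega (RtoC s * z)%C) by now apply Hstar.
    assert (HC := nterm_C1dir e w w' k He0 Hw).
    cbn [nterm']; rewrite Cmod_opp; unfold VId.
    assert (H1 : Cmod (VI N' (nterm w k) (RtoC s * z)%C)
                 <= cb * (M * (1 / 4) ^ k) * exp (4 * cb * Cmod (RtoC s * z)%C)).
    { apply VI_bounded; trivial.
      - apply HC.
      - apply Rmult_le_pos; trivial; apply pow_le; lra.
      - intros t Ht; rewrite Cmult_assoc, <- RtoC_mult, Cmod_scale by tauto.
      replace (t * (s * Cmod z)) with (t * s * Cmod z) by ring.
        apply nterm_bound; trivial; [apply Hw|nra]. }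
    assert (H2 : Cmod (VI (fun r s => N r s * RtoC (clamp 0 1 s ^ 2))%C (nterm' e w w' k)
                    (RtoC s * z)%C)
                 <= L * (1 / 2) ^ k / 4 * exp (4 * cb * Cmod (RtoC s * z)%C)).
    { apply VI_contracts; trivial.
      - apply jcont_mult; trivial; apply jcont_clamp_sqr.
      - intros r t Hr Ht; rewrite Cmod_mult, Cmod_R, Rabs_pos_eq by apply clamp_sqr_in.
        rewrite <- (Rmult_1_r (2 * cb * t * r)).
        apply Rmult_le_compat; try apply Cmod_ge_0; try apply clamp_sqr_in.
        now apply HB.
      - apply HC.
      - apply Rmult_le_pos; trivial; left; apply half_pow_pos.
      - intros t Ht; rewrite Cmult_assoc, <- RtoC_mult, Cmod_scale by tauto.
      replace (t * (s * Cmod z)) with (t * s * Cmod z) by ring.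
        apply IH; nra. }
    rewrite <- (Cmod_scale s z) by tauto.
    eapply Rle_trans; [apply Cmod_triangle|].
    rewrite Cmod_mult, Cmod_R.
    assert (H3 := dotC_Cmod_le e (RtoC s * z)%C); rewrite He in H3.
    set (E := exp (4 * cb * Cmod (RtoC s * z)%C)) in *.
    assert (HE : 0 < E) by apply exp_pos.
    assert (Hq := quarter_le_half k); assert (Hh := half_pow_pos k).
    set (V := Cmod (VI N' (nterm w k) (RtoC s * z)%C)) in *.
    assert (HV : 0 <= V) by apply Cmod_ge_0.
    assert (H4 : Rabs (dotC e (RtoC s * z)%C / Cmod (RtoC s * z)%C) * V <= V).
    { rewrite <- (Rmult_1_l V) at 2; apply Rmult_le_compat_r; trivial. }
    assert (H5 : cb * (M * (1 / 4) ^ k) <= L / 4 * (1 / 2) ^ k).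
    { replace (cb * (M * (1 / 4) ^ k)) with (cb * M * (1 / 4) ^ k) by ring.
      apply Rmult_le_compat; trivial; try nra.
      apply pow_le; lra. }
    assert (H6 : cb * (M * (1 / 4) ^ k) * E <= L / 4 * (1 / 2) ^ k * E).
    { apply Rmult_le_compat_r; lra. }
    replace (L * (1 / 2) ^ S k * E) with (L * (1 / 2) ^ k * E / 2) by (simpl; field).
    lra.
Qed.

Lemma Neumann_C1dir e w w' : Cmod e = 1 -> C1dir Omega e w w' ->
  exists u', C1dir Omega e (Neumann w) u'.
Proof.
  intros He Hw.
  assert (He0 : e <> RtoC 0) by (intros E; rewrite E, Cmod_0 in He; lra).
  exists (fun z => CSer (fun k => nterm' e w w' k z)).
  assert (Hloc : forall z0, Omega z0 -> exists B, locally z0 (fun z => Omega z /\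
    (forall k, Cmod (nterm w k z) <= B * (1 / 2) ^ k) /\
    (forall k, Cmod (nterm' e w w' k z) <= B * (1 / 2) ^ k))).
  { intros z0 Hz0.
    destruct (ray_bound w z0 (proj1 Hw) Hz0) as [M [HM Hl]].
    destruct (ray_bound w' z0 (proj1 (proj2 Hw)) Hz0) as [L [HL Hl']].
    set (B := (4 * cb * M + M + L)).
    assert (HcM : 0 <= cb * M) by (apply Rmult_le_pos; lra).
    exists (B * exp (4 * cb * rho)).
    generalize (filter_and _ _ (Hopen z0 Hz0) (filter_and _ _ Hl Hl')); apply filter_imp.
    intros z [Hz [H1 H2]]; split; trivial.
    assert (Hz1 : z = (RtoC 1 * z)%C) by (symmetry; apply Cmult_1_l).
    split; intros k; rewrite Hz1.
    - apply nterm_bound_half; trivial; try (apply Hw); try (unfold B; lra).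
      intros s Hs; eapply Rle_trans; [now apply H1|unfold B; lra].
    - eapply Rle_trans; [apply (nterm'_bound e w w' z M B); trivial|]; try (unfold B; lra).
      + intros s Hs; eapply Rle_trans; [now apply H2|unfold B; lra].
      + assert (Hh := half_pow_pos k).
        replace (B * exp (4 * cb * rho) * (1 / 2) ^ k)
          with (B * (1 / 2) ^ k * exp (4 * cb * rho)) by ring.
        apply Rmult_le_compat_l.
        * apply Rmult_le_pos; unfold B; lra.
        * apply exp_le_rho; trivial; lra. }
  split; [|split].
  - intros z Hz; apply (Neumann_tail_cont w 0 (proj1 Hw) z Hz).
  - intros z Hz; destruct (Hloc z Hz) as [B HBl].
    apply (continuous_CSer (nterm' e w w') z B).
    + intros k; now apply (nterm_C1dir e w w' k He0 Hw).
    + revert HBl; apply filter_imp; tauto.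
  - intros z Hz; destruct (Hloc z Hz) as [B HBl].
    assert (Hl : locally 0 (fun s => Omega (z + RtoC s * e)%C /\
      (forall k, Cmod (nterm w k (z + RtoC s * e)%C) <= B * (1 / 2) ^ k) /\
      (forall k, Cmod (nterm' e w w' k (z + RtoC s * e)%C) <= B * (1 / 2) ^ k))).
    { apply (continuous_line z e 0 (fun y => Omega y /\
        (forall k, Cmod (nterm w k y) <= B * (1 / 2) ^ k) /\
        (forall k, Cmod (nterm' e w w' k y) <= B * (1 / 2) ^ k))).
      now replace (z + RtoC 0 * e)%C with z by ring. }
    eapply is_derC_eq.
    + apply (is_derC_CSer (fun k s => nterm w k (z + RtoC s * e)%C)
               (fun k s => nterm' e w w' k (z + RtoC s * e)%C) 0 B).
      * revert Hl; apply filter_imp; tauto.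
      * revert Hl; apply filter_imp; tauto.
      * revert Hl; apply filter_imp; intros s [Hs _] k.
        apply is_derC_line_shift; now apply (nterm_C1dir e w w' k He0 Hw).
      * revert Hl; apply filter_imp; intros s [Hs _] k.
        apply (continuous_comp (fun s => z + RtoC s * e)%C (nterm' e w w' k));
          [apply continuous_line|].
        now apply (nterm_C1dir e w w' k He0 Hw).
    + now replace (z + RtoC 0 * e)%C with z by ring.
Qed.

End Volterra.

(** * The first-order system satisfied by the two kernels *)

Lemma is_derive_RInt_rect (X X' : R -> R -> R) (rho r : R) :
  (forall p : R * R, continuous (fun q : R * R => X (fst q) (snd q)) p) ->
  (forall p : R * R, continuous (fun q : R * R => X' (fst q) (snd q)) p) ->
  (forall r t, 0 < r < rho -> 0 <= t <= 1 -> is_derive (fun s => X s t) r (X' r t)) ->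
  0 < r < rho ->
  is_derive (fun s => RInt (X s) 0 1) r (RInt (X' r) 0 1).
Proof.
  intros HX HX' Hd Hr.
  assert (E : forall Y : R -> R -> R, forall s, RInt (Y s) 0 1 = RInt (fun t => Y s (clamp 0 1 t)) 0 1).
  { intros Y s; apply (RInt_ext (V := R_CompleteNormedModule)).
    rewrite Rmin_left, Rmax_right by lra; intros t Ht; rewrite clamp_id; trivial; lra. }
  rewrite E.
  apply is_derive_ext with (fun s => RInt (fun t => X s (clamp 0 1 t)) 0 1).
  { intros s; symmetry; apply E. }
  apply (is_derive_RInt_param_everywhere (fun s t => X s (clamp 0 1 t))
           (fun s t => X' s (clamp 0 1 t))); [lra| | |].
  - generalize (locally_itv 0 rho r Hr); apply filter_imp; intros s Hs t.
    apply Hd; trivial; apply clamp_in; lra.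
  - apply filter_forall; intros s t _.
    apply (continuous_comp (fun t => (s, clamp 0 1 t)) (fun q : R * R => X (fst q) (snd q)));
      [|apply HX].
    apply continuous_pairR; [apply continuous_const|apply continuous_clamp].
  - intros t _.
    apply (continuous_comp (fun p : R * R => (fst p, clamp 0 1 (snd p)))
             (fun q : R * R => X' (fst q) (snd q))); [|apply HX'].
    apply continuous_pairR; [apply continuous_fst|].
    apply (continuous_comp (fun p : R * R => snd p) (clamp 0 1));
      [apply continuous_snd|apply continuous_clamp].
Qed.

Lemma RInt_zero_nonneg (f : R -> R) (t : R) :
  (forall x, continuous f x) -> (forall x, 0 <= x <= 1 -> 0 <= f x) ->
  RInt f 0 1 = 0 -> 0 < t < 1 -> f t = 0.
Proof.
  intros Hc Hp H0 Ht.
  destruct (Rle_lt_or_eq_dec 0 (f t) (Hp t ltac:(lra))) as [Hft|]; [exfalso|congruence].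
  assert (Hl : locally t (fun s => 0 < f s /\ 0 < s < 1)).
  { apply filter_and; [|now apply locally_itv].
    exact (Hc t _ (open_gt 0 (f t) Hft)). }
  destruct Hl as [d Hd].
  assert (Hd' : forall s, t - d / 2 <= s <= t + d / 2 -> 0 < f s /\ 0 < s < 1).
  { intros s Hs; apply Hd; apply ball_R.
    generalize (cond_pos d); intros; apply Rabs_def1; lra. }
  assert (Hdp := cond_pos d).
  assert (HI : forall a b, ex_RInt f a b).
  { intros a b; apply (ex_RInt_continuous (V := R_CompleteNormedModule)); trivial. }
  assert (H1 := Hd' (t - d / 2) ltac:(lra)).
  assert (H2 := Hd' (t + d / 2) ltac:(lra)).
  assert (Hm : 0 < RInt f (t - d / 2) (t + d / 2)).
  { apply RInt_gt_0; [lra| |]; intros s Hs; [now destruct (Hd' s ltac:(lra))|apply Hc]. }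
  assert (Hg : forall a b, 0 <= a <= b -> b <= 1 -> 0 <= RInt f a b).
  { intros a b Hab Hb; apply RInt_ge_0; [lra|trivial|]; intros s Hs; apply Hp; lra. }
  assert (G1 := Hg 0 (t - d / 2) ltac:(lra) ltac:(lra)).
  assert (G2 := Hg (t + d / 2) 1 ltac:(lra) ltac:(lra)).
  assert (C1 := RInt_Chasles f 0 (t - d / 2) (t + d / 2) (HI _ _) (HI _ _)).
  assert (C2 := RInt_Chasles f 0 (t + d / 2) 1 (HI _ _) (HI _ _)).
  unfold plus in *; simpl in *; lra.
Qed.

(** Gronwall's lemma for a nonnegative function that vanishes at 0. *)
Lemma Gronwall_zero (F F' : R -> R) (rho m : R) :
  (forall r, continuous F r) -> (forall r, 0 < r < rho -> is_derive F r (F' r)) ->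
  (forall r, 0 < r < rho -> F' r <= m * F r) ->
  F 0 = 0 -> (forall r, 0 <= F r) -> forall r, 0 < r < rho -> F r = 0.
Proof.
  intros Hc Hd Hi H0 Hp r Hr.
  set (Q := fun s => F s * exp (- m * s)).
  assert (HQc : forall s, continuous Q s).
  { intros s; apply continuous_Rmult; trivial.
    apply ex_derive_continuous_R; auto_derive; trivial. }
  assert (Hmono : forall s, 0 < s < r -> Q r <= Q s).
  { intros s Hs.
    destruct (MVT_gen Q s r
      (fun s => F' s * exp (- m * s) + F s * (- m * exp (- m * s)))) as [c [Hc' E]].
    - rewrite Rmin_left, Rmax_right by lra; intros x Hx.
      apply (is_derive_Rmult F (fun s => exp (- m * s))); [apply Hd; lra|].
      auto_derive; trivial; ring.
    - intros x _; apply continuity_pt_filterlim; apply HQc.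
    - rewrite Rmin_left, Rmax_right in Hc' by lra.
      assert (He' := exp_pos (- m * c)).
      assert (F' c <= m * F c) by (apply Hi; lra).
      assert (0 < exp (- m * c) * (r - s)) by nra.
      assert ((F' c * exp (- m * c) + F c * (- m * exp (- m * c))) * (r - s) <= 0).
      { replace ((F' c * exp (- m * c) + F c * (- m * exp (- m * c))) * (r - s))
          with ((F' c - m * F c) * (exp (- m * c) * (r - s))) by ring. nra. }
      lra. }
  assert (HQ0 : Q 0 = 0) by (unfold Q; rewrite H0; ring).
  assert (HQr : Q r <= 0).
  { apply Rnot_lt_le; intros Hlt.
    assert (Hl : locally 0 (fun s => Q s < Q r)).
    { apply (HQc 0 (fun y => y < Q r)); rewrite HQ0; apply (open_lt (Q r) 0 Hlt). }
    destruct (locally_R_meets_itv 0 r 0 _ ltac:(lra) ltac:(lra) Hl) as [s [Hs Hs']].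
    specialize (Hmono s Hs'); lra. }
  assert (He := exp_pos (- m * r)); unfold Q in HQr; specialize (Hp r).
  apply Rle_antisym; trivial; apply Rnot_lt_le; intros Hlt.
  assert (0 < F r * exp (- m * r)) by now apply Rmult_lt_0_compat. lra.
Qed.

Lemma sqmod_ge_0 z : 0 <= sqmod z.
Proof. unfold sqmod; nra. Qed.

Lemma sqmod_0 z : sqmod z = 0 -> z = RtoC 0.
Proof.
  unfold sqmod; intros H; apply Ceq; simpl; nra.
Qed.

Lemma sqmod_Cmod z : sqmod z = Cmod z * Cmod z.
Proof.
  unfold sqmod; replace (Cmod z * Cmod z) with (Cmod z ^ 2) by ring.
  rewrite Cmod_pair_sqr; ring.
Qed.

Lemma is_derive_sqmod f x l : is_derC f x l -> is_derive (fun y => sqmod (f y)) x (2 * dotC (f x) l).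
Proof.
  rewrite is_derC_iff; intros [? ?]; unfold sqmod, dotC.
  eapply is_derive_eq.
  - apply (is_derive_plus (V := R_NormedModule)); apply is_derive_Rmult; eassumption.
  - unfold plus; simpl; ring.
Qed.

Lemma dotC_mult_le (p d s : C) (M : R) : Cmod p <= M ->
  - dotC s (p * d)%C <= M / 2 * (sqmod s + sqmod d).
Proof.
  intros Hp.
  assert (H1 : Rabs (dotC s (p * d)%C) <= Cmod s * Cmod (p * d)%C) by apply dotC_le.
  rewrite Cmod_mult in H1; rewrite !sqmod_Cmod.
  assert (Hs := Cmod_ge_0 s); assert (Hd := Cmod_ge_0 d); assert (Hp0 := Cmod_ge_0 p).
  assert (H3 : - dotC s (p * d)%C <= Rabs (dotC s (p * d)%C)).
  { rewrite <- Rabs_Ropp; apply Rle_abs. }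
  assert (H4 : Cmod s * (Cmod p * Cmod d) <= Cmod s * (M * Cmod d)).
  { apply Rmult_le_compat_l; trivial; apply Rmult_le_compat_r; trivial. }
  assert (H5 : 2 * (Cmod s * Cmod d) <= Cmod s * Cmod s + Cmod d * Cmod d).
  { assert (H := pow2_ge_0 (Cmod s - Cmod d)); simpl in H; lra. }
  assert (H6 : M / 2 * (2 * (Cmod s * Cmod d)) <= M / 2 * (Cmod s * Cmod s + Cmod d * Cmod d)).
  { apply Rmult_le_compat_l; lra. }
  lra.
Qed.

(** [G] is continuous with its partial derivatives [Gr], [Gt], [Grr], [Grt] on
    the whole plane; they are its derivatives only in the interior of the
    rectangle [0, rho] x [0, 1]. *)
Definition C2rect (rho : R) (G Gr Gt Grr Grt : R -> R -> C) : Prop :=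
  (jcont G /\ jcont Gr /\ jcont Gt /\ jcont Grr /\ jcont Grt) /\
  forall r t, 0 < r < rho -> 0 < t < 1 ->
    is_derC (fun s => G s t) r (Gr r t) /\ is_derC (G r) t (Gt r t) /\
    is_derC (fun s => Gr s t) r (Grr r t) /\ is_derC (Gr r) t (Grt r t) /\
    is_derC (fun s => Gt s t) r (Grt r t).

Lemma C2rect_edge_r rho G Gr Gt Grr Grt r t : C2rect rho G Gr Gt Grr Grt ->
  0 < r < rho -> 0 <= t <= 1 -> is_derC (fun s => G s t) r (Gr r t).
Proof.
  intros [[HG [HGr _]] Hd] Hr Ht.
  apply (is_derC_edge G Gr 0 rho 0 1); trivial; [lra|].
  intros; now apply Hd.
Qed.

Lemma C2rect_edge_t rho G Gr Gt Grr Grt r t : C2rect rho G Gr Gt Grr Grt ->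
  0 < rho -> 0 <= r <= rho -> 0 < t < 1 -> is_derC (G r) t (Gt r t).
Proof.
  intros [[HG [_ [HGt _]]] Hd] Hrho Hr Ht.
  assert (Hsw : forall N, jcont N -> jcont (fun t r => N r t)).
  { intros N HN p; apply (jcont_comp N (fun q : R * R => snd q) (fun q : R * R => fst q)); trivial.
    - destruct p; apply continuous_snd.
    - destruct p; apply continuous_fst. }
  apply (is_derC_edge (fun t r => G r t) (fun t r => Gt r t) 0 1 0 rho); trivial.
  - now apply Hsw.
  - now apply Hsw.
  - intros; now apply Hd.
Qed.

Section Kernels.

Variable rho : R.
Hypothesis Hrho : 0 < rho.
Variables G Gr Gt Grr Grt K Kr Kt Krr Krt : R -> R -> C.
Hypothesis HG : C2rect rho G Gr Gt Grr Grt.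
Hypothesis HK : C2rect rho K Kr Kt Krr Krt.
Variables p q : R -> C.
Variable M : R.
Hypothesis Hpc : forall r, contC p r.
Hypothesis HpM : forall r, 0 < r < rho -> Cmod (p r) <= M.
Hypothesis Hpd : forall r, 0 < r < rho ->
  is_derC (fun s => RtoC s * p s)%C r (RtoC r * (q r - p r * p r))%C.
Hypothesis HGeq : forall r t, 0 < r < rho -> 0 < t < 1 ->
  (RtoC r * (Grr r t - q r * G r t) - Gr r t + RtoC (2 * (1 - t)) * Grt r t)%C = RtoC 0.
Hypothesis HKeq : forall r t, 0 < r < rho -> 0 < t < 1 ->
  (RtoC r * (Krr r t - (RtoC 2 * (p r * p r) - q r) * K r t) - Kr r t
   + RtoC (2 * (1 - t)) * Krt r t)%C = RtoC 0.
Hypothesis HG0 : forall t, 0 <= t <= 1 -> G 0 t = RtoC 0.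
Hypothesis HK0 : forall t, 0 <= t <= 1 -> K 0 t = RtoC 0.
Hypothesis HGb : forall r, 0 < r < rho -> is_derC (fun s => G s 0) r (RtoC r * q r)%C.
Hypothesis HKb : forall r, 0 < r < rho ->
  is_derC (fun s => K s 0) r (RtoC r * (RtoC 2 * (p r * p r) - q r))%C.
Hypothesis HGKb : forall r, 0 < r < rho -> (G r 0 - K r 0)%C = (RtoC (2 * r) * p r)%C.

(** [eS + eD] and [eS - eD] are twice the defects of the two first-order
    identities between the kernels. *)
Definition eS r t : C :=
  (RtoC r * (Gr r t + Kr r t) - RtoC r * p r * (G r t - K r t))%C.
Definition eD r t : C :=
  (RtoC r * (Gr r t - Kr r t) - RtoC r * p r * (G r t + K r t)
   + RtoC (2 * (1 - t)) * (Gt r t - Kt r t) - RtoC 2 * (G r t - K r t))%C.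

(* The derivatives of [eS] in t and in r.  In the latter the equations of the
   kernels replace the second derivatives in r, which clears the factor r of
   the system. *)
Let St r t : C := (RtoC r * (Grt r t + Krt r t - p r * (Gt r t - Kt r t)))%C.
Let Sr r t : C :=
  (RtoC 2 * (Gr r t + Kr r t) - RtoC 2 * p r * (G r t - K r t) - p r * eD r t
   - RtoC (2 * (1 - t)) * (Grt r t + Krt r t - p r * (Gt r t - Kt r t)))%C.

Let JG : jcont G := proj1 (proj1 HG).
Let JGr : jcont Gr := proj1 (proj2 (proj1 HG)).
Let JGt : jcont Gt := proj1 (proj2 (proj2 (proj1 HG))).
Let JGrt : jcont Grt := proj2 (proj2 (proj2 (proj2 (proj1 HG)))).
Let JK : jcont K := proj1 (proj1 HK).
Let JKr : jcont Kr := proj1 (proj2 (proj1 HK)).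
Let JKt : jcont Kt := proj1 (proj2 (proj2 (proj1 HK))).
Let JKrt : jcont Krt := proj2 (proj2 (proj2 (proj2 (proj1 HK)))).

Lemma jcont_eS : jcont eS.
Proof. intros [r t]; unfold eS; cont. Qed.

Lemma jcont_eD : jcont eD.
Proof. intros [r t]; unfold eD; cont. Qed.

Let JS : jcont eS := jcont_eS.
Let JD : jcont eD := jcont_eD.

Let jcont_St : jcont St.
Proof. intros [r t]; unfold St; cont. Qed.

Let jcont_Sr : jcont Sr.
Proof. intros [r t]; unfold Sr; cont. Qed.

Lemma RtoC_neq_0 r : r <> 0 -> RtoC r <> RtoC 0.
Proof. intros H E; now apply H, RtoC_inj. Qed.

Lemma is_derC_id r : is_derC (fun s => RtoC s) r (RtoC 1).
Proof.
  apply (is_derC_RtoC (fun s => s)); apply (is_derive_id (K := R_AbsRing)).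
Qed.

Lemma eS_derivative_r r t : 0 < r < rho -> 0 < t < 1 -> is_derC (fun s => eS s t) r (Sr r t).
Proof.
  intros Hr Ht.
  destruct (proj2 HG r t Hr Ht) as [g1 [g2 [g3 [g4 g5]]]].
  destruct (proj2 HK r t Hr Ht) as [k1 [k2 [k3 [k4 k5]]]].
  assert (Eg := HGeq r t Hr Ht); assert (Ek := HKeq r t Hr Ht).
  unfold eS; eapply is_derC_eq.
  - apply (is_derC_minus (fun s => RtoC s * (Gr s t + Kr s t))%C
             (fun s => RtoC s * p s * (G s t - K s t))%C).
    + apply (is_derC_mult (fun s => RtoC s) (fun s => Gr s t + Kr s t)%C); [apply is_derC_id|].
      apply (is_derC_plus (fun s => Gr s t) (fun s => Kr s t)); eassumption.
    + apply (is_derC_mult (fun s => RtoC s * p s)%C (fun s => G s t - K s t)%C); [now apply Hpd|].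
      apply (is_derC_minus (fun s => G s t) (fun s => K s t)); eassumption.
  - unfold Sr, eD.
    ceq.
    set (g := (RtoC r * (Grr r t - q r * G r t) - Gr r t + RtoC (2 * (1 - t)) * Grt r t)%C) in *.
    set (k := (RtoC r * (Krr r t - (RtoC 2 * (p r * p r) - q r) * K r t) - Kr r t
                 + RtoC (2 * (1 - t)) * Krt r t)%C) in *.
    match goal with |- ?a = ?b => replace a with (b + g + k)%C end.
    + rewrite Eg, Ek; ring.
    + unfold g, k; ring.
Qed.

Lemma eS_derivative_t r t : 0 < r < rho -> 0 < t < 1 -> is_derC (eS r) t (St r t).
Proof.
  intros Hr Ht.
  destruct (proj2 HG r t Hr Ht) as [g1 [g2 [g3 [g4 g5]]]].
  destruct (proj2 HK r t Hr Ht) as [k1 [k2 [k3 [k4 k5]]]].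
  unfold eS; eapply is_derC_eq.
  - apply (is_derC_minus (fun t => RtoC r * (Gr r t + Kr r t))%C
             (fun t => RtoC r * p r * (G r t - K r t))%C).
    + apply (is_derC_mult (fun _ => RtoC r) (fun t => Gr r t + Kr r t)%C); [apply is_derC_const|].
      apply (is_derC_plus (Gr r) (Kr r)); eassumption.
    + apply (is_derC_mult (fun _ => RtoC r * p r)%C (fun t => G r t - K r t)%C);
        [apply is_derC_const|].
      apply (is_derC_minus (G r) (K r)); eassumption.
  - unfold St; cring.
Qed.

Lemma eD_derivative_r r t : 0 < r < rho -> 0 < t < 1 ->
  is_derC (fun s => eD s t) r (- (p r * eS r t))%C.
Proof.
  intros Hr Ht.
  destruct (proj2 HG r t Hr Ht) as [g1 [g2 [g3 [g4 g5]]]].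
  destruct (proj2 HK r t Hr Ht) as [k1 [k2 [k3 [k4 k5]]]].
  assert (Eg := HGeq r t Hr Ht); assert (Ek := HKeq r t Hr Ht).
  unfold eD; eapply is_derC_eq.
  - apply (is_derC_minus (fun s => RtoC s * (Gr s t - Kr s t) - RtoC s * p s * (G s t + K s t)
             + RtoC (2 * (1 - t)) * (Gt s t - Kt s t))%C
             (fun s => RtoC 2 * (G s t - K s t))%C).
    + apply (is_derC_plus (fun s => RtoC s * (Gr s t - Kr s t) - RtoC s * p s * (G s t + K s t))%C
               (fun s => RtoC (2 * (1 - t)) * (Gt s t - Kt s t))%C).
      * apply (is_derC_minus (fun s => RtoC s * (Gr s t - Kr s t))%C
                 (fun s => RtoC s * p s * (G s t + K s t))%C).
        -- apply (is_derC_mult (fun s => RtoC s) (fun s => Gr s t - Kr s t)%C); [apply is_derC_id|].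
           apply (is_derC_minus (fun s => Gr s t) (fun s => Kr s t)); eassumption.
        -- apply (is_derC_mult (fun s => RtoC s * p s)%C (fun s => G s t + K s t)%C);
             [now apply Hpd|].
           apply (is_derC_plus (fun s => G s t) (fun s => K s t)); eassumption.
      * apply (is_derC_mult (fun _ => RtoC (2 * (1 - t))) (fun s => Gt s t - Kt s t)%C);
          [apply is_derC_const|].
        apply (is_derC_minus (fun s => Gt s t) (fun s => Kt s t)); eassumption.
    + apply (is_derC_mult (fun _ => RtoC 2) (fun s => G s t - K s t)%C); [apply is_derC_const|].
      apply (is_derC_minus (fun s => G s t) (fun s => K s t)); eassumption.
  - unfold eS.
    ceq.
    set (g := (RtoC r * (Grr r t - q r * G r t) - Gr r t + RtoC (2 * (1 - t)) * Grt r t)%C) in *.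
    set (k := (RtoC r * (Krr r t - (RtoC 2 * (p r * p r) - q r) * K r t) - Kr r t
                 + RtoC (2 * (1 - t)) * Krt r t)%C) in *.
    match goal with |- ?a = ?b => replace a with (b + g - k)%C end.
    + rewrite Eg, Ek; ring.
    + unfold g, k; ring.
Qed.

Lemma eS_at_t0 r : 0 < r < rho -> eS r 0 = RtoC 0.
Proof.
  intros Hr; unfold eS.
  assert (E1 : Gr r 0 = (RtoC r * q r)%C).
  { apply (is_derC_unique (fun s => G s 0) r); [|now apply HGb].
    apply (C2rect_edge_r rho G Gr Gt Grr Grt); trivial; lra. }
  assert (E2 : Kr r 0 = (RtoC r * (RtoC 2 * (p r * p r) - q r))%C).
  { apply (is_derC_unique (fun s => K s 0) r); [|now apply HKb].
    apply (C2rect_edge_r rho K Kr Kt Krr Krt); trivial; lra. }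
  rewrite HGKb, E1, E2, RtoC_mult by trivial; ring.
Qed.

Lemma C2rect_Gt_0 N Nr Nt Nrr Nrt t : C2rect rho N Nr Nt Nrr Nrt ->
  (forall t, 0 <= t <= 1 -> N 0 t = RtoC 0) -> 0 < t < 1 -> Nt 0 t = RtoC 0.
Proof.
  intros HN H0 Ht.
  apply (is_derC_unique (N 0) t).
  - apply (C2rect_edge_t rho N Nr Nt Nrr Nrt); trivial; lra.
  - apply is_derC_ext_loc with (fun _ => RtoC 0); [|apply is_derC_const].
    generalize (locally_itv 0 1 t Ht); apply filter_imp; intros s Hs; symmetry; apply H0; lra.
Qed.

Lemma eS_at_r0 t : 0 < t < 1 -> eS 0 t = RtoC 0.
Proof. intros Ht; unfold eS; ring. Qed.

Lemma eD_at_r0 t : 0 < t < 1 -> eD 0 t = RtoC 0.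
Proof.
  intros Ht; unfold eD.
  rewrite (C2rect_Gt_0 G Gr Gt Grr Grt t HG HG0 Ht), (C2rect_Gt_0 K Kr Kt Krr Krt t HK HK0 Ht).
  rewrite HG0, HK0 by lra; ring.
Qed.

(** The density of the energy of the defects.  The weight 1 - t makes the
    boundary terms of the integration by parts in t cancel. *)
Let X r t : R := (1 - t) * (sqmod (eS r t) + sqmod (eD r t)).
Let X' r t : R :=
  (1 - t) * (2 * dotC (eS r t) (Sr r t) + 2 * dotC (eD r t) (- (p r * eS r t))%C).
(* The r-derivative of the density is at most - (2 / r) Y_t plus 2 M times the
   density, and [Y] vanishes at t = 0 and t = 1. *)
Let Y r t : R := (1 - t) ^ 2 * sqmod (eS r t).
Let Y' r t : R := -2 * (1 - t) * sqmod (eS r t) + (1 - t) ^ 2 * (2 * dotC (eS r t) (St r t)).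

Let cont_X x : continuous (fun q : R * R => X (fst q) (snd q)) x.
Proof. destruct x; unfold X; cont. Qed.

Let cont_X' x : continuous (fun q : R * R => X' (fst q) (snd q)) x.
Proof. destruct x; unfold X'; cont. Qed.

Let cont_Y' x : continuous (fun q : R * R => Y' (fst q) (snd q)) x.
Proof. destruct x; unfold Y'; cont. Qed.

Let cont_second (Z : R -> R -> R) r t :
  (forall x, continuous (fun q : R * R => Z (fst q) (snd q)) x) -> continuous (Z r) t.
Proof.
  intros HZ; apply (continuous_comp (fun t => (r, t)) (fun q : R * R => Z (fst q) (snd q)));
    [|apply HZ].
  apply continuous_pairR; [apply continuous_const|apply continuous_id].
Qed.

Let X_derivative r t : 0 < r < rho -> 0 <= t <= 1 -> is_derive (fun s => X s t) r (X' r t).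
Proof.
  intros Hr Ht; unfold X, X'.
  assert (H1 : is_derC (fun s => eS s t) r (Sr r t)).
  { apply (is_derC_edge eS Sr 0 rho 0 1); trivial; try lra.
    apply eS_derivative_r. }
  assert (H2 : is_derC (fun s => eD s t) r (- (p r * eS r t))%C).
  { apply (is_derC_edge eD (fun r t => - (p r * eS r t))%C 0 rho 0 1); trivial; try lra.
    - intros [x y]; cont.
    - apply eD_derivative_r. }
  apply is_derive_sqmod in H1, H2.
  eapply is_derive_eq.
  - apply (is_derive_Rmult (fun _ => 1 - t) (fun s => sqmod (eS s t) + sqmod (eD s t))).
    + apply (is_derive_const (V := R_NormedModule)).
    + apply (is_derive_plus (V := R_NormedModule)); eassumption.
  - unfold zero, plus; simpl; ring.
Qed.

Let Y'_integral r : 0 < r < rho -> RInt (Y' r) 0 1 = 0.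
Proof.
  intros Hr.
  rewrite (RInt_derivative_interior (Y r)); trivial.
  - unfold Y; rewrite eS_at_t0; trivial; unfold sqmod; simpl; ring.
  - lra.
  - intros t Ht; unfold Y, Y'.
    assert (H := is_derive_sqmod _ _ _ (eS_derivative_t r t Hr Ht)).
    eapply is_derive_eq.
    + apply is_derive_Rmult; [|exact H].
      auto_derive; trivial.
    + simpl; ring.
  - intros t _; apply (cont_second Y); intros [r' t']; unfold Y; cont.
  - intros t; apply (cont_second Y'); trivial.
Qed.

Let X'_le r t : 0 < r < rho -> 0 <= t <= 1 -> X' r t <= - (2 / r) * Y' r t + 2 * M * X r t.
Proof.
  intros Hr Ht.
  assert (Hi1 := dotC_mult_le (p r) (eD r t) (eS r t) M (HpM r Hr)).
  assert (Hi2 := dotC_mult_le (p r) (eS r t) (eD r t) M (HpM r Hr)).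
  assert (E : (RtoC r * Sr r t)%C =
    (RtoC 2 * eS r t - RtoC (2 * (1 - t)) * St r t - RtoC r * (p r * eD r t))%C).
  { unfold Sr, St, eS; ring. }
  assert (E1 : r * dotC (eS r t) (Sr r t) =
    2 * sqmod (eS r t) - 2 * (1 - t) * dotC (eS r t) (St r t)
    - r * dotC (eS r t) (p r * eD r t)%C).
  { transitivity (dotC (eS r t) (RtoC r * Sr r t)%C).
    - unfold dotC; simpl; unfold Re, Im; ring.
    - rewrite E; unfold dotC, sqmod; simpl; unfold Re, Im; ring. }
  assert (E2 : dotC (eD r t) (- (p r * eS r t))%C = - dotC (eD r t) (p r * eS r t)%C).
  { unfold dotC; simpl; ring. }
  set (I1 := dotC (eS r t) (p r * eD r t)%C) in *.
  set (I2 := dotC (eD r t) (p r * eS r t)%C) in *.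
  assert (E3 : X' r t = - (2 / r) * Y' r t + 2 * (1 - t) * (- I1 - I2)).
  { unfold X', Y'; rewrite E2.
    assert (E1' : dotC (eS r t) (Sr r t) =
      (2 * sqmod (eS r t) - 2 * (1 - t) * dotC (eS r t) (St r t) - r * I1) / r).
    { rewrite <- E1; field; lra. }
    rewrite E1'; field; lra. }
  rewrite E3; unfold X.
  assert (H : 2 * (1 - t) * (- I1 - I2)
              <= 2 * (1 - t) * (M * (sqmod (eS r t) + sqmod (eD r t)))).
  { apply Rmult_le_compat_l; lra. }
  lra.
Qed.

Let energy r : R := RInt (X r) 0 1.

Let ex_RInt_second (Z : R -> R -> R) r :
  (forall x, continuous (fun q : R * R => Z (fst q) (snd q)) x) -> ex_RInt (Z r) 0 1.
Proof.
  intros HZ; apply (ex_RInt_continuous (V := R_CompleteNormedModule)).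
  intros t _; now apply cont_second.
Qed.

Let energy_zero r : 0 < r < rho -> energy r = 0.
Proof.
  revert r; apply (Gronwall_zero energy (fun r => RInt (X' r) 0 1) rho (2 * M)).
  - intros r; unfold energy.
    assert (H : contC (fun r => RIntC (fun t => RtoC (X r t)) 0 1) r).
    { apply (continuous_RIntC_param (fun r t => RtoC (X r t))); [lra| |].
      - apply filter_forall; intros s t _; apply continuous_RtoC; now apply cont_second.
      - intros t _; apply continuous_RtoC, cont_X. }
    apply (continuous_cpt _ _ true) in H.
    apply continuous_ext with (2 := H); intros s.
    apply (RIntC_cpt true (fun t => RtoC (X s t))).
    apply ex_RIntC_continuous; intros t _; apply continuous_RtoC; now apply cont_second.
  - intros r Hr; now apply (is_derive_RInt_rect X X' rho r).
  - intros r Hr.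
    replace (2 * M * energy r) with (RInt (fun t => - (2 / r) * Y' r t + 2 * M * X r t) 0 1).
    + apply RInt_le; [lra|now apply ex_RInt_second| |].
      * apply (ex_RInt_plus (V := R_NormedModule)); apply (ex_RInt_scal (V := R_NormedModule));
          now apply ex_RInt_second.
      * intros t Ht; apply X'_le; lra.
    + rewrite (RInt_plus (V := R_CompleteNormedModule) (fun t => - (2 / r) * Y' r t)
                 (fun t => 2 * M * X r t)).
      * rewrite (RInt_scal (V := R_CompleteNormedModule) (Y' r)),
          (RInt_scal (V := R_CompleteNormedModule) (X r)); try now apply ex_RInt_second.
        rewrite Y'_integral; trivial.
        unfold scal, plus; simpl; unfold mult; simpl; unfold energy; ring.
      * apply (ex_RInt_scal (V := R_NormedModule)); now apply ex_RInt_second.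
      * apply (ex_RInt_scal (V := R_NormedModule)); now apply ex_RInt_second.
  - unfold energy.
    rewrite (RInt_ext (V := R_CompleteNormedModule) _ (fun _ => 0)).
    + rewrite RInt_const; apply Rmult_0_r.
    + rewrite Rmin_left, Rmax_right by lra; intros t Ht; unfold X.
      rewrite eS_at_r0, eD_at_r0 by trivial; unfold sqmod; simpl; ring.
  - intros r; unfold energy; apply RInt_ge_0; [lra|now apply ex_RInt_second|].
    intros t Ht; unfold X; apply Rmult_le_pos; [lra|].
    apply Rplus_le_le_0_compat; apply sqmod_ge_0.
Qed.

Lemma defects_vanish r t : 0 < r < rho -> 0 < t < 1 -> eS r t = RtoC 0 /\ eD r t = RtoC 0.
Proof.
  intros Hr Ht.
  assert (HX : X r t = 0).
  { apply RInt_zero_nonneg; trivial.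
    - intros x; now apply cont_second.
    - intros s Hs; unfold X; apply Rmult_le_pos; [lra|].
      apply Rplus_le_le_0_compat; apply sqmod_ge_0.
    - exact (energy_zero r Hr). }
  unfold X in HX.
  assert (H1 := sqmod_ge_0 (eS r t)); assert (H2 := sqmod_ge_0 (eD r t)).
  assert (H : sqmod (eS r t) + sqmod (eD r t) = 0).
  { apply Rmult_integral in HX; destruct HX; lra. }
  split; apply sqmod_0; lra.
Qed.

Lemma kernel_identity_G r t : 0 < r < rho -> 0 < t < 1 ->
  (RtoC r * (Gr r t - p r * G r t)
   + (RtoC (1 - t) * (Gt r t - Kt r t) - (G r t - K r t)))%C = RtoC 0.
Proof.
  intros Hr Ht; destruct (defects_vanish r t Hr Ht) as [E1 E2].
  replace (_ + _)%C with (RtoC (1 / 2) * (eS r t + eD r t))%C.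
  - rewrite E1, E2; ring.
  - unfold eS, eD; rewrite RtoC_mult, RtoC_div by lra; field.
Qed.

Lemma kernel_identity_K r t : 0 < r < rho -> 0 < t < 1 ->
  (RtoC r * (Kr r t - - p r * K r t)
   + (RtoC (1 - t) * (Kt r t - Gt r t) - (K r t - G r t)))%C = RtoC 0.
Proof.
  intros Hr Ht; destruct (defects_vanish r t Hr Ht) as [E1 E2].
  replace (_ + _)%C with (RtoC (1 / 2) * (eS r t - eD r t))%C.
  - rewrite E1, E2; ring.
  - unfold eS, eD; rewrite RtoC_mult, RtoC_div by lra; field.
Qed.

End Kernels.

(** * Intertwining with the Euler and rotation fields *)

(** For h with partial derivatives hx, hy: the derivatives x hx + y hy and
    - y hx + x hy. *)
Definition eulerC (hx hy : C -> C) (z : C) : C :=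
  (RtoC (Re z) * hx z + RtoC (Im z) * hy z)%C.
Definition rotC (hx hy : C -> C) (z : C) : C :=
  (RtoC (Re z) * hy z - RtoC (Im z) * hx z)%C.

Lemma C1dir_1_partial Omega h hx z : C1dir Omega (RtoC 1) h hx -> Omega z ->
  is_derC (fun s => h (s, Im z)) (Re z) (hx z).
Proof.
  intros [_ [_ Hd]] Hz.
  apply is_derC_ext_loc with (fun s => h (z + RtoC (s - Re z) * RtoC 1)%C).
  { apply filter_forall; intros s; f_equal; apply Ceq; simpl; unfold Re, Im; ring. }
  eapply is_derC_eq.
  - apply (is_derC_comp (fun s => h (z + RtoC s * RtoC 1)%C) (fun s => s - Re z) (Re z) (hx z) 1).
    + rewrite Rminus_diag; now apply Hd.
    + auto_derive; trivial; ring.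
  - apply Cmult_1_l.
Qed.

Lemma C1dir_i_partial Omega h hy z : C1dir Omega Ci h hy -> Omega z ->
  is_derC (fun s => h (Re z, s)) (Im z) (hy z).
Proof.
  intros [_ [_ Hd]] Hz.
  apply is_derC_ext_loc with (fun s => h (z + RtoC (s - Im z) * Ci)%C).
  { apply filter_forall; intros s; f_equal; apply Ceq; simpl; unfold Re, Im; ring. }
  eapply is_derC_eq.
  - apply (is_derC_comp (fun s => h (z + RtoC s * Ci)%C) (fun s => s - Im z) (Im z) (hy z) 1).
    + rewrite Rminus_diag; now apply Hd.
    + auto_derive; trivial; ring.
  - apply Cmult_1_l.
Qed.

Lemma is_derive_line_2d (f fx fy : C -> R) (Omega : C -> Prop) (w z : C) :
  open Omega -> Omega w ->
  (forall v, Omega v -> is_derive (fun s => f (s, Im v)) (Re v) (fx v)) ->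
  (forall v, Omega v -> is_derive (fun s => f (Re v, s)) (Im v) (fy v)) ->
  continuous fx w ->
  is_derive (fun s => f (w + RtoC s * z)%C) 0 (Re z * fx w + Im z * fy w).
Proof.
  intros Ho Hw Hx Hy Hc.
  destruct w as [x y], z as [a b]; simpl in *.
  assert (HF : filterdiff (fun u : R * R => f (fst u, snd u)) (locally (x, y))
    (fun u : R * R => fst u * fx (x, y) + snd u * fy (x, y))).
  { apply (is_derive_filterdiff (fun s t => f (s, t)) x y (fun s t => fx (s, t)) (fy (x, y))).
    - generalize (Ho _ Hw); apply filter_imp; intros [s t] Hst; exact (Hx (s, t) Hst).
    - exact (Hy (x, y) Hw).
    - apply continuous_ext with fx; [now intros []|exact Hc]. }
  apply (filterdiff_differentiable_pt_lim (fun s t => f (s, t)) x y) in HF.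
  assert (Hl : forall u v : R, is_derive (fun s => u + s * v) 0 v).
  { intros u v; auto_derive; trivial; ring. }
  apply is_derive_ext with (fun s => f (x + s * a, y + s * b)).
  { intros s; f_equal; unfold Cplus, Cmult, RtoC; simpl; f_equal; ring. }
  apply is_derive_Reals.
  replace (a * fx (x, y) + b * fy (x, y)) with (fx (x, y) * a + fy (x, y) * b) by ring.
  apply (derivable_pt_lim_comp_2d (fun s t => f (s, t)) (fun s => x + s * a) (fun s => y + s * b)).
  - now rewrite !Rmult_0_l, !Rplus_0_r.
  - apply is_derive_Reals, Hl.
  - apply is_derive_Reals, Hl.
Qed.

Lemma C1dir_any Omega h hx hy w z : open Omega ->
  C1dir Omega (RtoC 1) h hx -> C1dir Omega Ci h hy -> Omega w ->
  is_derC (fun s => h (w + RtoC s * z)%C) 0 (RtoC (Re z) * hx w + RtoC (Im z) * hy w)%C.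
Proof.
  intros Ho Hx Hy Hw.
  assert (Px := fun v Hv => C1dir_1_partial Omega h hx v Hx Hv).
  assert (Py := fun v Hv => C1dir_i_partial Omega h hy v Hy Hv).
  apply is_derC_of_cpt; intros i; eapply is_derive_eq.
  - apply (is_derive_line_2d (fun v => cpt i (h v)) (fun v => cpt i (hx v)) (fun v => cpt i (hy v))
             Omega w z Ho Hw).
    + intros v Hv; apply (is_derC_cpt (fun s => h (s, Im v))); now apply Px.
    + intros v Hv; apply (is_derC_cpt (fun s => h (Re v, s))); now apply Py.
    + apply (continuous_cpt hx); now apply Hx.
  - destruct i; simpl; unfold Re, Im; ring.
Qed.

(** The radial kernel s G(r, 1 - s^2) of the transmutation operator. *)
Definition sker (G : R -> R -> C) (r s : R) : C :=
  (RtoC (clamp 0 1 s) * G r (1 - clamp 0 1 s ^ 2)%R)%C.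

Lemma jcont_sker G : jcont G -> jcont (sker G).
Proof.
  intros HG [r s]; unfold sker; cont.
Qed.

(** The transmutation operator of the kernel [G]. *)
Definition Tr (G : R -> R -> C) (h : C -> C) (z : C) : C := (h z + VI (sker G) h z)%C.

(** The derivative of [Tr G h] in the direction [e]. *)
Definition Trd (e : C) (G Gr : R -> R -> C) (h h' : C -> C) (z : C) : C :=
  (h' z + VId e (sker G) (sker Gr) h h' z)%C.

Lemma cont_of_jcont N r x : jcont N -> contC (N r) x.
Proof. intros HN; apply (jcont_comp N (fun _ => r) (fun s => s) x HN); cont. Qed.

Section Intertwining.

Variable rho : R.
Hypothesis Hrho : 0 < rho.
Variables G Gr Gt K Kt : R -> R -> C.
Variable p : R -> C.
Hypothesis HG : jcont G.
Hypothesis HGr : jcont Gr.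
Hypothesis HK : jcont K.
Hypothesis HGd : forall r t, 0 < r < rho -> 0 < t < 1 -> is_derC (G r) t (Gt r t).
Hypothesis HKd : forall r t, 0 < r < rho -> 0 < t < 1 -> is_derC (K r) t (Kt r t).
Hypothesis HGrd : forall r t, 0 < r < rho -> 0 < t < 1 -> is_derC (fun s => G s t) r (Gr r t).
Hypothesis Hid : forall r t, 0 < r < rho -> 0 < t < 1 ->
  (RtoC r * (Gr r t - p r * G r t)
   + (RtoC (1 - t) * (Gt r t - Kt r t) - (G r t - K r t)))%C = RtoC 0.
Hypothesis Hbd : forall r, 0 < r < rho -> (G r 0 - K r 0)%C = (RtoC (2 * r) * p r)%C.
Hypothesis HK0 : forall t, 0 <= t <= 1 -> K 0 t = RtoC 0.

Lemma sker_at_0 N s : (forall t, 0 <= t <= 1 -> N 0 t = RtoC 0) -> sker N 0 s = RtoC 0.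
Proof.
  intros HN; unfold sker; rewrite HN; [ring|].
  assert (H := clamp_sqr_in s); lra.
Qed.

(** The integrand is the derivative of s^2 / 2 (G - K)(r, 1 - s^2) phi(s), by
    the first-order identity at t = 1 - s^2. *)
Lemma radial_by_parts (phi phi' : R -> C) r : 0 < r < rho ->
  (forall s, contC phi s) -> (forall s, contC phi' s) ->
  (forall s, 0 < s < 1 -> is_derC phi s (phi' s)) ->
  RIntC (fun s => RtoC r * (sker Gr r s - p r * sker G r s) * phi s
     + RtoC (clamp 0 1 s / 2) * (sker G r s - sker K r s) * phi' s)%C 0 1
  = (RtoC r * p r * phi 1)%C.
Proof.
  intros Hr Hc Hc' Hd.
  set (B := fun s => (RtoC (s ^ 2 / 2) * (G r (1 - s ^ 2)%R - K r (1 - s ^ 2)%R) * phi s)%C).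
  assert (JGs := jcont_sker G HG); assert (JGrs := jcont_sker Gr HGr);
    assert (JKs := jcont_sker K HK).
  rewrite (RIntC_derivative_interior B).
  - unfold B; replace (1 - 1 ^ 2) with 0 by ring.
    rewrite Hbd by trivial; rewrite !RtoC_mult, !RtoC_div, !RtoC_pow by lra; cfield.
  - lra.
  - intros s Hs; unfold B.
    assert (Ht : 0 < 1 - s ^ 2 < 1) by (simpl; nra).
    assert (Hsd : is_derive (fun s => 1 - s ^ 2) s (- (2 * s))) by (auto_derive; trivial; ring).
    assert (E := Hid r (1 - s ^ 2) Hr Ht).
    eapply is_derC_eq.
    + apply (is_derC_mult (fun s => RtoC (s ^ 2 / 2) * (G r (1 - s ^ 2)%R - K r (1 - s ^ 2)%R))%C
               phi); [|now apply Hd].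
      apply (is_derC_mult (fun s => RtoC (s ^ 2 / 2))
               (fun s => G r (1 - s ^ 2)%R - K r (1 - s ^ 2)%R)%C).
      * apply (is_derC_RtoC (fun s => s ^ 2 / 2) s s); auto_derive; trivial; field.
      * apply (is_derC_minus (fun s => G r (1 - s ^ 2)) (fun s => K r (1 - s ^ 2))).
        -- apply (is_derC_comp (G r) (fun s => 1 - s ^ 2)); [now apply HGd|exact Hsd].
        -- apply (is_derC_comp (K r) (fun s => 1 - s ^ 2)); [now apply HKd|exact Hsd].
    + unfold sker; rewrite clamp_id by lra.
      ceq.
      replace (1 - (1 - s ^ 2)) with (s ^ 2) in E by ring.
      match type of E with ?l = _ => set (g := l) in * end.
      match goal with |- ?a = ?b => replace a with (b - RtoC s * phi s * g)%C end.
      * rewrite E; ring.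
      * unfold g; rewrite RtoC_opp, !RtoC_div, !RtoC_mult, !RtoC_pow by lra; cfield.
  - intros s _; unfold B, Rdiv; cont.
  - intros s; unfold Rdiv; cont.
Qed.

Lemma ex_RIntC_sker N r : jcont N -> ex_RIntC (sker N r) 0 1.
Proof. intros HN; apply ex_RIntC_continuous; intros s _; now apply cont_of_jcont, jcont_sker. Qed.

(** For r > 0, the previous lemma with phi = 1 expresses the mean of
    s G_r(r, 1 - s^2) through p(r); then r tends to 0. *)
Lemma sker_Gr_mean_zero : contC p 0 -> p 0 = RtoC 0 -> RIntC (sker Gr 0) 0 1 = RtoC 0.
Proof.
  intros Hpc Hp0.
  set (h := fun r => (RIntC (sker Gr r) 0 1 - p r * (RtoC 1 + RIntC (sker G r) 0 1))%C).
  assert (Hh : h 0 = RtoC 0).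
  { assert (HI : forall N, jcont N -> contC (fun r => RIntC (sker N r) 0 1) 0).
    { intros N HN; apply (continuous_RIntC_param (sker N)); [lra| |].
      - apply filter_forall; intros r s _; now apply cont_of_jcont, jcont_sker.
      - intros s _; now apply jcont_sker. }
    apply (zero_by_density h 0).
    - assert (I1 := HI Gr HGr); assert (I2 := HI G HG); unfold h; cont.
    - intros P HP; destruct (locally_R_meets_itv 0 rho 0 P Hrho ltac:(lra) HP) as [r [HPr Hr]].
      exists r; split; trivial; unfold h.
      assert (E := radial_by_parts (fun _ => RtoC 1) (fun _ => RtoC 0) r Hr
        (fun _ => continuous_const _ _) (fun _ => continuous_const _ _)
        (fun s _ => is_derC_const _ s)).
      rewrite (RIntC_ext _
        (fun s => RtoC r * (sker Gr r s - p r * sker G r s))%C) in E.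
      2:{ intros s _; cring. }
      assert (I1 := ex_RIntC_sker Gr r HGr); assert (I2 := ex_RIntC_sker G r HG).
      assert (I3 : ex_RIntC (fun s => p r * sker G r s)%C 0 1).
      { now apply ex_RIntC_scal. }
      rewrite RIntC_scal, RIntC_minus, RIntC_scal in E; trivial.
      2:{ now apply (ex_RInt_minus (V := C_R_NormedModule)). }
      assert (Hr0 : RtoC r <> RtoC 0) by (apply RtoC_neq_0; lra).
      set (A := RIntC (sker Gr r) 0 1) in *; set (B := RIntC (sker G r) 0 1) in *.
      replace (A - p r * (RtoC 1 + B))%C
        with ((RtoC r * (A - p r * B) - RtoC r * p r * RtoC 1) / RtoC r)%C by (field; trivial).
      rewrite E; field; trivial. }
  unfold h in Hh; rewrite Hp0 in Hh.
  replace (RIntC (sker Gr 0) 0 1)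
    with (RIntC (sker Gr 0) 0 1 - RtoC 0 * (RtoC 1 + RIntC (sker G 0) 0 1))%C by ring.
  exact Hh.
Qed.

Lemma sker_derivative r s : 0 < r < rho -> is_derC (fun r => sker G r s) r (sker Gr r s).
Proof.
  intros Hr; unfold sker; eapply is_derC_eq.
  - apply (is_derC_mult (fun _ => RtoC (clamp 0 1 s)) (fun r => G r (1 - clamp 0 1 s ^ 2)));
      [apply is_derC_const|].
    apply (is_derC_edge G Gr 0 rho 0 1); trivial; [lra|].
    assert (H := clamp_sqr_in s); lra.
  - cring.
Qed.

Variable Omega : C -> Prop.
Hypothesis Hopen : open Omega.
Hypothesis Hstar : star_shaped0 Omega.
Hypothesis HOrho : forall z, Omega z -> Cmod z < rho.

Lemma eulerC_cont hx hy : cont_in Omega hx -> cont_in Omega hy -> cont_in Omega (eulerC hx hy).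
Proof.
  intros Hx Hy z Hz; unfold eulerC.
  destruct (proj1 (continuous_C_iff (fun z : C => z) z) (continuous_id z)) as [Hr Hi].
  specialize (Hx z Hz); specialize (Hy z Hz); cont.
Qed.

Lemma rotC_cont hx hy : cont_in Omega hx -> cont_in Omega hy -> cont_in Omega (rotC hx hy).
Proof.
  intros Hx Hy z Hz; unfold rotC.
  destruct (proj1 (continuous_C_iff (fun z : C => z) z) (continuous_id z)) as [Hr Hi].
  specialize (Hx z Hz); specialize (Hy z Hz); cont.
Qed.

Lemma dotC_1 z : dotC (RtoC 1) z = Re z.
Proof. unfold dotC; simpl; ring. Qed.

Lemma dotC_i z : dotC Ci z = Im z.
Proof. unfold dotC; simpl; ring. Qed.

Lemma RtoC_scale_Re k z : Re (RtoC k * z)%C = k * Re z.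
Proof. simpl; unfold Re; ring. Qed.

Lemma RtoC_scale_Im k z : Im (RtoC k * z)%C = k * Im z.
Proof. simpl; unfold Im; ring. Qed.

Lemma VI_euler hx hy N z : jcont N -> cont_in Omega hx -> cont_in Omega hy -> Omega z ->
  VI N (eulerC hx hy) z =
  (RtoC (Re z) * VI (fun r s => N r s * RtoC (clamp 0 1 s ^ 2)) hx z
   + RtoC (Im z) * VI (fun r s => N r s * RtoC (clamp 0 1 s ^ 2)) hy z)%C.
Proof.
  intros HN Hx Hy Hz; unfold VI.
  assert (HN2 := jcont_mult _ _ HN jcont_clamp_sqr).
  assert (I1 := VI_integrable Omega Hstar _ hx z HN2 Hx Hz).
  assert (I2 := VI_integrable Omega Hstar _ hy z HN2 Hy Hz).
  rewrite <- !RIntC_scal by trivial.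
  rewrite <- RIntC_plus.
  - apply RIntC_ext; intros s _; unfold eulerC.
    rewrite RtoC_scale_Re, RtoC_scale_Im, !RtoC_mult; cring.
  - now apply ex_RIntC_scal.
  - now apply ex_RIntC_scal.
Qed.

Lemma VI_rot hx hy N z : jcont N -> cont_in Omega hx -> cont_in Omega hy -> Omega z ->
  VI N (rotC hx hy) z =
  (RtoC (Re z) * VI (fun r s => N r s * RtoC (clamp 0 1 s ^ 2)) hy z
   - RtoC (Im z) * VI (fun r s => N r s * RtoC (clamp 0 1 s ^ 2)) hx z)%C.
Proof.
  intros HN Hx Hy Hz.
  rewrite (VI_ext Omega Hstar N _ (eulerC hy (fun w => - hx w)%C)); trivial.
  2:{ intros w _; unfold rotC, eulerC; ring. }
  rewrite VI_euler, (VI_opp Omega Hstar); trivial; [ring|now apply jcont_mult, jcont_clamp_sqr|].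
  intros w Hw; now apply continuous_Copp, Hx.
Qed.

(** The rotation field commutes with the operator. *)
Lemma Tr_rot h hx hy z : C1dir Omega (RtoC 1) h hx -> C1dir Omega Ci h hy -> Omega z ->
  rotC (Trd (RtoC 1) G Gr h hx) (Trd Ci G Gr h hy) z = Tr G (rotC hx hy) z.
Proof.
  intros Hx Hy Hz; unfold Tr.
  rewrite VI_rot; trivial; try now apply jcont_sker.
  2: apply Hx. 2: apply Hy.
  unfold rotC, Trd, VId; rewrite dotC_1, dotC_i.
  unfold Rdiv; rewrite !RtoC_mult; ring.
Qed.

Lemma ray_continuous h z s : cont_in Omega h -> Omega z ->
  contC (fun s => h (RtoC (clamp 0 1 s ^ 2) * z)%C) s.
Proof.
  intros Hh Hz; apply (continuous_on_ray Omega Hstar h (fun _ => z) (fun s => s)); trivial; cont.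
Qed.

Lemma ray_derivative h hx hy z s : C1dir Omega (RtoC 1) h hx -> C1dir Omega Ci h hy ->
  Omega z -> 0 < s < 1 ->
  is_derC (fun s => h (RtoC (clamp 0 1 s ^ 2) * z)%C) s
    (RtoC (2 * clamp 0 1 s) * (RtoC (Re z) * hx (RtoC (clamp 0 1 s ^ 2) * z)
       + RtoC (Im z) * hy (RtoC (clamp 0 1 s ^ 2) * z)))%C.
Proof.
  intros Hx Hy Hz Hs; rewrite clamp_id by lra.
  assert (Hs2 : 0 <= s ^ 2 <= 1) by (simpl; nra).
  set (w := (RtoC (s ^ 2) * z)%C).
  assert (Hw : Omega w) by now apply Hstar.
  apply is_derC_ext_loc with (fun u => h (w + RtoC (u ^ 2 - s ^ 2) * z)%C).
  { generalize (locally_itv 0 1 s Hs); apply filter_imp; intros u Hu; f_equal; unfold w.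
    rewrite clamp_id by lra; rewrite RtoC_minus; ring. }
  apply (is_derC_comp (fun v => h (w + RtoC v * z)%C) (fun u => u ^ 2 - s ^ 2)).
  - rewrite Rminus_diag; now apply (C1dir_any Omega).
  - auto_derive; trivial; ring.
Qed.

(** x d/dx + y d/dy - r p on the left of T_G becomes x d/dx + y d/dy on the
    right of T_K. *)
Lemma Tr_euler h hx hy z : C1dir Omega (RtoC 1) h hx -> C1dir Omega Ci h hy -> Omega z ->
  (eulerC (Trd (RtoC 1) G Gr h hx) (Trd Ci G Gr h hy) z
   - RtoC (Cmod z) * p (Cmod z) * Tr G h z)%C = Tr K (eulerC hx hy) z.
Proof.
  intros Hx Hy Hz.
  assert (Hh := proj1 Hx); assert (Hhx := proj1 (proj2 Hx)); assert (Hhy := proj1 (proj2 Hy)).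
  destruct (classic (z = RtoC 0)) as [->|Hn].
  { unfold Tr, VI; rewrite Cmod_0.
    rewrite (RIntC_ext
      (fun s => sker K 0 s * eulerC hx hy (RtoC (clamp 0 1 s ^ 2) * RtoC 0))%C (fun _ => RtoC 0 * RtoC 0)%C).
    2:{ intros s _; rewrite sker_at_0 by trivial; cring. }
    rewrite RIntC_scal.
    - unfold eulerC; simpl; ring.
    - apply ex_RIntC_continuous; intros; apply continuous_const. }
  assert (Hr : 0 < Cmod z < rho) by (split; [now apply Cmod_gt_0|now apply HOrho]).
  set (r := Cmod z) in *.
  set (phi := fun s => h (RtoC (clamp 0 1 s ^ 2) * z)%C).
  set (phi' := fun s => (RtoC (2 * clamp 0 1 s) * (RtoC (Re z) * hx (RtoC (clamp 0 1 s ^ 2) * z)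
       + RtoC (Im z) * hy (RtoC (clamp 0 1 s ^ 2) * z)))%C).
  assert (Hphi : forall s, contC phi s) by (intros; now apply ray_continuous).
  assert (Hphi' : forall s, contC phi' s).
  { assert (Cx := fun s => ray_continuous hx z s Hhx Hz).
    assert (Cy := fun s => ray_continuous hy z s Hhy Hz).
    intros s; unfold phi'; cont. }
  assert (P := radial_by_parts phi phi' r Hr Hphi Hphi'
    (fun s Hs => ray_derivative h hx hy z s Hx Hy Hz Hs)).
  assert (E1 : phi 1 = h z).
  { unfold phi; rewrite clamp_id by lra; f_equal; rewrite pow1; ring. }
  rewrite E1 in P.
  assert (JGs := jcont_sker G HG); assert (JGrs := jcont_sker Gr HGr);
    assert (JKs := jcont_sker K HK).
  assert (J : forall f : R -> C, (forall s, contC f s) -> ex_RIntC f 0 1).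
  { intros f Hf; apply ex_RIntC_continuous; intros; apply Hf. }
  assert (Q : (RtoC r * VI (sker Gr) h z - RtoC r * p r * VI (sker G) h z
               + (VI (sker G) (eulerC hx hy) z - VI (sker K) (eulerC hx hy) z))%C
              = (RtoC r * p r * h z)%C).
  { rewrite <- P.
    assert (EV : forall N, VI (sker N) (eulerC hx hy) z
      = RIntC (fun s => RtoC (clamp 0 1 s / 2) * sker N r s * phi' s)%C 0 1).
    { intros N; unfold VI; apply RIntC_ext; intros s _.
      unfold eulerC, phi', r; rewrite RtoC_scale_Re, RtoC_scale_Im.
      ceq.
      rewrite RtoC_div, !RtoC_mult, RtoC_pow by lra; cfield. }
    rewrite !EV.
    unfold VI; fold r.
    change (RIntC (fun s => sker Gr r s * h (RtoC (clamp 0 1 s ^ 2) * z))%C 0 1)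
      with (RIntC (fun s => sker Gr r s * phi s)%C 0 1).
    change (RIntC (fun s => sker G r s * h (RtoC (clamp 0 1 s ^ 2) * z))%C 0 1)
      with (RIntC (fun s => sker G r s * phi s)%C 0 1).
    assert (J1 : ex_RIntC (fun s => sker Gr r s * phi s)%C 0 1) by (apply J; intros s; cont).
    assert (J2 : ex_RIntC (fun s => sker G r s * phi s)%C 0 1) by (apply J; intros s; cont).
    assert (J3 : forall N, jcont (sker N) ->
      ex_RIntC (fun s => RtoC (clamp 0 1 s / 2) * sker N r s * phi' s)%C 0 1).
    { intros N HN; apply J; intros s; unfold Rdiv; cont. }
    assert (J3G := J3 G JGs); assert (J3K := J3 K JKs).
    rewrite <- (RIntC_scal (RtoC r)) by trivial.
    rewrite <- (RIntC_scal (RtoC r * p r)%C) by trivial.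
    rewrite <- (RIntC_minus (fun s => RtoC (clamp 0 1 s / 2) * sker G r s * phi' s)%C) by trivial.
    rewrite <- RIntC_minus.
    2, 3: now apply ex_RIntC_scal.
    rewrite <- RIntC_plus.
    - apply RIntC_ext; intros s _; cring.
    - apply (ex_RInt_minus (V := C_R_NormedModule)); now apply ex_RIntC_scal.
    - now apply (ex_RInt_minus (V := C_R_NormedModule)). }
  assert (EE := VI_euler hx hy (sker G) z (jcont_sker G HG) Hhx Hhy Hz).
  unfold Tr.
  replace (eulerC (Trd (RtoC 1) G Gr h hx) (Trd Ci G Gr h hy) z)
    with (eulerC hx hy z + RtoC r * VI (sker Gr) h z + VI (sker G) (eulerC hx hy) z)%C.
  - replace (VI (sker K) (eulerC hx hy) z)
      with (VI (sker G) (eulerC hx hy) z + RtoC r * VI (sker Gr) h z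
            - RtoC r * p r * VI (sker G) h z - RtoC r * p r * h z)%C.
    + ring.
    + rewrite <- Q; ring.
  - rewrite EE; unfold eulerC, Trd, VId; rewrite dotC_1, dotC_i; fold r.
    assert (Er : RtoC r = (RtoC (Re z) * RtoC (Re z / r) + RtoC (Im z) * RtoC (Im z / r))%C).
    { rewrite <- !RtoC_mult, <- RtoC_plus; f_equal.
      assert (Hm := Cmod_pair_sqr z); fold r in Hm.
      apply Rmult_eq_reg_r with r; [|lra].
      replace (r * r) with (r ^ 2) by ring; rewrite Hm; field; lra. }
    rewrite Er at 1; ring.
Qed.

End Intertwining.

(** * Extension of the given kernels to the whole plane *)

(** Boundedness on the rectangle, from uniform continuity: a segment from the
    corner (0, 0) is crossed in finitely many steps, each changing the modulus by
    less than 1. *)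
Lemma jcont_bounded (N : R -> R -> C) (rho : R) : jcont N -> 0 <= rho ->
  exists M, 0 < M /\ forall r t, 0 <= r <= rho -> 0 <= t <= 1 -> Cmod (N r t) <= M.
Proof.
  intros HN Hrho.
  destruct (uniform_continuity_2d (fun r t => Cmod (N r t)) 0 rho 0 1) with (eps := mkposreal 1 Rlt_0_1)
    as [d Hd].
  { intros x y _ _; apply continuity_2d_pt_filterlim.
    exact (continuous_Cmod_comp (fun q : R * R => N (fst q) (snd q)) (x, y) (HN (x, y))). }
  destruct (INR_unbounded ((rho + 1) / d)) as [n Hn].
  assert (Hdp := cond_pos d).
  assert (Hn0 : 0 < INR n).
  { apply Rlt_trans with (2 := Hn); apply Rdiv_lt_0_compat; lra. }
  assert (Hstep : (rho + 1) / INR n < d).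
  { apply Rmult_lt_reg_r with (INR n); trivial.
    replace ((rho + 1) / INR n * INR n) with (rho + 1) by (field; lra).
    apply Rmult_lt_reg_r with (/ d); [now apply Rinv_0_lt_compat|].
    replace (d * INR n * / d) with (INR n) by (field; lra); exact Hn. }
  exists (Cmod (N 0 0) + INR n + 1); split.
  { generalize (Cmod_ge_0 (N 0 0)); lra. }
  intros r t Hr Ht.
  assert (H : forall k, (k <= n)%nat ->
    Cmod (N (r * (INR k / INR n)) (t * (INR k / INR n))) <= Cmod (N 0 0) + INR k).
  { induction k as [|k IH]; intros Hk.
    - simpl; unfold Rdiv; rewrite !Rmult_0_l, !Rmult_0_r; lra.
    - assert (IHk := IH ltac:(lia)).
      assert (Hk0 : 0 <= INR k) by apply pos_INR.
      assert (Hkn : INR (S k) <= INR n) by now apply le_INR.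
      rewrite S_INR in *.
      assert (Hi : 0 < / INR n) by now apply Rinv_0_lt_compat.
      assert (Q1 : 0 <= INR k / INR n) by (unfold Rdiv; apply Rmult_le_pos; lra).
      assert (Q2 : (INR k + 1) / INR n <= 1).
      { apply Rmult_le_reg_r with (INR n); trivial.
        replace ((INR k + 1) / INR n * INR n) with (INR k + 1) by (field; lra); lra. }
      assert (Q3 : (INR k + 1) / INR n = INR k / INR n + / INR n) by (field; lra).
      assert (Hs := Hd (r * (INR k / INR n)) (t * (INR k / INR n))
                       (r * ((INR k + 1) / INR n)) (t * ((INR k + 1) / INR n))
                    ltac:(split; nra) ltac:(split; nra) ltac:(split; nra) ltac:(split; nra)).
      assert (Hd1 : forall x, 0 <= x <= rho + 1 ->
        Rabs (x * ((INR k + 1) / INR n) - x * (INR k / INR n)) < d).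
      { intros x Hx; rewrite Q3; replace (_ - _) with (x * / INR n) by ring.
        rewrite Rabs_pos_eq by nra.
        apply Rle_lt_trans with (2 := Hstep); unfold Rdiv; nra. }
      specialize (Hs (Hd1 r ltac:(lra)) (Hd1 t ltac:(lra))); simpl in Hs; apply Rabs_def2 in Hs; lra. }
  specialize (H n (Nat.le_refl n)).
  replace (INR n / INR n) with 1 in H by (field; lra).
  rewrite !Rmult_1_r in H; lra.
Qed.

(** Equality of mixed derivatives that are continuous in a rectangle. *)
Lemma Schwarz_rect (f fx fy fxy fyx : R -> R -> R) (a b c d x y : R) :
  (forall x y, a < x < b -> c < y < d ->
     is_derive (fun s => f s y) x (fx x y) /\ is_derive (f x) y (fy x y) /\
     is_derive (fx x) y (fxy x y) /\ is_derive (fun s => fy s y) x (fyx x y)) ->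
  a < x < b -> c < y < d ->
  continuous (fun p : R * R => fxy (fst p) (snd p)) (x, y) ->
  continuous (fun p : R * R => fyx (fst p) (snd p)) (x, y) ->
  fxy x y = fyx x y.
Proof.
  intros Hd Hx Hy C1 C2.
  assert (Lx : locally x (fun s => a < s < b)) by now apply locally_itv.
  assert (Ly : locally y (fun s => c < s < d)) by now apply locally_itv.
  assert (D1 : forall u v, a < u < b -> c < v < d ->
    is_derive (fun z => Derive (fun t => f z t) v) u (fyx u v)).
  { intros u v Hu Hv; apply is_derive_ext_loc with (fun s => fy s v).
    - generalize (locally_itv _ _ _ Hu); apply filter_imp; intros s Hs.
      symmetry; apply is_derive_unique; now apply Hd.
    - now apply Hd. }
  assert (D2 : forall u v, a < u < b -> c < v < d ->
    is_derive (fun z => Derive (fun t => f t z) u) v (fxy u v)).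
  { intros u v Hu Hv; apply is_derive_ext_loc with (fx u).
    - generalize (locally_itv _ _ _ Hv); apply filter_imp; intros s Hs.
      symmetry; apply is_derive_unique; now apply Hd.
    - now apply Hd. }
  assert (L2 : locally_2d (fun u v => a < u < b /\ c < v < d) x y).
  { destruct Lx as [e1 He1], Ly as [e2 He2].
    exists (mkposreal _ (Rmin_stable_in_posreal e1 e2)); simpl; intros u v Hu Hv; split.
    - apply He1; eapply Rlt_le_trans; [exact Hu|apply Rmin_l].
    - apply He2; eapply Rlt_le_trans; [exact Hv|apply Rmin_r]. }
  rewrite <- (is_derive_unique _ _ _ (D1 x y Hx Hy)), <- (is_derive_unique _ _ _ (D2 x y Hx Hy)).
  symmetry; apply Schwarz.
  - revert L2; apply locally_2d_impl, locally_2d_forall; intros u v [Hu Hv].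
    destruct (Hd u v Hu Hv) as [E1 [E2 _]].
    split; [|split; [|split]]; eexists; eauto.
  - apply continuity_2d_pt_ext_loc with fyx; [|now apply continuity_2d_pt_filterlim].
    revert L2; apply locally_2d_impl, locally_2d_forall; intros u v [Hu Hv].
    symmetry; apply is_derive_unique; now apply D1.
  - apply continuity_2d_pt_ext_loc with fxy; [|now apply continuity_2d_pt_filterlim].
    revert L2; apply locally_2d_impl, locally_2d_forall; intros u v [Hu Hv].
    symmetry; apply is_derive_unique; now apply D2.
Qed.

(** The extension of a function on [0, rho] x [0, 1] by its values at the
    nearest points of the rectangle. *)
Definition rect_ext (rho : R) (u : C -> C) (r t : R) : C := u (clamp 0 rho r, clamp 0 1 t).

Section RectangleExtension.

Variable rho : R.
Hypothesis Hrho : 0 < rho.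

Lemma rect_ext_in u r t : 0 <= r <= rho -> 0 <= t <= 1 -> rect_ext rho u r t = u (r, t).
Proof. intros Hr Ht; unfold rect_ext; now rewrite !clamp_id. Qed.

Lemma jcont_rect_ext u :
  continuous_on (fun p : C => 0 <= fst p <= rho /\ 0 <= snd p <= 1) u ->
  jcont (rect_ext rho u).
Proof.
  intros Hu x; unfold rect_ext.
  apply (continuous_of_continuous_on (U := C_UniformSpace) (V := C_UniformSpace)
    (fun p : C => 0 <= fst p <= rho /\ 0 <= snd p <= 1) u
    (fun q : R * R => (clamp 0 rho (fst q), clamp 0 1 (snd q)))); trivial.
  - intros y; simpl; split; apply clamp_in; lra.
  - apply continuous_pairR.
    + apply (continuous_comp (fun q : R * R => fst q) (clamp 0 rho));
        [destruct x; apply continuous_fst|apply continuous_clamp].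
    + apply (continuous_comp (fun q : R * R => snd q) (clamp 0 1));
        [destruct x; apply continuous_snd|apply continuous_clamp].
Qed.

Lemma rect_ext_der_r u r t l : 0 < r < rho -> 0 < t < 1 ->
  is_derC (fun s => u (s, t)) r l -> is_derC (fun s => rect_ext rho u s t) r l.
Proof.
  intros Hr Ht; apply is_derC_ext_loc.
  generalize (locally_itv _ _ _ Hr); apply filter_imp; intros s Hs.
  now rewrite rect_ext_in by lra.
Qed.

Lemma rect_ext_der_t u r t l : 0 < r < rho -> 0 < t < 1 ->
  is_derC (fun s => u (r, s)) t l -> is_derC (rect_ext rho u r) t l.
Proof.
  intros Hr Ht; apply is_derC_ext_loc.
  generalize (locally_itv _ _ _ Ht); apply filter_imp; intros s Hs.
  now rewrite rect_ext_in by lra.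
Qed.

Lemma kernel_extension q G : is_kernel rho q G ->
  exists H Hr Ht Hrr Hrt,
    C2rect rho H Hr Ht Hrr Hrt /\
    (forall r t, 0 <= r <= rho -> 0 <= t <= 1 -> H r t = G r t) /\
    (forall r t, 0 < r < rho -> 0 < t < 1 ->
       (RtoC r * (Hrr r t - q r * H r t) - Hr r t + RtoC (2 * (1 - t)) * Hrt r t)%C = RtoC 0) /\
    (forall t, 0 <= t <= 1 -> H 0 t = RtoC 0) /\
    (forall r, 0 <= r <= rho -> H r 0 = RIntC (fun tau => RtoC tau * q tau)%C 0 r).
Proof.
  intros [[Hc [u [v [[Hu [uu [uv [[Huu _] [[Huv _] Hdu]]]]]
    [[Hv [vu [vv [[Hvu _] [_ Hdv]]]]] Hd]]]]] [Heq [Hb H0]]].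
  set (g := fun p : C => G (fst p) (snd p)) in *.
  assert (DG : forall r t, 0 < r < rho -> 0 < t < 1 ->
    is_derC (fun s => G s t) r (u (r, t)) /\ is_derC (G r) t (v (r, t)) /\
    is_derC (fun s => u (s, t)) r (uu (r, t)) /\ is_derC (fun s => u (r, s)) t (uv (r, t)) /\
    is_derC (fun s => v (s, t)) r (vu (r, t))).
  { intros r t Hr Ht.
    destruct (Hd (r, t) (conj Hr Ht)) as [A1 A2].
    destruct (Hdu (r, t) (conj Hr Ht)) as [A3 A4].
    destruct (Hdv (r, t) (conj Hr Ht)) as [A5 A6].
    exact (conj A1 (conj A2 (conj A3 (conj A4 A5)))). }
  assert (Juv := jcont_rect_ext uv Huv); assert (Jvu := jcont_rect_ext vu Hvu).
  assert (Hmix : forall r t, 0 < r < rho -> 0 < t < 1 ->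
    rect_ext rho uv r t = rect_ext rho vu r t).
  { intros r t Hr Ht; apply Ceq_cpt; intros i.
    apply (Schwarz_rect (fun r t => cpt i (G r t)) (fun r t => cpt i (u (r, t)))
      (fun r t => cpt i (v (r, t))) (fun r t => cpt i (rect_ext rho uv r t))
      (fun r t => cpt i (rect_ext rho vu r t)) 0 rho 0 1); trivial.
    - intros x y Hx Hy; destruct (DG x y Hx Hy) as [A1 [A2 [A3 [A4 A5]]]].
      rewrite !rect_ext_in by lra.
      split; [exact (is_derC_cpt _ _ _ i A1)|split; [exact (is_derC_cpt _ _ _ i A2)|]].
      split; [exact (is_derC_cpt _ _ _ i A4)|exact (is_derC_cpt _ _ _ i A5)].
    - now apply (continuous_cpt (fun q : R * R => rect_ext rho uv (fst q) (snd q))).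
    - now apply (continuous_cpt (fun q : R * R => rect_ext rho vu (fst q) (snd q))). }
  exists (rect_ext rho g), (rect_ext rho u), (rect_ext rho v), (rect_ext rho uu), (rect_ext rho uv).
  split; [split|split; [|split; [|split]]].
  - split; [|split; [|split; [|split]]]; apply jcont_rect_ext; assumption.
  - intros r t Hr Ht; destruct (DG r t Hr Ht) as [A1 [A2 [A3 [A4 A5]]]].
    split; [|split; [|split; [|split]]].
    + apply (rect_ext_der_r g); trivial; rewrite rect_ext_in by lra; exact A1.
    + apply (rect_ext_der_t g); trivial; rewrite rect_ext_in by lra; exact A2.
    + apply (rect_ext_der_r u); trivial; rewrite rect_ext_in by lra; exact A3.
    + apply (rect_ext_der_t u); trivial; rewrite rect_ext_in by lra; exact A4.
    + apply (rect_ext_der_r v); trivial; rewrite Hmix, rect_ext_in by lra; exact A5.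
  - intros r t Hr Ht; now rewrite rect_ext_in.
  - intros r t Hr Ht; rewrite !rect_ext_in by lra.
    destruct (DG r t Hr Ht) as [A1 [A2 [A3 [A4 A5]]]].
    assert (E1 : forall r t, 0 < r < rho -> 0 < t < 1 -> DeriveC (fun s => G s t) r = u (r, t)).
    { intros x y Hx Hy; apply DeriveC_unique; now apply DG. }
    assert (E2 : DeriveC (fun s => DeriveC (fun s => G s t) s) r = uu (r, t)).
    { apply DeriveC_unique, is_derC_ext_loc with (fun s => u (s, t)); trivial.
      generalize (locally_itv _ _ _ Hr); apply filter_imp; intros s Hs; symmetry; now apply E1. }
    assert (E3 : DeriveC (fun s => DeriveC (fun r => G r s) r) t = uv (r, t)).
    { apply DeriveC_unique, is_derC_ext_loc with (fun s => u (r, s)); trivial.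
      generalize (locally_itv _ _ _ Ht); apply filter_imp; intros s Hs; symmetry; now apply E1. }
    assert (E := Heq r t Hr Ht); cbv beta zeta in E.
    rewrite E2, E3, E1 in E by trivial; exact E.
  - intros t Ht; rewrite rect_ext_in by lra; now apply H0.
  - intros r Hr; rewrite rect_ext_in by lra; now apply Hb.
Qed.

End RectangleExtension.

(** What is needed of a kernel [N] and its derivative [N'] in r for the operator
    h + VI N h to be bijective on C^1 functions. *)
Definition volterra_kernel (rho : R) (N N' : R -> R -> C) (cb : R) : Prop :=
  jcont N /\ jcont N' /\ 0 < cb /\
  (forall r s, 0 < r < rho -> is_derC (fun r => N r s) r (N' r s)) /\
  RIntC (N' 0) 0 1 = RtoC 0 /\
  kernel_bound rho cb N /\
  (forall r s, 0 <= r < rho -> 0 <= s <= 1 -> Cmod (N' r s) <= cb).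

Lemma sker_volterra rho G Gr Gt Grr Grt :
  0 < rho -> C2rect rho G Gr Gt Grr Grt -> (forall t, 0 <= t <= 1 -> G 0 t = RtoC 0) ->
  RIntC (sker Gr 0) 0 1 = RtoC 0 ->
  exists cb, volterra_kernel rho (sker G) (sker Gr) cb.
Proof.
  intros Hrho HC HG0 Hm.
  assert (JG : jcont G) by apply HC.
  assert (JGr : jcont Gr) by (destruct HC as [[_ [H _]] _]; exact H).
  destruct (jcont_bounded Gr rho JGr ltac:(lra)) as [M [HM Hb]].
  exists M; split; [now apply jcont_sker|]; split; [now apply jcont_sker|].
  split; [trivial|]; split; [|split; [trivial|split]].
  - intros r s Hr; apply (sker_derivative rho G Gr JG JGr); trivial.
    intros r' t' Hr' Ht'; now apply (proj2 HC).
  - intros r s Hr Hs; unfold sker; rewrite clamp_id by trivial.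
    assert (Ht : 0 <= 1 - s ^ 2 <= 1) by (simpl; nra).
    rewrite Cmod_mult, Cmod_R, Rabs_pos_eq by lra.
    assert (HGr : Cmod (G r (1 - s ^ 2)) <= r * M).
    { replace (G r (1 - s ^ 2)) with (G r (1 - s ^ 2)%R - G 0 (1 - s ^ 2)%R)%C
        by (rewrite HG0 by trivial; ring).
      assert (Hcf : forall N, jcont N -> forall x, contC (fun r => N r (1 - s ^ 2)) x).
      { intros N HN x; apply (jcont_comp N (fun r => r) (fun _ => 1 - s ^ 2)); trivial;
          [apply continuous_id|apply continuous_const]. }
      rewrite <- (RIntC_derivative_interior (fun r => G r (1 - s ^ 2)) (fun r => Gr r (1 - s ^ 2))).
      - replace (r * M) with ((r - 0) * M) by ring.
        apply Cmod_RIntC_le_const; [lra| |].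
        + apply ex_RIntC_continuous; intros x _; now apply Hcf.
        + intros x Hx; apply Hb; lra.
      - lra.
      - intros x Hx; apply (C2rect_edge_r rho G Gr Gt Grr Grt); trivial; lra.
      - intros x _; now apply Hcf.
      - intros x; now apply Hcf. }
    assert (s * Cmod (G r (1 - s ^ 2)) <= s * (r * M)) by (apply Rmult_le_compat_l; lra).
    assert (0 <= s * (r * M)) by (apply Rmult_le_pos; [lra|apply Rmult_le_pos; lra]).
    lra.
  - intros r s Hr Hs; unfold sker; rewrite clamp_id by trivial.
    assert (Ht : 0 <= 1 - s ^ 2 <= 1) by (simpl; nra).
    rewrite Cmod_mult, Cmod_R, Rabs_pos_eq by lra.
    rewrite <- (Rmult_1_l M); apply Rmult_le_compat; [lra|apply Cmod_ge_0|lra|].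
    apply Hb; trivial; lra.
Qed.

(** * C^1 functions and the polar form of the equations *)

Lemma C1dir_ext (Omega : C -> Prop) (e : C) (h k h' : C -> C) : open Omega -> (forall z, Omega z -> h z = k z) ->
  C1dir Omega e h h' -> C1dir Omega e k h'.
Proof.
  intros Ho E [H1 [H2 H3]]; split; [|split]; trivial.
  - intros z Hz; apply (continuous_ext_loc (T := C_UniformSpace) (U := C_UniformSpace) k h);
      [|now apply H1].
    generalize (Ho z Hz); apply filter_imp; exact E.
  - intros z Hz; apply is_derC_ext_loc with (fun s => h (z + RtoC s * e)%C); [|now apply H3].
    generalize (locally_line_in Omega Ho z e Hz); apply filter_imp; intros s; apply E.
Qed.

Lemma C1dir_unique Omega e h h1 h2 z : C1dir Omega e h h1 -> C1dir Omega e h h2 ->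
  Omega z -> h1 z = h2 z.
Proof.
  intros [_ [_ H1]] [_ [_ H2]] Hz; eapply is_derC_unique; [now apply H1|now apply H2].
Qed.

Lemma Ck1_C1dir Omega h : open Omega -> Ck 1 Omega Omega h ->
  exists hx hy, C1dir Omega (RtoC 1) h hx /\ C1dir Omega Ci h hy.
Proof.
  intros Ho [Hc [hx [hy [[Hx _] [[Hy _] Hd]]]]].
  assert (HI : forall k, continuous_on Omega k -> cont_in Omega k).
  { intros k Hk z Hz; apply (continuous_continuous_on Omega k z); trivial; now apply Ho. }
  exists hx, hy; split; (split; [now apply HI|split; [now apply HI|]]); intros z Hz;
    destruct (Hd z Hz) as [D1 D2].
  - apply is_derC_ext_loc with (fun s => h (Re z + s, Im z)).
    { apply filter_forall; intros s; f_equal; apply Ceq; simpl; unfold Re, Im; ring. }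
    eapply is_derC_eq.
    + apply (is_derC_comp (fun s => h (s, Im z)) (fun s => Re z + s) 0 (hx z) 1).
      * rewrite Rplus_0_r; exact D1.
      * auto_derive; trivial; ring.
    + apply Cmult_1_l.
  - apply is_derC_ext_loc with (fun s => h (Re z, Im z + s)).
    { apply filter_forall; intros s; f_equal; apply Ceq; simpl; unfold Re, Im; ring. }
    eapply is_derC_eq.
    + apply (is_derC_comp (fun s => h (Re z, s)) (fun s => Im z + s) 0 (hy z) 1).
      * rewrite Rplus_0_r; exact D2.
      * auto_derive; trivial; ring.
    + apply Cmult_1_l.
Qed.

Lemma C1dir_Ck1 Omega h hx hy : open Omega ->
  C1dir Omega (RtoC 1) h hx -> C1dir Omega Ci h hy -> Ck 1 Omega Omega h.
Proof.
  intros Ho Hx Hy.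
  assert (HI : forall k, cont_in Omega k -> continuous_on Omega k).
  { intros k Hk; apply continuous_on_forall; exact Hk. }
  split; [apply HI, Hx|]; exists hx, hy; split; [|split].
  - split; [apply HI, Hx|exact I].
  - split; [apply HI, Hy|exact I].
  - intros z Hz; split; [now apply (C1dir_1_partial Omega)|now apply (C1dir_i_partial Omega)].
Qed.

Lemma C1dir_Dx Omega h hx z : C1dir Omega (RtoC 1) h hx -> Omega z -> Defs.Dx h z = hx z.
Proof. intros Hx Hz; apply DeriveC_unique; now apply (C1dir_1_partial Omega). Qed.

Lemma C1dir_Dy Omega h hy z : C1dir Omega Ci h hy -> Omega z -> Defs.Dy h z = hy z.
Proof. intros Hy Hz; apply DeriveC_unique; now apply (C1dir_i_partial Omega). Qed.

Lemma Bicomplex_eq (W Z : Bicomplex) : W = Z <-> Sc W = Sc Z /\ Vec W = Vec Z.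
Proof.
  split; [now intros ->|]; destruct W, Z; simpl; now intros [-> ->].
Qed.

Lemma dbar_components (W : C -> Bicomplex) z a b c d :
  Defs.Dx (fun w => Sc (W w)) z = a -> Defs.Dy (fun w => Sc (W w)) z = b ->
  Defs.Dx (fun w => Vec (W w)) z = c -> Defs.Dy (fun w => Vec (W w)) z = d ->
  dbar W z = mkB ((a - d) / RtoC 2)%C ((b + c) / RtoC 2)%C.
Proof.
  intros <- <- <- <-; apply Bicomplex_eq; simpl; rewrite RtoC_div by lra; split; field.
Qed.

Lemma half_eq_iff (a c : C) : (a / RtoC 2)%C = (c / RtoC 2)%C <-> (a - c)%C = RtoC 0.
Proof.
  split; intros H.
  - replace (a - c)%C with (RtoC 2 * (a / RtoC 2 - c / RtoC 2))%C by field; rewrite H; ring.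
  - replace a with ((a - c) + c)%C by ring; rewrite H; field.
Qed.

(** A first-order equation for W in Cartesian components. *)
Lemma dbar_system Omega W B ax ay bx byy F1 F2 : open Omega ->
  C1dir Omega (RtoC 1) (fun z => Sc (W z)) ax -> C1dir Omega Ci (fun z => Sc (W z)) ay ->
  C1dir Omega (RtoC 1) (fun z => Vec (W z)) bx -> C1dir Omega Ci (fun z => Vec (W z)) byy ->
  (forall z, Omega z -> B z = mkB (F1 z / RtoC 2)%C (F2 z / RtoC 2)%C) ->
  (BCk 1 Omega W /\ (forall z, Omega z -> dbar W z = B z) <-> forall z, Omega z ->
     (ax z - byy z - F1 z)%C = RtoC 0 /\ (ay z + bx z - F2 z)%C = RtoC 0).
Proof.
  intros Ho H1 H2 H3 H4 HB.
  assert (E : forall z, Omega z ->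
    dbar W z = mkB ((ax z - byy z) / RtoC 2)%C ((ay z + bx z) / RtoC 2)%C).
  { intros z Hz; apply dbar_components.
    - now apply (C1dir_Dx Omega).
    - now apply (C1dir_Dy Omega).
    - now apply (C1dir_Dx Omega (fun z => Vec (W z))).
    - now apply (C1dir_Dy Omega (fun z => Vec (W z))). }
  assert (EQ : forall z, Omega z -> (dbar W z = B z <->
     (ax z - byy z - F1 z)%C = RtoC 0 /\ (ay z + bx z - F2 z)%C = RtoC 0)).
  { intros z Hz; rewrite E, HB, Bicomplex_eq by trivial; simpl; now rewrite !half_eq_iff. }
  split.
  - intros [_ H] z Hz; now apply EQ, H.
  - intros H; split.
    + split; [apply (C1dir_Ck1 Omega _ ax ay)|apply (C1dir_Ck1 Omega _ bx byy)]; trivial.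
    + intros z Hz; now apply EQ, H.
Qed.

Lemma continuous_zero_at_origin Omega (F : C -> C) : open Omega -> Omega (RtoC 0) ->
  contC F (RtoC 0) -> (forall z, Omega z -> z <> RtoC 0 -> F z = RtoC 0) ->
  F (RtoC 0) = RtoC 0.
Proof.
  intros Ho H0 Hc HF; apply (zero_by_density F (RtoC 0) Hc); intros P HP.
  destruct (filter_and _ _ HP (Ho _ H0)) as [d Hd].
  assert (Hdp := cond_pos d).
  assert (Hb : P (RtoC (d / 2)) /\ Omega (RtoC (d / 2))).
  { apply Hd; split; apply ball_R; simpl; rewrite Rabs_pos_eq; lra. }
  exists (RtoC (d / 2)); split; [tauto|].
  apply HF; [tauto|]; apply RtoC_neq_0; lra.
Qed.

(** The two polar equations, with [c] for p / r, are the Cartesian ones in a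
    rotated basis. *)
Lemma polar_iff (z ux uy vx vy u v c : C) : z <> RtoC 0 ->
  ((ux - vy - c * (RtoC (Re z) * u + RtoC (Im z) * v))%C = RtoC 0 /\
   (uy + vx - c * (RtoC (Im z) * u - RtoC (Re z) * v))%C = RtoC 0 <->
   ((RtoC (Re z) * ux + RtoC (Im z) * uy) - (RtoC (Re z) * vy - RtoC (Im z) * vx)
     - c * RtoC (Cmod z ^ 2) * u)%C = RtoC 0 /\
   ((RtoC (Re z) * vx + RtoC (Im z) * vy) + (RtoC (Re z) * uy - RtoC (Im z) * ux)
     + c * RtoC (Cmod z ^ 2) * v)%C = RtoC 0).
Proof.
  intros Hn.
  set (x := RtoC (Re z)); set (y := RtoC (Im z)).
  assert (Er : RtoC (Cmod z ^ 2) = (x * x + y * y)%C).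
  { unfold x, y; rewrite Cmod_pair_sqr, <- !RtoC_mult, <- RtoC_plus; f_equal; ring. }
  assert (Hr : (x * x + y * y)%C <> RtoC 0).
  { rewrite <- Er; apply RtoC_neq_0; apply pow_nonzero; intros H; now apply Hn, Cmod_eq_0. }
  rewrite Er; set (A := (ux - vy - c * (x * u + y * v))%C).
  set (B := (uy + vx - c * (y * u - x * v))%C).
  set (P := (x * ux + y * uy - (x * vy - y * vx) - c * (x * x + y * y) * u)%C).
  set (Q := (x * vx + y * vy + (x * uy - y * ux) + c * (x * x + y * y) * v)%C).
  split; intros [H1 H2]; split.
  - replace P with (x * A + y * B)%C by (unfold P, A, B; ring); rewrite H1, H2; ring.
  - replace Q with (x * B - y * A)%C by (unfold Q, A, B; ring); rewrite H1, H2; ring.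
  - replace A with ((x * P - y * Q) / (x * x + y * y))%C
      by (unfold P, Q, A; field; trivial).
    rewrite H1, H2; field; trivial.
  - replace B with ((y * P + x * Q) / (x * x + y * y))%C
      by (unfold P, Q, B; field; trivial).
    rewrite H1, H2; field; trivial.
Qed.

(** The Cartesian and the polar system are equivalent on the whole domain: at
    the origin the polar one is empty, and the Cartesian one holds by
    continuity. *)
Lemma system_polar (Omega : C -> Prop) (ux uy vx vy u v c F1 F2 : C -> C) :
  open Omega -> Omega (RtoC 0) ->
  cont_in Omega ux -> cont_in Omega uy -> cont_in Omega vx -> cont_in Omega vy ->
  cont_in Omega F1 -> cont_in Omega F2 ->
  (forall z, Omega z -> z <> RtoC 0 ->
     F1 z = (c z * (RtoC (Re z) * u z + RtoC (Im z) * v z))%C /\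
     F2 z = (c z * (RtoC (Im z) * u z - RtoC (Re z) * v z))%C) ->
  ((forall z, Omega z ->
      (ux z - vy z - F1 z)%C = RtoC 0 /\ (uy z + vx z - F2 z)%C = RtoC 0) <->
   (forall z, Omega z ->
      (eulerC ux uy z - rotC vx vy z - c z * RtoC (Cmod z ^ 2) * u z)%C = RtoC 0 /\
      (eulerC vx vy z + rotC ux uy z + c z * RtoC (Cmod z ^ 2) * v z)%C = RtoC 0)).
Proof.
  intros Ho H0 Cux Cuy Cvx Cvy CF1 CF2 HF.
  assert (Hoff : forall z, Omega z -> z <> RtoC 0 ->
    ((ux z - vy z - F1 z)%C = RtoC 0 /\ (uy z + vx z - F2 z)%C = RtoC 0 <->
     (eulerC ux uy z - rotC vx vy z - c z * RtoC (Cmod z ^ 2) * u z)%C = RtoC 0 /\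
     (eulerC vx vy z + rotC ux uy z + c z * RtoC (Cmod z ^ 2) * v z)%C = RtoC 0)).
  { intros z Hz Hn; destruct (HF z Hz Hn) as [-> ->]; now apply polar_iff. }
  split; intros H z Hz; destruct (classic (z = RtoC 0)) as [->|Hn];
    try now apply Hoff, H.
  - unfold eulerC, rotC; rewrite Cmod_0; simpl; rewrite !Rmult_0_l; split; ring.
  - specialize (Cux _ H0); specialize (Cuy _ H0); specialize (Cvx _ H0);
      specialize (Cvy _ H0); specialize (CF1 _ H0); specialize (CF2 _ H0).
    split.
    + apply (continuous_zero_at_origin Omega (fun z => ux z - vy z - F1 z)%C Ho H0); [cont|].
      intros w Hw Hn; now apply Hoff, H.
    + apply (continuous_zero_at_origin Omega (fun z => uy z + vx z - F2 z)%C Ho H0); [cont|].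
      intros w Hw Hn; now apply Hoff, H.
Qed.

(** * The logarithmic derivative of f and the transmutation operators *)

Lemma Omega_Cmod_lt Omega rho : open Omega -> Omega (RtoC 0) -> is_sup_modulus Omega rho ->
  0 < rho /\ forall z, Omega z -> Cmod z < rho.
Proof.
  intros Ho H0 [Hub _].
  assert (Hle : forall z, Omega z -> Cmod z <= rho) by (intros z Hz; apply Hub; now exists z).
  assert (Hout : forall z e : C, Omega z -> exists s, 0 < s /\ Omega (z + RtoC s * e)%C).
  { intros z e Hz.
    destruct (locally_R_meets_itv 0 1 0 _ ltac:(lra) ltac:(lra) (locally_line_in Omega Ho z e Hz))
      as [s [Hs Hs']].
    exists s; split; [lra|exact Hs]. }
  assert (Hr : 0 < rho).
  { destruct (Hout (RtoC 0) (RtoC 1) H0) as [s [Hs Hz]].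
    apply Hle in Hz; rewrite Cplus_0_l, Cmult_1_r, Cmod_R, Rabs_pos_eq in Hz; lra. }
  split; trivial; intros z Hz.
  destruct (classic (z = RtoC 0)) as [->|Hn]; [now rewrite Cmod_0|].
  destruct (Hout z z Hz) as [s [Hs Hz']].
  apply Hle in Hz'.
  replace (z + RtoC s * z)%C with (RtoC (1 + s) * z)%C in Hz' by (rewrite RtoC_plus; ring).
  rewrite Cmod_scale in Hz' by lra.
  assert (0 < Cmod z) by now apply Cmod_gt_0. nra.
Qed.

Lemma clamped_continuous (rho : R) (f : R -> C) : 0 < rho ->
  continuous_on (fun r => 0 <= r <= rho) f -> forall r, contC (fun r => f (clamp 0 rho r)) r.
Proof.
  intros Hr Hf r.
  apply (continuous_of_continuous_on (U := R_UniformSpace) (V := C_UniformSpace)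
    (fun r => 0 <= r <= rho) f (clamp 0 rho)); trivial.
  - intros y; apply clamp_in; lra.
  - apply continuous_clamp.
Qed.

Lemma continuous_Cinv {U : UniformSpace} (f : U -> C) x :
  contC f x -> f x <> RtoC 0 -> contC (fun y => / f y)%C x.
Proof.
  intros Hf Hn; apply continuous_C_iff in Hf as [H1 H2].
  assert (Hn' : Re (f x) ^ 2 + Im (f x) ^ 2 <> 0).
  { rewrite <- Cmod_pair_sqr; apply pow_nonzero; intros H; now apply Hn, Cmod_eq_0. }
  assert (Hd : continuous (fun y => Re (f y) ^ 2 + Im (f y) ^ 2) x).
  { cont. }
  apply continuous_C_iff; split.
  - now apply (continuous_Rdiv (fun y => Re (f y)) (fun y => Re (f y) ^ 2 + Im (f y) ^ 2)).
  - apply (continuous_Rdiv (fun y => - Im (f y)) (fun y => Re (f y) ^ 2 + Im (f y) ^ 2)); trivial.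
    now apply (continuous_opp (V := R_NormedModule)).
Qed.

(** The logarithmic derivative p = f' / f, extended continuously, and the
    Riccati equation (r p)' = r (q - p^2) that it satisfies. *)
Lemma log_derivative rho q f : 0 < rho -> Ck_itv 2 0 rho f ->
  (forall r, 0 <= r <= rho -> f r <> RtoC 0) -> radial_solution rho q f ->
  exists p : R -> C, (forall r, contC p r) /\
    (exists M, forall r, 0 < r < rho -> Cmod (p r) <= M) /\
    (forall r, 0 < r < rho -> is_derC f r (f r * p r)%C) /\
    (forall r, 0 < r < rho ->
       is_derC (fun s => RtoC s * p s)%C r (RtoC r * (q r - p r * p r))%C).
Proof.
  intros Hrho [Hf [f1 [[Hf1 [f2 [[Hf2 _] Hd2]]] Hd1]]] Hn Heq.
  assert (Cf := clamped_continuous rho f Hrho Hf).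
  assert (Cf1 := clamped_continuous rho f1 Hrho Hf1).
  set (p := fun r => (f1 (clamp 0 rho r) * / f (clamp 0 rho r))%C).
  assert (Hp : forall r, contC p r).
  { intros r; unfold p; apply continuous_Cmult; [apply Cf1|].
    apply (continuous_Cinv (fun r => f (clamp 0 rho r))); [apply Cf|].
    apply Hn, clamp_in; lra. }
  assert (Hp' : forall r, 0 <= r <= rho -> p r = (f1 r * / f r)%C).
  { intros r Hr; unfold p; now rewrite clamp_id. }
  exists p; split; [trivial|]; split; [|split].
  - destruct (continuity_ab_maj (fun r => Cmod (p r)) 0 rho) as [m [Hm _]]; [lra| |].
    + intros c _; apply continuity_pt_filterlim; exact (continuous_Cmod_comp p c (Hp c)).
    + exists (Cmod (p m)); intros r Hr; apply Hm; lra.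
  - intros r Hr; eapply is_derC_eq; [now apply Hd1|].
    rewrite Hp' by lra; assert (Hn0 := Hn r ltac:(lra)); cfield; trivial.
  - intros r Hr; assert (Hn0 := Hn r ltac:(lra)).
    assert (E : (f2 r + RtoC (1 / r) * f1 r - q r * f r)%C = RtoC 0).
    { assert (E1 : forall s, 0 < s < rho -> DeriveC f s = f1 s)
        by (intros s Hs; apply DeriveC_unique; now apply Hd1).
      assert (E2 : DeriveC (DeriveC f) r = f2 r).
      { apply DeriveC_unique, is_derC_ext_loc with f1; [|now apply Hd2].
        generalize (locally_itv _ _ _ Hr); apply filter_imp; intros s Hs; symmetry; now apply E1. }
      rewrite <- E2, <- (E1 r Hr); exact (Heq r Hr). }
    apply is_derC_ext_loc with (fun s => RtoC s * (f1 s * / f s))%C.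
    { generalize (locally_itv _ _ _ Hr); apply filter_imp; intros s Hs.
      rewrite Hp' by lra; trivial. }
    eapply is_derC_eq.
    + apply (is_derC_mult (fun s => RtoC s) (fun s => f1 s * / f s)%C); [apply is_derC_id|].
      apply (is_derC_mult f1 (fun s => / f s)%C); [now apply Hd2|].
      apply is_derC_inv; [now apply Hd1|trivial].
    + ceq.
      rewrite Hp' by lra; unfold Cdiv.
      assert (Hr0 : RtoC r <> RtoC 0) by (apply RtoC_neq_0; lra).
      rewrite RtoC_div in E by lra.
      match type of E with ?l = _ => set (g := l) in * end.
      match goal with |- ?a = ?b => replace a with (b + RtoC r * g * / f r)%C end.
      * rewrite E; ring.
      * unfold g; field; split; trivial.
Qed.

(** The radial function is of class C^1 at the origin: its derivative there in
    the direction 1 is f'(0) from the right and - f'(0) from the left, so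
    f'(0) = 0. *)
Lemma log_derivative_at_0 Omega rho f fx p : open Omega -> Omega (RtoC 0) -> 0 < rho ->
  Cmod (f 0) <> 0 ->
  C1dir Omega (RtoC 1) (radial f) fx -> (forall r, contC p r) ->
  (forall z, Omega z -> z <> RtoC 0 ->
     fx z = (f (Cmod z) * p (Cmod z) * RtoC (Re z / Cmod z))%C) ->
  p 0 = RtoC 0.
Proof.
  intros Ho H0 Hrho Hf0 Hfx Hp E.
  destruct (locally_line_in Omega Ho (RtoC 0) (RtoC 1) H0) as [d Hd].
  assert (Hdp := cond_pos d).
  assert (Hl : forall s, Rabs s < d -> Omega (RtoC s)).
  { intros s Hs; replace (RtoC s) with (RtoC 0 + RtoC s * RtoC 1)%C by ring.
    apply Hd; apply ball_R.
    now rewrite Rminus_0_r. }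
  assert (Hm : forall e : R, contC (fun s => RtoC (e * s)) 0).
  { intros e; cont. }
  assert (Cx : forall e, contC (fun s => fx (RtoC (e * s))) 0).
  { intros e; apply (continuous_comp (fun s => RtoC (e * s)) fx); [apply Hm|].
    rewrite Rmult_0_r; exact (proj1 (proj2 Hfx) _ H0). }
  assert (Cr : forall e, contC (fun s => radial f (RtoC (e * s))) 0).
  { intros e; apply (continuous_comp (fun s => RtoC (e * s)) (radial f)); [apply Hm|].
    rewrite Rmult_0_r; exact (proj1 Hfx _ H0). }
  assert (P : forall e, Rabs e = 1 -> fx (RtoC 0) = (RtoC e * (f 0 * p 0))%C).
  { intros e He.
    assert (Q : fx (RtoC (e * 0)) = (RtoC e * (radial f (RtoC (e * 0)) * p 0))%C).
    { apply (continuous_eq_closed_itv (fun s => fx (RtoC (e * s)))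
        (fun s => RtoC e * (radial f (RtoC (e * s)) * p s))%C 0 (d / 2)); try lra; trivial.
      - specialize (Cr e); cont.
      - intros s Hs.
        assert (Hes : Rabs (e * s) = s) by (rewrite Rabs_mult, He, Rabs_pos_eq; lra).
        rewrite E.
        + unfold radial; rewrite Cmod_R, Hes; simpl.
          replace (e * s / s) with e by (field; lra); ring.
        + apply Hl; rewrite Hes; lra.
        + apply RtoC_neq_0; intros E0; rewrite E0, Rabs_R0 in Hes; lra. }
    rewrite Rmult_0_r in Q; unfold radial in Q; now rewrite Cmod_0 in Q. }
  assert (P1 := P 1 Rabs_R1).
  assert (P2 := P (-1) ltac:(rewrite Rabs_left; lra)).
  assert (Hz : (f 0 * p 0)%C = RtoC 0).
  { replace (f 0 * p 0)%C
      with ((RtoC 1 * (f 0 * p 0) - RtoC (-1) * (f 0 * p 0)) / RtoC 2)%C.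
    - rewrite <- P1, <- P2; field.
    - replace (RtoC (-1)) with (- RtoC 1)%C by (now rewrite <- RtoC_opp); field. }
  assert (Hfn : f 0 <> RtoC 0) by (intros H; apply Hf0; now rewrite H, Cmod_0).
  apply NNPP; intros Hn; now apply (Cmult_neq_0 _ _ Hfn Hn).
Qed.

Lemma radial_partial Omega rho f p e fe z : (forall z, Omega z -> Cmod z < rho) ->
  C1dir Omega e (radial f) fe -> (forall r, 0 < r < rho -> is_derC f r (f r * p r)%C) ->
  Omega z -> z <> RtoC 0 ->
  fe z = (f (Cmod z) * p (Cmod z) * RtoC (dotC e z / Cmod z))%C.
Proof.
  intros Hrho [_ [_ Hfe]] Hf Hz Hn.
  apply (is_derC_unique (fun s => radial f (z + RtoC s * e)%C) 0); [now apply Hfe|].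
  assert (E0 : (z + RtoC 0 * e)%C = z) by ring.
  unfold radial; eapply is_derC_eq.
  - apply (is_derC_comp f (fun s => Cmod (z + RtoC s * e)%C)).
    + rewrite E0; apply Hf; split; [now apply Cmod_gt_0|now apply Hrho].
    + apply is_derive_Cmod_line; now rewrite E0.
  - rewrite E0; cring.
Qed.

Lemma RIntC_weighted_ext rho (u uc : R -> C) : 0 < rho ->
  (forall r, contC uc r) -> (forall r, 0 < r < rho -> u r = uc r) ->
  forall r, 0 <= r <= rho -> RIntC (fun tau => RtoC tau * u tau)%C 0 r
    = RIntC (fun tau => RtoC tau * uc tau)%C 0 r.
Proof.
  intros Hrho Hc E r Hr; apply RIntC_ext.
  rewrite Rmin_left, Rmax_right by lra; intros s Hs; rewrite E; trivial; lra.
Qed.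

Lemma is_derC_RIntC_upper (v : R -> C) (r : R) : (forall s, contC v s) ->
  is_derC (RIntC v 0) r (v r).
Proof.
  intros Hv; apply (is_derive_RInt (V := C_R_NormedModule) v (RIntC v 0) 0 r); [|apply Hv].
  apply filter_forall; intros y.
  apply RIntC_correct.
  apply ex_RIntC_continuous; intros; apply Hv.
Qed.

Section TransmutedPair.

Variable Omega : C -> Prop.
Hypothesis Hopen : open Omega.
Hypothesis Hstar : star_shaped0 Omega.
Variable rho : R.
Hypothesis HOrho : forall z, Omega z -> Cmod z < rho.

Lemma Top_Tr (G H : R -> R -> C) h z :
  (forall r t, 0 <= r <= rho -> 0 <= t <= 1 -> H r t = G r t) -> Omega z ->
  Top G h z = Tr H h z.
Proof.
  intros E Hz; unfold Top, Tr, VI; f_equal.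
  assert (Hr := HOrho z Hz); assert (Hr0 := Cmod_ge_0 z).
  apply RIntC_ext.
  rewrite Rmin_left, Rmax_right by lra; intros s Hs.
  unfold sker; rewrite clamp_id by lra; rewrite E; trivial; [lra|simpl; nra].
Qed.

Lemma Tr_C1dir G Gr cb e h h' : volterra_kernel rho (sker G) (sker Gr) cb -> e <> RtoC 0 ->
  C1dir Omega e h h' -> C1dir Omega e (Tr G h) (Trd e G Gr h h').
Proof.
  intros [H1 [H2 [_ [H3 [H4 _]]]]] He Hh.
  destruct (VI_C1dir Omega Hopen Hstar rho HOrho _ _ H1 H2 H3 H4 e h h' He Hh) as [A1 [A2 A3]].
  destruct Hh as [B1 [B2 B3]]; split; [|split].
  - intros z Hz; apply continuous_Cplus; [now apply B1|now apply A1].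
  - intros z Hz; apply continuous_Cplus; [now apply B2|now apply A2].
  - intros z Hz; apply (is_derC_plus (fun s => h (z + RtoC s * e)%C)
      (fun s => VI (sker G) h (z + RtoC s * e)%C)); [now apply B3|now apply A3].
Qed.

Lemma Tr_partial G Gr cb e u w w' u' : volterra_kernel rho (sker G) (sker Gr) cb ->
  e <> RtoC 0 -> C1dir Omega e u u' -> C1dir Omega e w w' ->
  (forall z, Omega z -> Tr G u z = w z) ->
  forall z, Omega z -> w' z = Trd e G Gr u u' z.
Proof.
  intros V He Hu Hw E z Hz; apply (C1dir_unique Omega e (Tr G u)); trivial.
  - apply (C1dir_ext Omega e w); trivial; intros y Hy; symmetry; now apply E.
  - now apply (Tr_C1dir G Gr cb).
Qed.

Lemma Tr_surjective G Gr cb w wx wy : volterra_kernel rho (sker G) (sker Gr) cb ->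
  C1dir Omega (RtoC 1) w wx -> C1dir Omega Ci w wy ->
  exists u ux uy, C1dir Omega (RtoC 1) u ux /\ C1dir Omega Ci u uy /\
    forall z, Omega z -> Tr G u z = w z.
Proof.
  intros [H1 [H2 [Hcb [H3 [H4 [H5 H6]]]]]] Hx Hy.
  exists (Neumann (sker G) w).
  assert (S := Neumann_C1dir Omega Hopen Hstar rho HOrho cb Hcb (sker G) H1 H5 (sker Gr) H2 H3 H4 H6).
  destruct (S (RtoC 1) w wx ltac:(apply Cmod_1) Hx) as [ux Hux].
  assert (Hi : Cmod Ci = 1).
  { unfold Cmod, Ci; simpl; replace (0 * (0 * 1) + 1 * (1 * 1)) with 1 by ring; apply sqrt_1. }
  destruct (S Ci w wy Hi Hy) as [uy Huy].
  exists ux, uy; split; [trivial|split; [trivial|]]; intros z Hz.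
  apply (Neumann_solves Omega Hopen Hstar rho HOrho cb Hcb (sker G) H1 H5 w (proj1 Hx) z Hz).
Qed.

Lemma Tr_injective G Gr cb h k : volterra_kernel rho (sker G) (sker Gr) cb ->
  cont_in Omega h -> cont_in Omega k ->
  (forall z, Omega z -> Tr G h z = Tr G k z) -> forall z, Omega z -> h z = k z.
Proof.
  intros [H1 [H2 [Hcb [H3 [H4 [H5 H6]]]]]] Hh Hk E z Hz.
  assert (Hk' : cont_in Omega (fun w => - k w)%C) by (intros w Hw; now apply continuous_Copp, Hk).
  assert (H0 : (h z + - k z)%C = RtoC 0).
  { apply (Volterra_unique Omega Hopen Hstar rho HOrho cb Hcb (sker G) H1 H5
             (fun w => h w + - k w)%C); trivial.
    - intros w Hw; apply continuous_Cplus; [now apply Hh|now apply Hk'].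
    - intros w Hw; rewrite (VI_plus Omega Hstar _ h (fun w => - k w)%C) by trivial.
      rewrite (VI_opp Omega Hstar) by trivial.
      specialize (E w Hw); unfold Tr in E.
      replace (h w + - k w + (VI (sker G) h w + - VI (sker G) k w))%C
        with ((h w + VI (sker G) h w) - (k w + VI (sker G) k w))%C by ring.
      rewrite E; ring. }
  replace (h z) with ((h z + - k z) + k z)%C by ring; rewrite H0; ring.
Qed.

Lemma Tr_ext G h k z : (forall w, Omega w -> h w = k w) -> Omega z -> Tr G h z = Tr G k z.
Proof.
  intros E Hz; unfold Tr; rewrite E by trivial; f_equal; now apply (VI_ext Omega Hstar).
Qed.

Lemma Tr_opp G h z : jcont G -> cont_in Omega h -> Omega z ->
  Tr G (fun w => - h w)%C z = (- Tr G h z)%C.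
Proof.
  intros HG Hh Hz; unfold Tr; rewrite (VI_opp Omega Hstar); trivial; [ring|now apply jcont_sker].
Qed.

End TransmutedPair.

(** * The two kernels of a Vekua equation *)

(** The operator of [G] turns D - r p into D on the side of [K], and commutes
    with the rotation field.  The pair of f and 1/f satisfies this for p = f' / f,
    the pair of 1/f and f for - p. *)
Definition transmuted_pair (Omega : C -> Prop) (G Gr K : R -> R -> C) (p : R -> C) : Prop :=
  forall h hx hy z, C1dir Omega (RtoC 1) h hx -> C1dir Omega Ci h hy -> Omega z ->
    (eulerC (Trd (RtoC 1) G Gr h hx) (Trd Ci G Gr h hy) z
     - RtoC (Cmod z) * p (Cmod z) * Tr G h z)%C = Tr K (eulerC hx hy) z /\
    rotC (Trd (RtoC 1) G Gr h hx) (Trd Ci G Gr h hy) z = Tr G (rotC hx hy) z.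

Lemma kernels_transmute (Omega : C -> Prop) (rho : R) (q f : R -> C) (Gf Gi : R -> R -> C)
    (p : R -> C) :
  open Omega -> star_shaped0 Omega -> 0 < rho -> (forall z, Omega z -> Cmod z < rho) ->
  Ck_itv 1 0 rho q -> (forall r, 0 <= r <= rho -> f r <> RtoC 0) ->
  (forall r, contC p r) -> (exists M, forall r, 0 < r < rho -> Cmod (p r) <= M) ->
  (forall r, 0 < r < rho -> is_derC f r (f r * p r)%C) ->
  (forall r, 0 < r < rho -> is_derC (fun s => RtoC s * p s)%C r (RtoC r * (q r - p r * p r))%C) ->
  p 0 = RtoC 0 ->
  is_kernel rho q Gf -> is_kernel rho (q_inv q f) Gi ->
  exists G Gr K Kr cG cK,
    (forall r t, 0 <= r <= rho -> 0 <= t <= 1 -> G r t = Gf r t) /\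
    (forall r t, 0 <= r <= rho -> 0 <= t <= 1 -> K r t = Gi r t) /\
    jcont G /\ jcont K /\
    volterra_kernel rho (sker G) (sker Gr) cG /\ volterra_kernel rho (sker K) (sker Kr) cK /\
    transmuted_pair Omega G Gr K p /\ transmuted_pair Omega K Kr G (fun r => - p r)%C.
Proof.
  intros Ho Hs Hrho HOr [Hq _] Hnz Hpc [M HpM] Hfp Hpd Hp0 HGf HGi.
  destruct (kernel_extension rho Hrho q Gf HGf)
    as [G [Gr [Gt [Grr [Grt [HG [EG [GEq [G0 Gb]]]]]]]]].
  destruct (kernel_extension rho Hrho (q_inv q f) Gi HGi)
    as [K [Kr [Kt [Krr [Krt [HK [EK [KEq [K0 Kb]]]]]]]]].
  set (qc := fun r => q (clamp 0 rho r)).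
  assert (Cqc : forall r, contC qc r) by (apply (clamped_continuous rho q Hrho Hq)).
  assert (Eqc : forall r, 0 < r < rho -> q r = qc r).
  { intros r Hr; unfold qc; now rewrite clamp_id by lra. }
  assert (Eqi : forall r, 0 < r < rho -> q_inv q f r = (RtoC 2 * (p r * p r) - q r)%C).
  { intros r Hr; unfold q_inv.
    rewrite (DeriveC_unique f r _ (Hfp r Hr)).
    assert (Hn := Hnz r ltac:(lra)); field; trivial. }
  assert (Crid : forall v : R -> C, (forall r, contC v r) -> forall r, contC (fun s => RtoC s * v s)%C r).
  { intros v Hv r; apply continuous_Cmult; [|apply Hv].
    apply continuous_RtoC, continuous_id. }
  assert (Cpp : forall r, contC (fun r => RtoC 2 * (p r * p r) - qc r)%C r).
  { intros r; apply continuous_Cminus; [|apply Cqc].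
    apply continuous_Cmult; [apply continuous_const|]; apply continuous_Cmult; apply Hpc. }
  assert (Gb' : forall r, 0 <= r <= rho -> G r 0 = RIntC (fun tau => RtoC tau * qc tau)%C 0 r).
  { intros r Hr; rewrite Gb by trivial.
    now apply (RIntC_weighted_ext rho q qc Hrho Cqc Eqc). }
  assert (Kb' : forall r, 0 <= r <= rho ->
    K r 0 = RIntC (fun tau => RtoC tau * (RtoC 2 * (p tau * p tau) - qc tau))%C 0 r).
  { intros r Hr; rewrite Kb by trivial.
    apply (RIntC_weighted_ext rho (q_inv q f) (fun r => RtoC 2 * (p r * p r) - qc r)%C Hrho Cpp);
      trivial.
    intros s Hs'; rewrite Eqi, Eqc by trivial; trivial. }
  assert (HGb : forall r, 0 < r < rho -> is_derC (fun s => G s 0) r (RtoC r * q r)%C).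
  { intros r Hr; rewrite Eqc by trivial.
    apply is_derC_ext_loc with (RIntC (fun tau => RtoC tau * qc tau)%C 0).
    - generalize (locally_itv _ _ _ Hr); apply filter_imp; intros s Hs'; symmetry; apply Gb'; lra.
    - apply (is_derC_RIntC_upper (fun tau => RtoC tau * qc tau)%C); now apply Crid. }
  assert (HKb : forall r, 0 < r < rho ->
    is_derC (fun s => K s 0) r (RtoC r * (RtoC 2 * (p r * p r) - q r))%C).
  { intros r Hr; rewrite Eqc by trivial.
    apply is_derC_ext_loc
      with (RIntC (fun tau => RtoC tau * (RtoC 2 * (p tau * p tau) - qc tau))%C 0).
    - generalize (locally_itv _ _ _ Hr); apply filter_imp; intros s Hs'; symmetry; apply Kb'; lra.
    - apply (is_derC_RIntC_upper (fun tau => RtoC tau * (RtoC 2 * (p tau * p tau) - qc tau))%C).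
      now apply (Crid (fun r => RtoC 2 * (p r * p r) - qc r)%C). }
  assert (HGKb : forall r, 0 < r < rho -> (G r 0 - K r 0)%C = (RtoC (2 * r) * p r)%C).
  { intros r Hr; rewrite Gb', Kb' by lra.
    assert (J : forall v : R -> C, (forall s, contC v s) -> ex_RIntC v 0 r).
    { intros v Hv; apply ex_RIntC_continuous; intros; apply Hv. }
    rewrite <- RIntC_minus.
    2:{ apply J; now apply Crid. }
    2:{ apply J; now apply (Crid (fun r => RtoC 2 * (p r * p r) - qc r)%C). }
    rewrite (RIntC_derivative_interior (fun s => RtoC 2 * (RtoC s * p s))%C).
    - rewrite RtoC_mult; ring.
    - lra.
    - intros s Hs'; eapply is_derC_eq.
      + apply (is_derC_mult (fun _ => RtoC 2) (fun s => RtoC s * p s)%C);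
          [apply is_derC_const|apply Hpd; lra].
      + rewrite Eqc by lra; cring.
    - intros s _; apply continuous_Cmult; [apply continuous_const|now apply Crid].
    - intros s; apply continuous_Cminus; [now apply Crid|].
      now apply (Crid (fun r => RtoC 2 * (p r * p r) - qc r)%C). }
  assert (KEq' : forall r t, 0 < r < rho -> 0 < t < 1 ->
    (RtoC r * (Krr r t - (RtoC 2 * (p r * p r) - q r) * K r t) - Kr r t
     + RtoC (2 * (1 - t)) * Krt r t)%C = RtoC 0).
  { intros r t Hr Ht; rewrite <- Eqi by trivial; now apply KEq. }
  assert (IG := kernel_identity_G rho Hrho G Gr Gt Grr Grt K Kr Kt Krr Krt HG HK p q M Hpc HpM Hpd
    GEq KEq' G0 K0 HGb HKb HGKb).
  assert (IK := kernel_identity_K rho Hrho G Gr Gt Grr Grt K Kr Kt Krr Krt HG HK p q M Hpc HpM Hpd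
    GEq KEq' G0 K0 HGb HKb HGKb).
  assert (JG : jcont G) by apply HG.
  assert (JK : jcont K) by apply HK.
  assert (JGr : jcont Gr) by (destruct HG as [[_ [J _]] _]; exact J).
  assert (JKr : jcont Kr) by (destruct HK as [[_ [J _]] _]; exact J).
  assert (HGd : forall r t, 0 < r < rho -> 0 < t < 1 -> is_derC (G r) t (Gt r t)).
  { intros r t Hr Ht; now apply (proj2 HG). }
  assert (HKd : forall r t, 0 < r < rho -> 0 < t < 1 -> is_derC (K r) t (Kt r t)).
  { intros r t Hr Ht; now apply (proj2 HK). }
  assert (HKGb : forall r, 0 < r < rho -> (K r 0 - G r 0)%C = (RtoC (2 * r) * - p r)%C).
  { intros r Hr; assert (E := HGKb r Hr).
    replace (K r 0 - G r 0)%C with (- (G r 0 - K r 0))%C by ring; rewrite E; ring. }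
  assert (Hpc' : forall r, contC (fun r => - p r)%C r) by (intros; now apply continuous_Copp).
  assert (Hp0' : (- p 0)%C = RtoC 0) by (rewrite Hp0; ring).
  assert (MG := sker_Gr_mean_zero rho Hrho G Gr Gt K Kt p JG JGr JK HGd HKd IG HGKb (Hpc 0) Hp0).
  assert (MK := sker_Gr_mean_zero rho Hrho K Kr Kt G Gt (fun r => - p r)%C JK JKr JG HKd HGd IK HKGb
                  (Hpc' 0) Hp0').
  destruct (sker_volterra rho G Gr Gt Grr Grt Hrho HG G0 MG) as [cG VG].
  destruct (sker_volterra rho K Kr Kt Krr Krt Hrho HK K0 MK) as [cK VK].
  exists G, Gr, K, Kr, cG, cK.
  split; [exact EG|split; [exact EK|split; [exact JG|split; [exact JK|]]]].
  split; [exact VG|split; [exact VK|split]].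
  - intros h hx hy z Hx Hy Hz; split.
    + now apply (Tr_euler rho G Gr Gt K Kt p JG JGr JK HGd HKd IG HGKb K0 Omega Ho Hs HOr).
    + now apply (Tr_rot G Gr JG Omega Hs).
  - intros h hx hy z Hx Hy Hz; split.
    + now apply (Tr_euler rho K Kr Kt G Gt (fun r => - p r)%C JK JKr JG HKd HGd IK HKGb G0
                   Omega Ho Hs HOr).
    + now apply (Tr_rot K Kr JK Omega Hs).
Qed.

(** * Transmutation of holomorphic functions *)

Lemma Hol_polar (Omega : C -> Prop) W ax ay bx byy : open Omega -> Omega (RtoC 0) ->
  C1dir Omega (RtoC 1) (fun z => Sc (W z)) ax -> C1dir Omega Ci (fun z => Sc (W z)) ay ->
  C1dir Omega (RtoC 1) (fun z => Vec (W z)) bx -> C1dir Omega Ci (fun z => Vec (W z)) byy ->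
  (Hol Omega W <-> forall z, Omega z ->
     eulerC ax ay z = rotC bx byy z /\ eulerC bx byy z = (- rotC ax ay z)%C).
Proof.
  intros Ho H0 H1 H2 H3 H4; unfold Hol.
  set (O := fun _ : C => RtoC 0).
  assert (CO : cont_in Omega O) by (intros z _; unfold O; cont).
  rewrite (dbar_system Omega W (fun _ => CtoB (RtoC 0)) ax ay bx byy O O Ho H1 H2 H3 H4).
  2:{ intros z _; apply Bicomplex_eq; unfold O; simpl; split; field. }
  rewrite (system_polar Omega ax ay bx byy O O O O O Ho H0); trivial;
    [|exact (proj1 (proj2 H1))|exact (proj1 (proj2 H2))|exact (proj1 (proj2 H3))
    |exact (proj1 (proj2 H4))|intros z _ _; unfold O; split; ring].
  unfold O; split; intros H z Hz; destruct (H z Hz) as [P Q]; split.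
  - replace (eulerC ax ay z) with ((eulerC ax ay z - rotC bx byy z
      - RtoC 0 * RtoC (Cmod z ^ 2) * RtoC 0) + rotC bx byy z)%C by ring; rewrite P; ring.
  - replace (eulerC bx byy z) with ((eulerC bx byy z + rotC ax ay z
      + RtoC 0 * RtoC (Cmod z ^ 2) * RtoC 0) - rotC ax ay z)%C by ring; rewrite Q; ring.
  - rewrite P; ring.
  - rewrite Q; ring.
Qed.

Lemma Vekua_polar (Omega : C -> Prop) rho f p W fx fy ax ay bx byy :
  open Omega -> Omega (RtoC 0) -> (forall z, Omega z -> Cmod z < rho) ->
  (forall r, 0 <= r <= rho -> f r <> RtoC 0) ->
  (forall r, 0 < r < rho -> is_derC f r (f r * p r)%C) ->
  C1dir Omega (RtoC 1) (radial f) fx -> C1dir Omega Ci (radial f) fy ->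
  C1dir Omega (RtoC 1) (fun z => Sc (W z)) ax -> C1dir Omega Ci (fun z => Sc (W z)) ay ->
  C1dir Omega (RtoC 1) (fun z => Vec (W z)) bx -> C1dir Omega Ci (fun z => Vec (W z)) byy ->
  (Vekua Omega f W <-> forall z, Omega z ->
     (eulerC ax ay z - RtoC (Cmod z) * p (Cmod z) * Sc (W z))%C = rotC bx byy z /\
     (eulerC bx byy z - RtoC (Cmod z) * - p (Cmod z) * Vec (W z))%C = (- rotC ax ay z)%C).
Proof.
  intros Ho H0 Hr Hnz Hfp Hfx Hfy H1 H2 H3 H4; unfold Vekua.
  set (F1 := fun z => ((fx z * Sc (W z) + fy z * Vec (W z)) * / radial f z)%C).
  set (F2 := fun z => ((fy z * Sc (W z) - fx z * Vec (W z)) * / radial f z)%C).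
  assert (Hrad : forall z, Omega z -> radial f z <> RtoC 0).
  { intros z Hz; apply Hnz; split; [apply Cmod_ge_0|left; now apply Hr]. }
  assert (CF : forall z, Omega z -> contC F1 z /\ contC F2 z).
  { intros z Hz.
    assert (Ci0 : contC (fun z => / radial f z)%C z).
    { apply (continuous_Cinv (radial f)); [exact (proj1 Hfx z Hz)|now apply Hrad]. }
    assert (C1 := proj1 H1 z Hz); assert (C2 := proj1 H3 z Hz).
    assert (Cx := proj1 (proj2 Hfx) z Hz); assert (Cy := proj1 (proj2 Hfy) z Hz).
    unfold F1, F2; split; cont. }
  rewrite (dbar_system Omega W _ ax ay bx byy F1 F2 Ho H1 H2 H3 H4).
  2:{ intros z Hz; rewrite (dbar_components _ z (fx z) (fy z) (RtoC 0) (RtoC 0)).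
      - apply Bicomplex_eq; simpl; unfold F1, F2; assert (Hn := Hrad z Hz); split; field; trivial.
      - now apply (C1dir_Dx Omega (radial f)).
      - now apply (C1dir_Dy Omega (radial f)).
      - exact (DeriveC_unique (fun _ => RtoC 0) _ _ (is_derC_const _ _)).
      - exact (DeriveC_unique (fun _ => RtoC 0) _ _ (is_derC_const _ _)). }
  rewrite (system_polar Omega ax ay bx byy (fun z => Sc (W z)) (fun z => Vec (W z))
             (fun z => p (Cmod z) / RtoC (Cmod z))%C F1 F2 Ho H0);
    [|exact (proj1 (proj2 H1))|exact (proj1 (proj2 H2))|exact (proj1 (proj2 H3))
    |exact (proj1 (proj2 H4))|exact (fun z Hz => proj1 (CF z Hz))|exact (fun z Hz => proj2 (CF z Hz))|].
  2:{ intros z Hz Hn.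
      assert (Hm : Cmod z <> 0) by (intros E; now apply Hn, Cmod_eq_0).
      assert (Hm0 := RtoC_neq_0 _ Hm); assert (Hn0 := Hrad z Hz).
      assert (Ex := radial_partial Omega rho f p _ fx z Hr Hfx Hfp Hz Hn).
      assert (Ey := radial_partial Omega rho f p _ fy z Hr Hfy Hfp Hz Hn).
      rewrite dotC_1, RtoC_div in Ex by trivial; rewrite dotC_i, RtoC_div in Ey by trivial.
      unfold F1, F2; rewrite Ex, Ey; unfold radial in *; split; field; split; trivial. }
  assert (Ec : forall z, (p (Cmod z) / RtoC (Cmod z) * RtoC (Cmod z ^ 2))%C
               = (RtoC (Cmod z) * p (Cmod z))%C).
  { intros z; destruct (Req_dec (Cmod z) 0) as [->|Hm].
    - rewrite (pow_i 2) by lia; ring.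
    - rewrite RtoC_pow; simpl; field; now apply RtoC_neq_0. }
  split; intros H z Hz; destruct (H z Hz) as [P Q]; rewrite ?Ec in *; split.
  - replace (rotC bx byy z) with (rotC bx byy z + RtoC 0)%C by ring; rewrite <- P; ring.
  - replace (- rotC ax ay z)%C with (- rotC ax ay z + RtoC 0)%C by ring; rewrite <- Q; ring.
  - rewrite <- P; ring.
  - replace (rotC ax ay z) with (- (- rotC ax ay z))%C by ring; rewrite <- Q; ring.
Qed.

Lemma Ck1_of_Ck2_closure (Omega : C -> Prop) h : open Omega ->
  Ck 2 Omega (closure Omega) h -> Ck 1 Omega Omega h.
Proof.
  intros Ho [Hc [hx [hy [[Hx _] [[Hy _] Hd]]]]].
  assert (Hsub : forall z, Omega z -> closure Omega z).
  { intros z Hz P HP; exists z; split; trivial; now apply (locally_singleton z P). }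
  assert (HI : forall k : C -> C, continuous_on (closure Omega) k -> continuous_on Omega k).
  { intros k Hk; now apply (continuous_on_subset (closure Omega) Omega). }
  split; [now apply HI|]; exists hx, hy.
  split; [split; [now apply HI|exact I]|split; [split; [now apply HI|exact I]|exact Hd]].
Qed.

Theorem proposition35
  (Omega : C -> Prop) (rho : R) (q f : R -> C) (Gf Gi : R -> R -> C)
  (HOmega_domain : planar_domain Omega)
  (HOmega_bounded : bounded_set Omega)
  (HOmega_star : star_shaped0 Omega)
  (Hrho : is_sup_modulus Omega rho)
  (Hq : Ck_itv 1 0 rho q)
  (Hf : Ck_itv 2 0 rho f)
  (Hf_nz : forall r : R, (0 <= r <= rho)%R -> f r <> RtoC 0)
  (Hf_eq : radial_solution rho q f)
  (Hf_0 : f 0%R = RtoC 1)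
  (Hf_lim : filterlim (fun r : R => (RtoC r * DeriveC f r)%C)
              (at_right 0%R) (locally (RtoC 0)))
  (Hf_radial : Ck 2 Omega (closure Omega) (radial f))
  (HGf : is_kernel rho q Gf)
  (HGi : is_kernel rho (q_inv q f) Gi) :
  forall W : C -> Bicomplex,
    Vekua Omega f W <->
    exists H : C -> Bicomplex,
      Hol Omega H /\ forall z : C, Omega z -> W z = Tcal Gf Gi H z.
Proof.
  intros W.
  assert (Ho : open Omega) by apply HOmega_domain.
  assert (H0 : Omega (RtoC 0)) by apply HOmega_star.
  destruct (Omega_Cmod_lt Omega rho Ho H0 Hrho) as [Hrho0 HOr].
  destruct (log_derivative rho q f Hrho0 Hf Hf_nz Hf_eq) as [p [Hpc [HpM [Hfp Hpd]]]].
  destruct (Ck1_C1dir Omega (radial f) Ho (Ck1_of_Ck2_closure Omega _ Ho Hf_radial))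
    as [fx [fy [Hfx Hfy]]].
  assert (Hp0 : p 0 = RtoC 0).
  { apply (log_derivative_at_0 Omega rho f fx p); trivial.
    - rewrite Hf_0, Cmod_1; lra.
    - intros z Hz Hn.
      rewrite (radial_partial Omega rho f p _ fx z HOr Hfx Hfp Hz Hn), dotC_1; trivial. }
  destruct (kernels_transmute Omega rho q f Gf Gi p Ho HOmega_star Hrho0 HOr Hq Hf_nz Hpc HpM
    Hfp Hpd Hp0 HGf HGi) as [G [Gr [K [Kr [cG [cK [EG [EK [JG [JK [VG [VK [TG TK]]]]]]]]]]]]].
  assert (Hi : Ci <> RtoC 0).
  { intros E; injection E; lra. }
  assert (H1 : RtoC 1 <> RtoC 0) by (apply RtoC_neq_0; lra).
  assert (ETop : forall H z, Omega z ->
    Tcal Gf Gi H z = mkB (Tr G (fun w => Sc (H w)) z) (Tr K (fun w => Vec (H w)) z)).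
  { intros H z Hz; unfold Tcal.
    now rewrite (Top_Tr Omega rho HOr Gf G), (Top_Tr Omega rho HOr Gi K). }
  split.
  - intros HV.
    destruct (Ck1_C1dir Omega _ Ho (proj1 (proj1 HV))) as [ux [uy [Hux Huy]]].
    destruct (Ck1_C1dir Omega _ Ho (proj2 (proj1 HV))) as [vx [vy [Hvx Hvy]]].
    assert (HP := proj1 (Vekua_polar Omega rho f p W fx fy ux uy vx vy Ho H0 HOr Hf_nz Hfp
                           Hfx Hfy Hux Huy Hvx Hvy) HV).
    destruct (Tr_surjective Omega Ho HOmega_star rho HOr G Gr cG _ ux uy VG Hux Huy)
      as [a [ax [ay [Hax [Hay Ea]]]]].
    destruct (Tr_surjective Omega Ho HOmega_star rho HOr K Kr cK _ vx vy VK Hvx Hvy)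
      as [b [bx [byy [Hbx [Hby Eb]]]]].
    exists (fun z => mkB (a z) (b z)); split.
    2:{ intros z Hz; rewrite ETop by trivial; apply Bicomplex_eq; simpl; split; symmetry.
        - exact (Ea z Hz).
        - exact (Eb z Hz). }
    apply (Hol_polar Omega (fun z => mkB (a z) (b z)) ax ay bx byy Ho H0 Hax Hay Hbx Hby).
    (* the partial derivatives of W are those of the transforms of a and b *)
    assert (Dux := Tr_partial Omega Ho HOmega_star rho HOr G Gr cG _ a _ ux ax VG H1 Hax Hux Ea).
    assert (Duy := Tr_partial Omega Ho HOmega_star rho HOr G Gr cG _ a _ uy ay VG Hi Hay Huy Ea).
    assert (Dvx := Tr_partial Omega Ho HOmega_star rho HOr K Kr cK _ b _ vx bx VK H1 Hbx Hvx Eb).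
    assert (Dvy := Tr_partial Omega Ho HOmega_star rho HOr K Kr cK _ b _ vy byy VK Hi Hby Hvy Eb).
    assert (Cax := proj1 (proj2 Hax)); assert (Cay := proj1 (proj2 Hay)).
    assert (Cbx := proj1 (proj2 Hbx)); assert (Cby := proj1 (proj2 Hby)).
    assert (EQ1 : forall z, Omega z -> Tr K (eulerC ax ay) z = Tr K (rotC bx byy) z).
    { intros z Hz; destruct (TG a ax ay z Hax Hay Hz) as [E1 _].
      destruct (TK b bx byy z Hbx Hby Hz) as [_ E2].
      rewrite <- E1, <- E2; unfold eulerC, rotC.
      rewrite <- Dux, <- Duy, <- Dvx, <- Dvy, Ea by trivial.
      exact (proj1 (HP z Hz)). }
    assert (EQ2 : forall z, Omega z ->
      Tr G (eulerC bx byy) z = Tr G (fun w => - rotC ax ay w)%C z).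
    { intros z Hz; rewrite (Tr_opp Omega HOmega_star G _ z JG) by (trivial; now apply rotC_cont).
      destruct (TG a ax ay z Hax Hay Hz) as [_ E1].
      destruct (TK b bx byy z Hbx Hby Hz) as [E2 _].
      rewrite <- E1, <- E2; unfold eulerC, rotC.
      rewrite <- Dux, <- Duy, <- Dvx, <- Dvy, Eb by trivial.
      exact (proj2 (HP z Hz)). }
    intros z Hz; split.
    + revert z Hz; apply (Tr_injective Omega Ho HOmega_star rho HOr K Kr cK); trivial.
      * now apply eulerC_cont.
      * now apply rotC_cont.
    + revert z Hz.
      apply (Tr_injective Omega Ho HOmega_star rho HOr G Gr cG (eulerC bx byy)
               (fun w => - rotC ax ay w)%C); trivial.
      * now apply eulerC_cont.
      * intros w Hw; apply continuous_Copp; now apply (rotC_cont Omega).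
  - intros [H [HH EW]].
    destruct (Ck1_C1dir Omega _ Ho (proj1 (proj1 HH))) as [ax [ay [Hax Hay]]].
    destruct (Ck1_C1dir Omega _ Ho (proj2 (proj1 HH))) as [bx [byy [Hbx Hby]]].
    assert (HP := proj1 (Hol_polar Omega H ax ay bx byy Ho H0 Hax Hay Hbx Hby) HH).
    set (a := fun z => Sc (H z)) in *; set (b := fun z => Vec (H z)) in *.
    assert (ES : forall z, Omega z -> Tr G a z = Sc (W z)).
    { intros z Hz; now rewrite EW, ETop. }
    assert (EV : forall z, Omega z -> Tr K b z = Vec (W z)).
    { intros z Hz; now rewrite EW, ETop. }
    assert (Cbx := proj1 (proj2 Hbx)); assert (Cax := proj1 (proj2 Hax)).
    assert (Cay := proj1 (proj2 Hay)); assert (Cby := proj1 (proj2 Hby)).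
    apply (Vekua_polar Omega rho f p W fx fy (Trd (RtoC 1) G Gr a ax) (Trd Ci G Gr a ay)
      (Trd (RtoC 1) K Kr b bx) (Trd Ci K Kr b byy) Ho H0 HOr Hf_nz Hfp Hfx Hfy).
    + apply (C1dir_ext Omega (RtoC 1) (Tr G a)); trivial.
      now apply (Tr_C1dir Omega Ho HOmega_star rho HOr G Gr cG).
    + apply (C1dir_ext Omega Ci (Tr G a)); trivial.
      now apply (Tr_C1dir Omega Ho HOmega_star rho HOr G Gr cG).
    + apply (C1dir_ext Omega (RtoC 1) (Tr K b)); trivial.
      now apply (Tr_C1dir Omega Ho HOmega_star rho HOr K Kr cK).
    + apply (C1dir_ext Omega Ci (Tr K b)); trivial.
      now apply (Tr_C1dir Omega Ho HOmega_star rho HOr K Kr cK).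
    + intros z Hz.
      destruct (TG a ax ay z Hax Hay Hz) as [E1 E2].
      destruct (TK b bx byy z Hbx Hby Hz) as [E3 E4].
      rewrite <- ES, <- EV, E1, E2, E3, E4 by trivial; split.
      * apply (Tr_ext Omega HOmega_star); trivial; intros w Hw; now apply HP.
      * rewrite <- (Tr_opp Omega HOmega_star G _ z JG) by (trivial; now apply rotC_cont).
        apply (Tr_ext Omega HOmega_star); trivial; intros w Hw; now apply HP.
Qed.
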